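(* For $m\ge0$ and integers $m_1,m_1'\ge0$ with $m_1+m_1'=m$, let $\varphi^m_{m_1m_1'}={\sf H}_m(x_1^{m_1}x_{1'}^{m_1'})\in\mathcal H_m$. The zonal polynomials $\varphi^m_{m_1m_1'}$, $m_1+m_1'=m$, of $\mathcal H_m$ are orthogonal with respect to the scalar product $\langle\cdot,\cdot\rangle$. These polynomials constitute a full set of zonal polynomials in the space $\mathcal H_m$, i.e. every polynomial in $\mathcal H_m$ that is zonal with respect to $U_q(\mathrm{so}_{N-2})$ is a linear combination of them.
   Context: Let $N=2n$ or $N=2n+1$; put $j'=N-j+1$. Let $q\neq0$ be not a root of unity (with a fixed $q^{1/2}$); $[a]=\frac{1-q^a}{1-q}$, $[a]_q=\frac{q^a-q^{-a}}{q-q^{-1}}$, $(a;p)_s=(1-a)(1-ap)\cdots(1-ap^{s-1})$. Put $(\rho_1,\dots,\rho_N)=(n-\frac12,n-\frac32,\dots,\frac12,0,-\frac12,\dots,-n+\frac12)$ if $N=2n+1$ and $(\rho_1,\dots,\rho_N)=(n-1,\dots,1,0,0,-1,\dots,-n+1)$ if $N=2n$. $\mathcal A$ is the associative unital $\mathbb C$-algebra generated by $x_1,\dots,x_N$ with relations: $x_ix_j=qx_jx_i$ for $i<j$, $i\neq j'$; $x_{i'}x_i-x_ix_{i'}=\frac{q-q^{-1}}{q^{\rho_i-1}+q^{-\rho_i+1}}\sum_{j=i+1}^{(i+1)'}q^{\rho_{j'}}x_jx_{j'}$ for $i<n$; $x_{n'}x_n-x_nx_{n'}=(q^{1/2}-q^{-1/2})x_{n+1}^2$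 if $N=2n+1$; $x_{n'}x_n=x_nx_{n'}$ if $N=2n$. The monomials $\mathbf x^\nu=x_1^{\nu_1}\cdots x_N^{\nu_N}$ form a basis of $\mathcal A$; $\mathcal A_m$ is the span of those with $|\nu|=\nu_1+\dots+\nu_N=m$. $Q=\sum_{i=1}^Nq^{\rho_{i'}}x_ix_{i'}$ (a central element). The $q$-Laplace operator $\Delta_q$ on $\mathcal A$ acts by $$\Delta_q\mathbf x^\nu=(1+q^{N-2})q^{|\nu|-1}\Big(\sum_{j=1}^n[\nu_j]_q[\nu_{j'}]_q\,q^{-\rho_j+d_j}\,\mathbf x^{\nu-\varepsilon_j-\varepsilon_{j'}}+[\nu_{n+1}-1][\nu_{n+1}]\frac{q^{|\nu|-2\nu_{n+1}+2}}{1+q}\,\mathbf x^{\nu-2\varepsilon_{n+1}}\Big),$$ with $d_j=\nu_1+\dots+\nu_{j-1}+\nu_{(j-1)'}+\dots+\nu_{1'}$, $\varepsilon_i$ the $i$th unit vector, last summand omitted if $N=2n$. $\mathcal H_m=\{p\in\mathcal A_m:\Delta_qp=0\}$, $\mathcal H=\{p\in\mathcal A:\Delta_qp=0\}$. It is known that $\mathcal A_m=\mathcal H_m\oplus Q\mathcal A_{m-2}$ (with $\mathcal A_{-1}=\mathcal A_{-2}=0$); ${\sf H}_m:\mathcal A_m\to\mathcal H_m$ is the corresponding projector. Action of $U_q(\mathrm{so}_N)$ (generators $K_i^{\pm1},E_i,F_i$, $i=1,\dots,n$) on $\mathcal A$: let $\hat K_i\triangleright\mathbf x^\nu=q^{\nu_i-\nu_{i'}}\mathbf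 x^\nu$; $K_i=\hat K_i\hat K_{i+1}^{-1}$ for $i<n$, $K_n=\hat K_n$ if $N=2n+1$, $K_n=\hat K_{n-1}\hat K_n$ if $N=2n$. On the $x_j$, all values not listed being $0$: for $k\le n-1$, $E_k\triangleright x_{k+1}=x_k$, $E_k\triangleright x_{k'}=-x_{(k+1)'}$, $F_k\triangleright x_k=x_{k+1}$, $F_k\triangleright x_{(k+1)'}=-x_{k'}$; if $N=2n+1$, $E_n\triangleright x_{n+1}=q^{1/2}x_n$, $E_n\triangleright x_{n+2}=-x_{n+1}$, $F_n\triangleright x_n=q^{-1/2}x_{n+1}$, $F_n\triangleright x_{n+1}=-x_{n+2}$; if $N=2n$, $E_n\triangleright x_{n+1}=x_{n-1}$, $E_n\triangleright x_{n+2}=-x_n$, $F_n\triangleright x_{n-1}=x_{n+1}$, $F_n\triangleright x_n=-x_{n+2}$. These extend to $\mathcal A$ by $E_i\triangleright1=F_i\triangleright1=0$, $E_i\triangleright(ab)=(E_i\triangleright a)b+(K_i\triangleright a)(E_i\triangleright b)$, $F_i\triangleright(ab)=(F_i\triangleright a)(K_i^{-1}\triangleright b)+a(F_i\triangleright b)$. $U_q(\mathrm{so}_{N-2})$ is the subalgebra generated by $K_i^{\pm1},E_i,F_i$, $i=2,\dots,n$. A polynomial $p\in\mathcal H_m$ is zonal with respect to $U_q(\mathrm{so}_{N-2})$ if it is invariant with respect to the action of this subalgebra: $E_i\triangleright p=F_i\triangleright p=0$ and $K_i\triangleright p=p$ for $i=2,\dots,n$. Scalar product: $\mathcal A$ carries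 the $*$-operation (an involutive algebra anti-automorphism) determined by $x_i^*=q^{\rho_{i'}}x_{i'}$, $i=1,\dots,N$. Let $\tau:\mathcal A\to\mathcal F(S_q^{N-1})=\mathcal A/(Q-1)$ be the canonical homomorphism, $(Q-1)$ being the two-sided ideal generated by $Q-1$. The invariant functional $h$ on $\mathcal F(S^{N-1}_q)$ is the linear functional with $h(\tau\mathbf x^\nu)=0$ unless $\nu_j=\nu_{j'}$ for $1\le j\le n$ and (if $N=2n+1$) $\nu_{n+1}=2l$ is even, in which case $$h(\tau\mathbf x^\nu)=\frac{(q^{-2};q^{-2})_{\nu_1}\cdots(q^{-2};q^{-2})_{\nu_n}\,(q^{-1};q^{-2})_l\,(1+q)^l}{q^{\rho_1\nu_1+\dots+\rho_n\nu_n+l}\,(1+q^{N-2})^{\nu_1+\dots+\nu_n+l}\,(q^{-N};q^{-2})_{\nu_1+\dots+\nu_n+l}}$$ ($l=0$ if $N=2n$). On $\mathcal H$: $\langle p_1,p_2\rangle=h((\tau p_1)^*(\tau p_2))$.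
   Formalization: Stated for N ≥ 3. That the φ are zonal is claimed only for N ≠ 4 (for N = 4, F_2 moves x_1 to x_3, so x_1 is not zonal); fullness only for N ≠ 3 (for N = 3 there are no generators i = 2,…,n, so all of H_m, of dimension 2m+1, is zonal). *)

(* Defs.v *)
From HB Require Import structures.
From mathcomp Require Import all_boot all_order all_algebra.
From mathcomp Require Import complex reals.
From mathcomp.multinomials Require Import monalg.

Set Implicit Arguments.
Unset Strict Implicit.
Unset Printing Implicit Defensive.

Import Order.TTheory GRing.Theory Num.Theory.
Local Open Scope ring_scope.

Notation free_alg C N := {malg C[{fmonom 'I_N}]}.

Inductive two_sided_ideal (B : pzRingType) (S : B -> Prop) : B -> Prop :=
| Ideal0 : two_sided_ideal S 0
| IdealGen a : S a -> two_sided_ideal S a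
| IdealD a b : two_sided_ideal S a -> two_sided_ideal S b ->
    two_sided_ideal S (a + b)
| IdealM a l r : two_sided_ideal S a -> two_sided_ideal S (l * a * r).

(* [A], with the projection [pi], is the quotient of [B] by the two-sided ideal
   generated by [S]. *)
Definition is_quotient_by (C : fieldType) (B : lalgType C) (A : algType C)
    (pi : {lrmorphism B -> A}) (S : B -> Prop) : Prop :=
  (forall a, exists b, pi b = a) /\
  (forall b, pi b = 0 <-> two_sided_ideal S b).

Definition lin_span (C : fieldType) (V : lmodType C) (S : V -> Prop) (v : V) :
    Prop :=
  exists (k : nat) (c : 'I_k -> C) (w : 'I_k -> V),
    (forall i, S (w i)) /\ v = \sum_(i < k) c i *: w i.

(* N = 2n or N = 2n + 1, according to [oddN].  All indices are the usual
   1-based ones, as natural numbers in 1..N (or 1..n). *)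
Definition dimN (n : nat) (oddN : bool) : nat := (n.*2 + oddN)%N.

Section QuantumEuclideanSpace.

Variables (C : numClosedFieldType) (n : nat) (oddN : bool).
(* [s] is the fixed square root of [q]. *)
Variables (q s : C).

Local Notation N := (dimN n oddN).

(* j' = N - j + 1 *)
Definition mir (j : nat) : nat := (N - j + 1)%N.

(* 2 rho_i, an integer even when rho_i is not. *)
Definition rho2 (i : nat) : int :=
  if (i <= n)%N then N%:Z - i.*2%:Z
  else if (mir i <= n)%N then (mir i).*2%:Z - N%:Z
  else 0.

(* q ^ rho_i *)
Definition qrho (i : nat) : C := s ^ rho2 i.

Definition qnum (a : int) : C := (1 - q ^ a) / (1 - q).

Definition qnum_sym (a : int) : C := (q ^ a - q ^ (- a)) / (q - q^-1).

Definition qpoch (a p : C) (k : nat) : C := \prod_(0 <= t < k) (1 - a * p ^+ t).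

(* The free generator X_j for 1 <= j <= N, and 0 for other j. *)
Definition free_gen (j : nat) : free_alg C N :=
  if j is k.+1 then
    if insub k is Some i then << fmu i >> else 0
  else 0.

Local Notation X := free_gen.

Inductive qrelator : free_alg C N -> Prop :=
| RelComm i j : (1 <= i)%N -> (i < j)%N -> (j <= N)%N -> i <> mir j ->
    qrelator (X i * X j - q *: (X j * X i))
| RelMirror i : (1 <= i)%N -> (i < n)%N ->
    qrelator (X (mir i) * X i - X i * X (mir i)
      - ((q - q^-1) / (qrho i * q^-1 + (qrho i)^-1 * q)) *:
          \sum_(i.+1 <= j < (mir i.+1).+1) qrho (mir j) *: (X j * X (mir j)))
| RelMiddleOdd : (1 <= n)%N -> oddN ->
    qrelator (X (mir n) * X n - X n * X (mir n) - (s - s^-1) *: X n.+1 ^+ 2)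
| RelMiddleEven : (1 <= n)%N -> ~~ oddN ->
    qrelator (X (mir n) * X n - X n * X (mir n)).

Section Polynomials.

Variables (A : algType C) (pi : {lrmorphism free_alg C N -> A}).

Definition x (j : nat) : A := pi (X j).

(* Exponents are functions on nat, of which only the values at 1..N matter. *)
Definition xmon (nu : nat -> nat) : A := \prod_(1 <= j < N.+1) x j ^+ nu j.

Definition mdegree (nu : nat -> nat) : nat := (\sum_(1 <= j < N.+1) nu j)%N.

(* p is in A_m *)
Definition homog (m : nat) : A -> Prop :=
  lin_span (fun v => exists nu, mdegree nu = m /\ v = xmon nu).

Definition Qelt : A :=
  \sum_(1 <= i < N.+1) qrho (mir i) *: (x i * x (mir i)).

(* p is in Q A_(m-2), which is 0 for m < 2 *)
Definition Qhomog (m : nat) (p : A) : Prop :=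
  if m is k.+2 then exists r, homog k r /\ p = Qelt * r else p = 0.

(* nu - eps_i - eps_j; the truncation only occurs in [is_qlaplace] for terms
   whose coefficient vanishes. *)
Definition lower2 (nu : nat -> nat) (i j : nat) : nat -> nat :=
  fun k => (nu k - (k == i) - (k == j))%N.

Definition dexp (nu : nat -> nat) (j : nat) : nat :=
  (\sum_(1 <= k < j) (nu k + nu (mir k)))%N.

Definition is_qlaplace (D : A -> A) : Prop := forall nu : nat -> nat,
  D (xmon nu) =
  ((1 + q ^ (N%:Z - 2)) * q ^ ((mdegree nu)%:Z - 1)) *:
  (\sum_(1 <= j < n.+1)
     (qnum_sym (nu j)%:Z * qnum_sym (nu (mir j))%:Z
        * ((qrho j)^-1 * q ^+ dexp nu j)) *: xmon (lower2 nu j (mir j))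
   + if oddN then
       (qnum ((nu n.+1)%:Z - 1) * qnum (nu n.+1)%:Z
          * (q ^ ((mdegree nu)%:Z - (nu n.+1).*2%:Z + 2) / (1 + q))) *:
       xmon (lower2 nu n.+1 n.+1)
     else 0).

(* p is in H_m *)
Definition harmonic (D : A -> A) (m : nat) (p : A) : Prop :=
  homog m p /\ D p = 0.

(* On A_m, [P] is the projector onto H_m along Q A_(m-2) in the decomposition
   A_m = H_m (+) Q A_(m-2); its values outside A_m are irrelevant. *)
Definition is_harmonic_projector (D : A -> A) (m : nat) (P : A -> A) : Prop :=
  [/\ forall p, homog m p -> harmonic D m (P p) /\ Qhomog m (p - P p),
      forall p, harmonic D m p -> P p = p
    & forall p, Qhomog m p -> P p = 0].

(* The eigenvalue of \hat K_i on x^nu is q ^ (wt_hat i nu). *)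
Definition wt_hat (i : nat) (nu : nat -> nat) : int :=
  (nu i)%:Z - (nu (mir i))%:Z.

(* The eigenvalue of K_i on x^nu is q ^ (wt i nu), from the expression of K_i
   through the \hat K_j. *)
Definition wt (i : nat) (nu : nat -> nat) : int :=
  if (i < n)%N then wt_hat i nu - wt_hat i.+1 nu
  else if oddN then wt_hat n nu
  else wt_hat n.-1 nu + wt_hat n nu.

Definition E_gen (k j : nat) : A :=
  if (k < n)%N then
    if j == k.+1 then x k else if j == mir k then - x (mir k.+1) else 0
  else if oddN then
    if j == n.+1 then s *: x n else if j == n.+2 then - x n.+1 else 0
  else
    if j == n.+1 then x n.-1 else if j == n.+2 then - x n else 0.

Definition F_gen (k j : nat) : A :=
  if (k < n)%N then
    if j == k then x k.+1 else if j == mir k.+1 then - x (mir k) else 0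
  else if oddN then
    if j == n then s^-1 *: x n.+1 else if j == n.+1 then - x n.+2 else 0
  else
    if j == n.-1 then x n.+1 else if j == n then - x n.+2 else 0.

(* The action of the generators of U_q(so_N); [Kop], [KVop] are the actions of
   K_i and K_i^-1. *)
Record so_action : Type := SoAction {
  Kop : nat -> {linear A -> A};
  KVop : nat -> {linear A -> A};
  Eop : nat -> {linear A -> A};
  Fop : nat -> {linear A -> A};
  Kop_mon : forall i nu, (1 <= i <= n)%N ->
    Kop i (xmon nu) = q ^ wt i nu *: xmon nu;
  KVop_mon : forall i nu, (1 <= i <= n)%N ->
    KVop i (xmon nu) = q ^ (- wt i nu) *: xmon nu;
  Eop_gen : forall i j, (1 <= i <= n)%N -> (1 <= j <= N)%N ->
    Eop i (x j) = E_gen i j;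
  Fop_gen : forall i j, (1 <= i <= n)%N -> (1 <= j <= N)%N ->
    Fop i (x j) = F_gen i j;
  Eop1 : forall i, (1 <= i <= n)%N -> Eop i 1 = 0;
  Fop1 : forall i, (1 <= i <= n)%N -> Fop i 1 = 0;
  EopM : forall i a b, (1 <= i <= n)%N ->
    Eop i (a * b) = Eop i a * b + Kop i a * Eop i b;
  FopM : forall i a b, (1 <= i <= n)%N ->
    Fop i (a * b) = Fop i a * KVop i b + a * Fop i b
}.

(* Invariance under the generators i = 2, ..., n, i.e. under U_q(so_(N-2)).
   Pitfall: for N = 3 there is no such generator and every p is zonal; for
   N = 4 the generators E_2, F_2 span a copy of sl_2 which moves x_1 to x_3. *)
Definition zonal (U : so_action) (p : A) : Prop :=
  forall i, (2 <= i <= n)%N -> [/\ Eop U i p = 0, Fop U i p = 0 & Kop U i p = p].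

(* For real q the *-operation can be taken conjugate-linear; for general
   complex q only the linear anti-automorphism exists.  [antilin] selects
   between the two. *)
Definition is_star (antilin : bool) (star : A -> A) : Prop :=
  [/\ forall a b, star (a + b) = star a + star b,
      forall c a, star (c *: a) = (if antilin then c^* else c) *: star a,
      forall a b, star (a * b) = star b * star a,
      forall a, star (star a) = a
    & forall i, (1 <= i <= N)%N -> star (x i) = qrho (mir i) *: x (mir i)].

Section Sphere.

Variables (FS : algType C) (tau : {lrmorphism A -> FS}).

Definition is_sphere : Prop := is_quotient_by tau (fun a => a = Qelt - 1).

Definition balanced (nu : nat -> nat) : bool :=
  all (fun j => nu j == nu (mir j)) (iota 1 n) && (oddN ==> ~~ odd (nu n.+1)).

Definition half_mid (nu : nat -> nat) : nat := if oddN then (nu n.+1)./2 else 0%N.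

Definition hvalue (nu : nat -> nat) : C :=
  let l := half_mid nu in
  let t := (\sum_(1 <= j < n.+1) nu j + l)%N in
  ((\prod_(1 <= j < n.+1) qpoch (q ^ (-2)) (q ^ (-2)) (nu j))
     * qpoch q^-1 (q ^ (-2)) l * (1 + q) ^+ l)
  / ((\prod_(1 <= j < n.+1) qrho j ^+ nu j) * q ^+ l
     * (1 + q ^ (N%:Z - 2)) ^+ t * qpoch (q ^ (- N%:Z)) (q ^ (-2)) t).

Definition is_invariant_functional (h : {scalar FS}) : Prop :=
  forall nu, h (tau (xmon nu)) = if balanced nu then hvalue nu else 0.

(* As Q^* = Q, the *-operation descends to the sphere: (tau p)^* = tau (p^* ). *)
Definition sprod (star : A -> A) (h : {scalar FS}) (p1 p2 : A) : C :=
  h (tau (star p1) * tau p2).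

End Sphere.

Definition phi (P : nat -> A -> A) (m m1 m1' : nat) : A :=
  P m (x 1 ^+ m1 * x (mir 1) ^+ m1').

End Polynomials.

End QuantumEuclideanSpace.

(* Main.v *)
(* Let Q_i be the quadratic element of the subalgebra generated by x_i, ..., x_{i'}
   (so Q = Q_1).  Straightening writes A as the span of x_1^a y x_{1'}^b with y in
   the subalgebra of x_2, ..., x_{N-1}, and the Laplacian acts on such a product
   through its action on y.  A downward induction on i gives
   Delta (Q_i^k) = theta Q_i^(k-1), so Delta has a two-term action on the zonal
   elements e(a,l,b) = x_1^a Q_2^l x_{1'}^b, and a harmonic combination of the
   e(m1-k,k,m1'-k) is found by solving a recurrence.  As e(a,l,b) is congruent to a
   multiple of e(a+l,0,b+l) modulo Q A, this combination is a nonzero multiple of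
   phi^m_{m1 m1'}.  Thus phi is zonal for N <> 4, and it has weight m1 - m1' under \hat K_1;
   phi^* has the opposite weight and h vanishes on nonzero weights, whence the
   orthogonality.

   For fullness, a Fock representation of the relations shows that the ordered
   monomials are linearly independent.  If E_k p = 0, then the coefficients of p at
   two monomials that differ by moving a pair x_{k+1} x_{(k+1)'} to x_k x_{k'} are
   proportional, so a zonal p is determined by its coefficients at the monomials
   x_1^a x_2^l x_{2'}^l x_{1'}^b, and it is a combination of the e(a,l,b).  When
   N = 4, p is determined by its coefficients at the x_1^a x_4^a, and it is a
   multiple of a power of Q. *)

(* The induction on i works because the relations form a tower: x_{i'} x_i differs from x_i x_{i'}
   by a multiple of Q_{i+1}, which is central in the algebra of the inner generators and
   q^2-commutes with x_i and x_{i'}. The two middle relations fit the same pattern with Q_{n+1}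
   equal to x_{n+1}^2 or 0, so both parities run through one argument.

   The factor between the harmonic combination and phi is never computed: it is nonzero because the
   combination is, and this is read off from one monomial.

   The exceptional dimensions come from the last generators. For N = 4, E_2 and F_2 act on x_1 and
   x_{1'} and link the pair x_2, x_{2'} to them, so Q_2 alone is not invariant and phi need not be
   zonal; fullness survives because the zonal elements there are multiples of powers of Q. For N = 3
   invariance is an empty condition, and x_2 is a harmonic element of degree 1 outside the span of
   x_1 and x_3; fullness therefore excludes N = 3. *)
Require Import Defs.
From HB Require Import structures.
From mathcomp Require Import all_boot all_order all_algebra.
From mathcomp Require Import complex reals.
From mathcomp.multinomials Require Import monalg.
From mathcomp Require Import finmap zify ring.
From mathcomp Require Import boolp functions.

Set Implicit Arguments.
Unset Strict Implicit.
Unset Printing Implicit Defensive.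

Import Order.TTheory GRing.Theory Num.Theory.
Local Open Scope ring_scope.

(** * Linear spans *)

Section LinSpan.

Variables (F : fieldType) (V : lmodType F) (S : V -> Prop).

Lemma lin_span0 : lin_span S 0.
Proof. by exists 0%N, (fun=> 0), (fun=> 0); split=> [[]|]; rewrite ?big_ord0. Qed.

Lemma lin_span_gen v : S v -> lin_span S v.
Proof.
by move=> Sv; exists 1%N, (fun=> 1), (fun=> v); split; rewrite // big_ord1 scale1r.
Qed.

Lemma lin_spanP c u v : lin_span S u -> lin_span S v -> lin_span S (c *: u + v).
Proof.
move=> [k [a [e [Se ->]]]] [l [b [f [Sf ->]]]]; exists (k + l)%N.
exists (fun i => match fintype.split i with inl j => c * a j | inr j => b j end).
exists (fun i => match fintype.split i with inl j => e j | inr j => f j end).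
split; first by move=> i; case: (fintype.split i).
rewrite big_split_ord scaler_sumr; congr (_ + _); apply: eq_bigr => i _.
  by rewrite -[lshift _ _]/(unsplit (inl i)) unsplitK scalerA.
by rewrite -[rshift _ _]/(unsplit (inr i)) unsplitK.
Qed.

Lemma lin_spanZ c v : lin_span S v -> lin_span S (c *: v).
Proof. by move=> Sv; rewrite -[_ *: _]addr0; apply: lin_spanP lin_span0. Qed.

Lemma lin_spanD u v : lin_span S u -> lin_span S v -> lin_span S (u + v).
Proof. by move=> Su Sv; rewrite -[u]scale1r; apply: lin_spanP. Qed.

Lemma lin_span_sum (I : eqType) (r : seq I) (E : I -> V) :
  (forall i, i \in r -> lin_span S (E i)) -> lin_span S (\sum_(i <- r) E i).
Proof.
move=> SE; rewrite big_seq; elim/big_ind: _ => //; first exact: lin_span0.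
exact: lin_spanD.
Qed.

Lemma lin_span_ind (P : V -> Prop) : P 0 ->
    (forall c u v, P u -> P v -> P (c *: u + v)) -> (forall v, S v -> P v) ->
  forall v, lin_span S v -> P v.
Proof.
move=> P0 PD PS v [k [c [w [Sw ->]]]]; elim/big_rec: _ => // i u _.
exact: PD (PS _ (Sw i)).
Qed.

End LinSpan.

(** * Scalars *)

Section QuantumSphere.

Variables (C : numClosedFieldType) (n : nat) (oddN : bool) (q s : C).

Local Notation N := (dimN n oddN).
Local Notation mir := (mir n oddN).
Local Notation qrho := (qrho n oddN s).

Hypothesis N_ge3 : (3 <= N)%N.
Hypothesis q_neq0 : q != 0.
Hypothesis q_nroot : forall k : nat, (0 < k)%N -> q ^+ k != 1.
Hypothesis s_sqrt : s ^+ 2 = q.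

Ltac mlia := repeat match goal with
  | H : context[Defs.mir] |- _ => revert H
  | H : context[dimN] |- _ => revert H end;
  have := leq_b1 oddN; unfold Defs.mir, dimN; lia.

Ltac qfield a := rewrite ?(exprS q a);
  let z := fresh "z" in let z0 := fresh "z_neq0" in
  move: (q ^+ a) (expf_neq0 a q_neq0) => z z0; field; rewrite ?q_neq0 ?z0 //.

Lemma n_gt0 : (0 < n)%N. Proof. by move: N_ge3; mlia. Qed.

Lemma mirK i : (1 <= i <= N)%N -> mir (mir i) = i. Proof. mlia. Qed.

Lemma s_neq0 : s != 0.
Proof. by apply: contraNneq q_neq0 => s0; rewrite -s_sqrt s0 expr0n. Qed.

Lemma expq_inj : injective (fun k : nat => q ^+ k).
Proof.
suff le_inj a b : (a <= b)%N -> q ^+ a = q ^+ b -> a = b.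
  by move=> a b /= e; case/orP: (leq_total a b) => /le_inj; [|move/(_ (esym e))]; auto.
move=> le_ab; rewrite -(subnKC le_ab) exprD => /eqP.
rewrite -[X in X == _]mulr1 (inj_eq (mulfI (expf_neq0 _ q_neq0))) eq_sym.
by case: (posnP (b - a)) => [->|/q_nroot/negPf->//]; rewrite addn0.
Qed.

Lemma expqz_eq1 (a : int) : (q ^ a == 1) = (a == 0).
Proof.
case: a => [[|k]|k]; rewrite ?expr0z ?eqxx //.
  by rewrite -exprnP (negPf (q_nroot _)).
by rewrite NegzE -exprnN -[1]invr1 (inj_eq (@invr_inj _)) (negPf (q_nroot _)).
Qed.

(** If q^a = - q^b, squaring gives a = b because q is not a root of unity, and then 2 q^a = 0. This
    keeps [alp], [w0] and the denominator of [bet] away from zero. *)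
Lemma expqD_neq0 a b : q ^+ a + q ^+ b != 0.
Proof.
apply/negP; rewrite addr_eq0 => /eqP e.
have e2 : q ^+ a.*2 = q ^+ b.*2 by rewrite -!muln2 !exprM e sqrrN.
have eab : a = b by apply: double_inj; exact: expq_inj e2.
move: e; rewrite eab => /eqP; rewrite -addr_eq0 -mulr2n mulrn_eq0 /=.
by rewrite expf_eq0 (negPf q_neq0) andbF.
Qed.

Lemma qrho_neq0 i : qrho i != 0.
Proof. by rewrite expfz_neq0 ?s_neq0. Qed.

Lemma qrhoE i : (i <= n)%N -> qrho i = s ^+ (N - i.*2).
Proof.
move=> le_in; rewrite /Defs.qrho /rho2 le_in subzn // /dimN.
by rewrite (leq_trans _ (leq_addr _ _)) // leq_double.
Qed.

Lemma sqr_qrho i : (i <= n)%N -> qrho i ^+ 2 = q ^+ (N - i.*2).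
Proof. by move=> le_in; rewrite qrhoE // -exprM mulnC exprM s_sqrt. Qed.

Lemma qrho_mir i : (1 <= i <= n)%N -> qrho (mir i) = (qrho i)^-1.
Proof.
case/andP=> i_gt0 le_in; rewrite /Defs.qrho invr_expz; congr (s ^ _).
rewrite /rho2 le_in.
have -> : (mir i <= n)%N = false by mlia.
rewrite mirK; last by mlia.
by rewrite le_in opprB.
Qed.

Lemma qrhoS i : (1 <= i)%N -> (i < n)%N -> qrho i = q * qrho i.+1.
Proof.
move=> i_gt0 lt_in; rewrite !qrhoE // ?(ltnW lt_in) // -s_sqrt -exprD.
congr (_ ^+ _); mlia.
Qed.

Lemma qrho_n : qrho n = if oddN then s else 1.
Proof. by rewrite qrhoE // /dimN addKn; case: oddN. Qed.

Lemma qrho_mid : oddN -> qrho n.+1 = 1.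
Proof.
move=> oN; rewrite /Defs.qrho /rho2 ltnn.
by have -> : (mir n.+1 <= n)%N = false by move: oN; mlia.
Qed.

(* x_{i'} x_i = x_i x_{i'} + [gam i] Q_{i+1} and
   Q_i = [alp i] (x_i x_{i'} + [bet i] Q_{i+1}), where Q_i is the quadratic
   element of the subalgebra generated by x_i, ..., x_{i'}. *)
Definition gam i := (q - q^-1) / (qrho i * q^-1 + (qrho i)^-1 * q).
Definition bet i := q ^+ 2 * qrho i / (qrho i ^+ 2 + q ^+ 2).
Definition alp i := (qrho i ^+ 2 + 1) / qrho i.

Lemma den_neq0 i : (i <= n)%N -> qrho i ^+ 2 + q ^+ 2 != 0.
Proof. by move=> le_in; rewrite sqr_qrho // expqD_neq0. Qed.

Lemma bet_neq0 i : (i <= n)%N -> bet i != 0.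
Proof.
by move=> le_in; rewrite !mulf_neq0 ?invr_neq0 ?expf_neq0 ?qrho_neq0 ?den_neq0.
Qed.

Lemma alp_neq0 i : (i <= n)%N -> alp i != 0.
Proof.
move=> le_in; rewrite mulf_neq0 ?invr_neq0 ?qrho_neq0 // sqr_qrho //.
exact: (expqD_neq0 _ 0).
Qed.

(** This identity fixes [bet]: it is what makes x_i x_{i'} + [bet i] Q_{i+1} commute with x_i and
    x_{i'}, since Q_{i+1} picks up q^2 or q^-2 on crossing them. *)
Lemma gamE i : (i <= n)%N -> gam i = bet i * (1 - q ^- 2).
Proof.
move=> le_in; rewrite /gam /bet; field.
rewrite qrho_neq0 q_neq0 den_neq0 //=.
Qed.

Lemma alpE i : (i <= n)%N -> alp i = (qrho i)^-1 + qrho i.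
Proof. by move=> le_in; rewrite /alp; field; rewrite qrho_neq0. Qed.

Lemma alp_bet i : (i <= n)%N -> alp i * bet i = qrho i * gam i + 1.
Proof.
move=> le_in; rewrite gamE // /alp /bet; field.
by rewrite qrho_neq0 q_neq0 den_neq0.
Qed.

(** * Operators satisfying the relations, and the Fock representation *)

Section Operators.

Variables (V : lmodType C) (T : nat -> {linear V -> V}).

Definition Qop i (v : V) : V :=
  \sum_(i <= j < (mir i).+1) qrho (mir j) *: T j (T (mir j) v).

Lemma TZ j c v : T j (c *: v) = c *: T j v. Proof. exact: linearZ. Qed.

Lemma TD j u v : T j (u + v) = T j u + T j v. Proof. exact: linearD. Qed.

(** Stated for operators on an arbitrary module because it is needed twice: for the Fock operators,
    and for the left multiplications of the algebra. The two middle relations are the case j = n of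
    the second clause: [Qop n.+1] is the square of the middle operator and [gam n] is s - s^-1 for
    odd N, and [Qop n.+1] is an empty sum for even N. *)
Definition quantum_rels i :=
  (forall j k v, (i <= j)%N -> (j < k)%N -> (k <= mir i)%N -> j <> mir k ->
    T j (T k v) = q *: T k (T j v)) /\
  (forall j v, (i <= j <= n)%N ->
    T (mir j) (T j v) = T j (T (mir j) v) + gam j *: Qop j.+1 v).

Lemma QopD i u v : Qop i (u + v) = Qop i u + Qop i v.
Proof.
by rewrite -big_split; apply: eq_bigr => j _ /=; rewrite !linearD.
Qed.

Lemma QopZ i c v : Qop i (c *: v) = c *: Qop i v.
Proof.
rewrite scaler_sumr; apply: eq_bigr => j _.
by rewrite !linearZ /= !scalerA mulrC.
Qed.

Lemma Qop_mid v : Qop n.+1 v = if oddN then T n.+1 (T n.+1 v) else 0.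
Proof.
case: ifPn => oN; rewrite /Qop.
  have e : mir n.+1 = n.+1 by move: oN; mlia.
  by rewrite e big_nat1 e qrho_mid // scale1r.
by rewrite big_geq //; move: oN n_gt0; mlia.
Qed.

Lemma Qop_split i v : (1 <= i <= n)%N ->
  Qop i v = (qrho i)^-1 *: T i (T (mir i) v) + Qop i.+1 v
    + qrho i *: T (mir i) (T i v).
Proof.
move=> i_bd; rewrite {1}/Qop big_ltn; last by move: i_bd; mlia.
rewrite big_nat_recr /=; last by move: i_bd; mlia.
rewrite qrho_mir // mirK; last by move: i_bd; mlia.
rewrite addrA /Qop; congr (_ + _ + _).
by have -> : (mir i.+1).+1 = mir i by move: i_bd; mlia.
Qed.

Lemma Qop_rec i v : (1 <= i <= n)%N -> quantum_rels i ->
  Qop i v = alp i *: (T i (T (mir i) v) + bet i *: Qop i.+1 v).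
Proof.
move=> i_bd [_ T_mir]; have le_in : (i <= n)%N by case/andP: i_bd.
rewrite Qop_split // T_mir ?leqnn // scalerDr scalerA scalerDr scalerA alp_bet //.
rewrite alpE // !scalerDl scale1r -!addrA; congr (_ + _).
by rewrite addrC -addrA.
Qed.

Lemma quantum_relsS i : quantum_rels i -> quantum_rels i.+1.
Proof.
move=> [T_comm T_mir]; split=> [j k v le_ij lt_jk le_k|j v /andP[le_ij le_jn]].
  by apply: T_comm => //; [lia|move: le_k; mlia].
by apply: T_mir; rewrite le_jn andbT ltnW.
Qed.

Lemma Qop_shift_l i v : (1 <= i <= n)%N -> quantum_rels i ->
  T i (Qop i.+1 v) = q ^+ 2 *: Qop i.+1 (T i v).
Proof.
move=> i_bd [T_comm _]; rewrite /Qop linear_sum scaler_sumr.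
rewrite !big_nat; apply: eq_bigr => j /andP[le_ij le_j]; rewrite TZ.
rewrite (T_comm i j); try by move: i_bd le_ij le_j; mlia.
rewrite (T_comm i (mir j)); try by move: i_bd le_ij le_j; mlia.
by rewrite TZ !scalerA; congr (_ *: _); ring.
Qed.

Lemma Qop_shift_r i v : (1 <= i <= n)%N -> quantum_rels i ->
  Qop i.+1 (T (mir i) v) = q ^+ 2 *: T (mir i) (Qop i.+1 v).
Proof.
move=> i_bd [T_comm _]; rewrite /Qop linear_sum scaler_sumr.
rewrite !big_nat; apply: eq_bigr => j /andP[le_ij le_j]; rewrite TZ.
rewrite (T_comm (mir j) (mir i)); try by move: i_bd le_ij le_j; mlia.
rewrite TZ (T_comm j (mir i)); try by move: i_bd le_ij le_j; mlia.
by rewrite !scalerA; congr (_ *: _); ring.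
Qed.

(** Downward induction on i through [Qop_rec]. For j strictly between i and i', the factors q from
    crossing T_i and T_{i'} cancel and Q_{i+1} is central one level below; for j = i and j = i' the
    defect [gam i] is absorbed by the q^2-commutation of Q_{i+1}, which is [gamE]. *)
Lemma Qop_central i j v : (1 <= i <= n.+1)%N -> quantum_rels i ->
  (i <= j <= mir i)%N -> T j (Qop i v) = Qop i (T j v).
Proof.
have [d] := ubnP (n.+1 - i); elim: d => // d IHd in i j v *.
rewrite ltnS => le_d i_bd Tr j_bd.
case: (ltnP n i) => lt_ni.
  have ei : i = n.+1 by lia.
  rewrite !ei !Qop_mid; case: ifPn => oN; last by rewrite linear0.
  by have -> : j = n.+1 by move: j_bd oN; rewrite ei; mlia.
have i_bd' : (1 <= i <= n)%N by lia.
rewrite !(Qop_rec _ i_bd' Tr) TZ TD TZ; congr (_ *: _).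
have [-> | ne_ji] := eqVneq j i.
  rewrite (Qop_shift_l v i_bd' Tr) Tr.2 ?leqnn // TD TZ.
  rewrite (Qop_shift_l v i_bd' Tr) !scalerA -addrA -scalerDl.
  by congr (_ + _ *: _); rewrite gamE //; field.
have [-> | ne_jm] := eqVneq j (mir i).
  rewrite (Qop_shift_r v i_bd' Tr) Tr.2 ?leqnn //.
  rewrite (Qop_shift_r v i_bd' Tr) !scalerA -addrA -scalerDl.
  by congr (_ + _ *: _); rewrite gamE //; field.
have -> : T j (Qop i.+1 v) = Qop i.+1 (T j v).
  apply: IHd; [by move: le_d lt_ni; lia | by [] | exact: quantum_relsS |].
  by move: j_bd ne_ji ne_jm i_bd'; mlia.
congr (_ + _); apply: (scalerI q_neq0).
rewrite -(Tr.1 i j); try by move: j_bd ne_ji ne_jm i_bd'; mlia.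
by rewrite (Tr.1 j (mir i)) ?TZ //; move: j_bd ne_ji ne_jm i_bd'; mlia.
Qed.

End Operators.

Definition linear_of (U V : lmodType C) (f : U -> V) (f_lin : linear f) :
    {linear U -> V} :=
  HB.pack f (GRing.isLinear.Build C U V *:%R f f_lin).

Definition Tmon (V : Type) (T : nat -> V -> V) i (nu : nat -> nat) (v : V) : V :=
  foldr (fun j w => iter (nu j) (T j) w) v (index_iota i (mir i).+1).

(** Exponents are functions on nat, of which a monomial of level i sees only the values at i, ...,
    i'. Agreement there stands for equality of the monomials. *)
Definition agree i (mu nu : nat -> nat) : bool :=
  all (fun j => mu j == nu j) (index_iota i (mir i).+1).

Lemma index_iota_split i : (1 <= i <= n)%N ->
  index_iota i (mir i).+1 = i :: rcons (index_iota i.+1 (mir i.+1).+1) (mir i).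
Proof.
move=> i_bd; rewrite /index_iota.
have e : ((mir i.+1).+1 - i.+1)%N.+2 = ((mir i).+1 - i)%N by move: i_bd; mlia.
rewrite -e -(addn1 _.+1) iotaD /= cats1; congr (_ :: rcons _ _).
by move: i_bd; mlia.
Qed.

Lemma index_iota_mid : index_iota n.+1 (mir n.+1).+1 = if oddN then [:: n.+1] else [::].
Proof.
rewrite /index_iota; set k := (_ - _)%N.
case: ifPn => oN.
  by have -> : k = 1%N by rewrite /k; move: oN; mlia.
by have -> : k = 0%N by rewrite /k; move: oN; mlia.
Qed.

Lemma Tmon_split (V : Type) (T : nat -> V -> V) i nu v : (1 <= i <= n)%N ->
  Tmon T i nu v =
  iter (nu i) (T i) (Tmon T i.+1 nu (iter (nu (mir i)) (T (mir i)) v)).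
Proof. by move=> i_bd; rewrite /Tmon index_iota_split //= foldr_rcons. Qed.

Lemma agree_split i mu nu : (1 <= i <= n)%N ->
  agree i mu nu =
  [&& mu i == nu i, mu (mir i) == nu (mir i) & agree i.+1 mu nu].
Proof. by move=> i_bd; rewrite /agree index_iota_split //= all_rcons. Qed.

(** The operator D is q to the minus degree. It is carried along because x_{i'} y = q^(-deg y) y
    x_{i'} for y in the inner generators, which is needed to adjoin x_{i'} one level up. The
    functionals [cf] are dual to the ordered monomials applied to the vacuum. *)
Definition fock_model i (V : lmodType C) (T : nat -> {linear V -> V})
    (D : {linear V -> V}) (v0 : V) (cf : (nat -> nat) -> {scalar V}) :=
  [/\ quantum_rels T i,
      forall j v, (i <= j <= mir i)%N -> D (T j v) = q^-1 *: T j (D v),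
      D v0 = v0
    & forall mu nu, cf mu (Tmon T i nu v0) = (agree i mu nu)%:R].

Definition shift0 (V : zmodType) (f : nat -> V) (k : nat) : V :=
  if k is k'.+1 then f k' else 0.

(** Sequences of scalars serve for both parities: the shift is multiplication by the middle
    generator, and for even N only the vacuum coordinate is ever read. At level n+1 the relations
    are vacuous. *)
Lemma fock_base : exists V T D v0 cf, @fock_model n.+1 V T D v0 cf.
Proof.
pose V : lmodType C := (nat -> C^o).
have shift_lin : linear (@shift0 C^o : V -> V).
  move=> c f g; apply/funext => -[|k]; last by [].
  by rewrite /= -[RHS]/(c * 0 + 0) mulr0 addr0.
have D_lin : linear ((fun f k => q ^- k * f k) : V -> V).
  move=> c f g; apply/funext => k; rewrite -[LHS]/(q ^- k * (c * f k + g k)).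
  by rewrite -[RHS]/(c * (q ^- k * f k) + q ^- k * g k) mulrDr mulrCA.
have cf_lin k : linear ((fun f => f k) : V -> C^o) by [].
exists V, (fun _ => linear_of shift_lin), (linear_of D_lin),
  (fun k => (k == 0)%:R), (fun mu => linear_of (cf_lin (if oddN then mu n.+1 else 0%N))).
split.
- split=> [j k v ? ? ? ?|j v]; first by exfalso; mlia.
  by rewrite ltnNge => /andP[/negbTE->].
- move=> j v _; apply/funext => -[|k] /=; rewrite -[RHS]/(q^-1 * _) ?mulr0 //.
  by rewrite /= exprS invfM mulrA.
- by apply/funext => -[|k] /=; rewrite ?mulr0 // expr0 invr1 mul1r.
move=> mu nu /=; rewrite /Tmon /agree index_iota_mid; case: ifPn => _ //=.
by rewrite andbT; elim: (nu n.+1) (mu n.+1) => [|m IHm] [|k] //=.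
Qed.

(** * Adjoining x_i and x_{i'} to a Fock representation of the inner generators *)

Section FockStep.

Variables (i : nat) (V : lmodType C) (T : nat -> {linear V -> V}).
Variables (D : {linear V -> V}) (v0 : V) (cf : (nat -> nat) -> {scalar V}).
Hypothesis i_bd : (1 <= i <= n)%N.
Hypothesis V_model : fock_model i.+1 T D v0 cf.

Local Notation Q' := (Qop T i.+1).
Let W : lmodType C := (nat -> nat -> V).

(* [f a b] is the coefficient of x_i^a _ x_{i'}^b; the summand with [Q'] comes
   from x_{i'} x_i^a = x_i^a x_{i'} + bet (1 - q^-2a) x_i^(a-1) Q_{i+1}. *)
Definition stepT j (f : W) : W := fun a b =>
  if j == i then (if a is a'.+1 then f a' b else 0)
  else if j == mir i then
    (if b is b'.+1 then D (f a b') else 0)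
      + (bet i * (1 - (q ^+ a.+1) ^- 2)) *: Q' (f a.+1 b)
  else q ^- a *: T j (f a b).

Definition stepD (f : W) : W := fun a b => q ^- (a + b) *: D (f a b).

Lemma stepT_lin j : linear (stepT j).
Proof.
move=> c f g; apply/funext => a; apply/funext => b.
rewrite -[RHS]/(c *: stepT j f a b + stepT j g a b) /stepT.
case: ifP => _; first by case: a => [|a] //; rewrite scaler0 addr0.
case: ifP => _; last first.
  rewrite -[(c *: f + g) a b]/(c *: f a b + g a b).
  by rewrite linearP scalerDr !scalerA [q ^- a * c]mulrC.
rewrite -[(c *: f + g) a.+1 b]/(c *: f a.+1 b + g a.+1 b) QopD QopZ.
case: b => [|b].
  by rewrite !add0r scalerDr !scalerA [_ * c]mulrC.
rewrite -[(c *: f + g) a b]/(c *: f a b + g a b) linearP.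
by rewrite !scalerDr !scalerA [_ * c]mulrC addrACA.
Qed.

Lemma stepD_lin : linear stepD.
Proof.
move=> c f g; apply/funext => a; apply/funext => b.
rewrite -[RHS]/(c *: stepD f a b + stepD g a b) /stepD.
rewrite -[(c *: f + g) a b]/(c *: f a b + g a b) linearP.
by rewrite scalerDr !scalerA [q ^- _ * c]mulrC.
Qed.

Lemma stepcf_lin mu : linear ((fun f => cf mu (f (mu i) (mu (mir i)))) : W -> C^o).
Proof. by move=> c f g; rewrite -linearP. Qed.

Definition linT j := linear_of (stepT_lin j).

Lemma stepT_in j f a b : (i < j < mir i)%N ->
  stepT j f a b = q ^- a *: T j (f a b).
Proof.
by move=> j_bd; rewrite /stepT !ifN //; move: j_bd; mlia.
Qed.

Lemma mir_neq : (mir i == i) = false.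
Proof. by move: i_bd; mlia. Qed.

Lemma stepT_l f a b : stepT i f a b = if a is a'.+1 then f a' b else 0.
Proof. by rewrite /stepT eqxx. Qed.

Lemma stepT_r f a b : stepT (mir i) f a b =
  (if b is b'.+1 then D (f a b') else 0)
    + (bet i * (1 - (q ^+ a.+1) ^- 2)) *: Q' (f a.+1 b).
Proof. by rewrite /stepT mir_neq eqxx. Qed.

Lemma Qop_step j f a b : (i < j)%N ->
  Qop linT j f a b = (q ^+ a) ^- 2 *: Qop T j (f a b).
Proof.
move=> lt_ij; rewrite /Qop scaler_sumr.
have fct2 (r : seq nat) (F : nat -> W) :
    (\sum_(k <- r) F k) a b = \sum_(k <- r) F k a b.
  by elim/big_rec2: _ => // k u v _ <-.
rewrite fct2 !big_nat; apply: eq_bigr => k k_bd.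
rewrite -[LHS]/(qrho (mir k) *: stepT k (stepT (mir k) f) a b).
rewrite !stepT_in; try by move: i_bd lt_ij k_bd; mlia.
rewrite TZ !scalerA; congr (_ *: _); qfield a.
Qed.

Lemma D_Qop v : D (Q' v) = q ^- 2 *: Q' (D v).
Proof.
case: V_model => _ DT _ _; rewrite /Qop linear_sum scaler_sumr !big_nat.
apply: eq_bigr => j j_bd; rewrite linearZ /= !DT; try by move: i_bd j_bd; mlia.
rewrite TZ !scalerA -exprVn; congr (_ *: _); ring.
Qed.

(** For the pair x_i, x_{i'} the two [Q'] terms differ by [bet i] (q^-2a - q^-2(a+1)) = [gam i]
    q^-2a, and q^-2a is the factor by which Q_{i+1} is scaled on x_i^a ([Qop_step]). An inner x_j
    against x_{i'} needs that [Q'] is central among the inner operators. *)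
Lemma step_rels : quantum_rels linT i.
Proof.
case: V_model => T_rels DT _ _; split=> [j k f le_ij lt_jk le_k ne_jk|j f j_bd].
  apply/funext => a; apply/funext => b.
  rewrite -[LHS]/(stepT j (stepT k f) a b) -[RHS]/(q *: stepT k (stepT j f) a b).
  have k_ltm : j = i -> (i < k < mir i)%N by move: ne_jk le_k; mlia.
  case: (eqVneq j i) => [eji|ne_ji].
    have k_in := k_ltm eji; rewrite eji (stepT_in _ _ _ k_in) !stepT_l.
    case: a => [|a]; first by rewrite linear0 !scaler0.
    by rewrite stepT_in // scalerA exprS invfM mulVKf.
  have j_in : (i < j < mir i)%N by move: ne_ji ne_jk le_ij lt_jk le_k; mlia.
  case: (eqVneq k (mir i)) => [ekm|ne_km]; last first.
    have k_in : (i < k < mir i)%N by move: ne_km j_in lt_jk le_k; mlia.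
    rewrite !stepT_in // !linearZ /= T_rels.1 ?linearZ /=; try by move: j_in k_in; mlia.
    by rewrite !scalerA; congr (_ *: _); ring.
  rewrite ekm (stepT_in _ _ _ j_in) !stepT_r !(stepT_in _ _ _ j_in).
  have cent v : T j (Q' v) = Q' (T j v).
    by apply: Qop_central => //; move: i_bd j_in; mlia.
  rewrite TD TZ cent QopZ !scalerDr !scalerA; congr (_ + _ *: _).
    case: b => [|b]; first by rewrite linear0 !scaler0.
    rewrite stepT_in // linearZ /= DT; last by move: j_in; mlia.
    by rewrite !scalerA mulrAC mulfV // mul1r.
  by qfield a.
apply/funext => a; apply/funext => b.
rewrite -[LHS]/(stepT (mir j) (stepT j f) a b).
rewrite -[RHS]/(stepT j (stepT (mir j) f) a b + gam j *: Qop linT j.+1 f a b).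
rewrite Qop_step; last by lia.
case: (eqVneq j i) => [eji|ne_ji]; last first.
  rewrite !stepT_in; try by move: i_bd j_bd ne_ji; mlia.
  rewrite !TZ T_rels.2; last by lia.
  rewrite !scalerA scalerDr !scalerA.
  by congr (_ *: _ + _ *: _); qfield a.
rewrite eji stepT_r stepT_l.
case: a => [|a]; last first.
  rewrite stepT_l stepT_r -addrA !scalerA -scalerDl.
  case: b => [|b]; rewrite ?stepT_l; congr (_ + _ *: _); rewrite gamE //.
  all: try by qfield a.+1.
  all: try by move: i_bd; lia.
have -> : (if b is b'.+1 then D (stepT i f 0%N b') else 0) = 0.
  by case: b => // b; rewrite stepT_l linear0.
rewrite stepT_l !add0r scalerA gamE; last by move: i_bd; lia.
by congr (_ *: _); field.
Qed.

Let delta a b (v : V) : W := fun a' b' => if (a' == a) && (b' == b) then v else 0.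

Lemma step_vac_r b v : linT (mir i) (delta 0 b v) = delta 0 b.+1 (D v).
Proof.
apply/funext => a; apply/funext => b'.
rewrite -[LHS]/(stepT (mir i) (delta 0 b v) a b') stepT_r /delta /=.
have Q0 : Q' 0 = 0 by rewrite -[X in Q' X](scale0r 0) QopZ scale0r.
rewrite Q0 scaler0 addr0; case: b' => [|b']; first by rewrite andbF.
by rewrite eqSS; case: ifP => // _; rewrite linear0.
Qed.

Lemma step_vac_in j b v : (i < j < mir i)%N ->
  linT j (delta 0 b v) = delta 0 b (T j v).
Proof.
move=> j_bd; apply/funext => a; apply/funext => b'.
rewrite -[LHS]/(stepT j (delta 0 b v) a b') stepT_in // /delta.
case: a => [|a] /=; last by rewrite linear0 scaler0.
by rewrite expr0 invr1 scale1r; case: ifP => // _; rewrite linear0.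
Qed.

Lemma step_vac_l a b v : linT i (delta a b v) = delta a.+1 b v.
Proof.
apply/funext => a'; apply/funext => b'.
by rewrite -[LHS]/(stepT i (delta a b v) a' b') stepT_l; case: a'.
Qed.

(** An ordered monomial acts on the vacuum without any straightening: the x_{i'} are applied first,
    when no x_i is present and the [Q'] term vanishes, then the inner generators, and the x_i
    last. *)
Lemma Tmon_step nu :
  Tmon linT i nu (delta 0 0 v0) = delta (nu i) (nu (mir i)) (Tmon T i.+1 nu v0).
Proof.
case: V_model => _ _ Dv0 _.
rewrite Tmon_split //.
have -> b : iter b (linT (mir i)) (delta 0 0 v0) = delta 0 b v0.
  by elim: b => // b IHb; rewrite iterS IHb step_vac_r Dv0.
move: (nu (mir i)) => b.
have -> : Tmon linT i.+1 nu (delta 0 b v0) = delta 0 b (Tmon T i.+1 nu v0).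
  have : all (fun j => i < j < mir i)%N (index_iota i.+1 (mir i.+1).+1).
    by apply/allP => j; rewrite mem_index_iota; move: i_bd; mlia.
  rewrite /Tmon; elim: (index_iota _ _) => //= j r IHr /andP[j_bd /IHr->].
  elim: (nu j) => // k IHk; rewrite !iterS IHk; exact: step_vac_in.
by elim: (nu i) => // a IHa; rewrite iterS IHa step_vac_l.
Qed.

Lemma fock_step : exists V T D v0 cf, @fock_model i V T D v0 cf.
Proof.
case: (V_model) => T_rels DT Dv0 cfE.
exists W, linT, (linear_of stepD_lin), (delta 0 0 v0).
exists (fun mu => linear_of (stepcf_lin mu)); split.
- exact: step_rels.
- move=> j f j_bd; apply/funext => a; apply/funext => b.
  rewrite -[LHS]/(q ^- (a + b) *: D (stepT j f a b)).
  rewrite -[RHS]/(q^-1 *: stepT j (stepD f) a b).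
  case: (eqVneq j i) => [->|ne_ji].
    rewrite !stepT_l; case: a => [|a]; first by rewrite linear0 !scaler0.
    by rewrite /stepD addSn scalerA exprS invfM.
  case: (eqVneq j (mir i)) => [->|ne_jm]; last first.
    have j_in : (i < j < mir i)%N by move: ne_ji ne_jm j_bd; lia.
    rewrite !stepT_in // /stepD !linearZ /= DT; last by move: j_in; mlia.
    by rewrite linearZ /= !scalerA; congr (_ *: _); rewrite mulrCA mulrA.
  rewrite !stepT_r /stepD linearD linearZ /= D_Qop !scalerDr !QopZ !scalerA.
  congr (_ + _ *: _); last first.
    by rewrite addSn; move: (_ * (1 - _)) => c; qfield (a + b)%N.
  case: b => [|b]; first by rewrite linear0 !scaler0.
  by rewrite linearZ /= scalerA addnS exprS invfM.
- apply/funext => a; apply/funext => b.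
  rewrite -[LHS]/(q ^- (a + b) *: D (delta 0 0 v0 a b)) /delta.
  case: a => [|a]; last by rewrite linear0 scaler0.
  by case: b => [|b] /=; rewrite ?linear0 ?scaler0 // Dv0 expr0 invr1 scale1r.
move=> mu nu; rewrite Tmon_step.
rewrite -[LHS]/(cf mu (delta (nu i) (nu (mir i)) (Tmon T i.+1 nu v0) (mu i) (mu (mir i)))).
rewrite agree_split // /delta andbA; case: (_ && _) => /=; last by rewrite linear0.
exact: cfE.
Qed.

End FockStep.

Lemma fock_exists : exists V T D v0 cf, @fock_model 1 V T D v0 cf.
Proof.
suff H d : (d <= n)%N -> exists V T D v0 cf, @fock_model (n.+1 - d)%N V T D v0 cf.
  by have := H n (leqnn n); rewrite subSnn.
elim: d => [|d IHd] lt_dn; first by rewrite subn0; exact: fock_base.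
have [V [T [D [v0 [cf]]]]] := IHd (ltnW lt_dn).
have -> : (n.+1 - d = (n.+1 - d.+1).+1)%N by lia.
by move=> V_model; apply: fock_step V_model; lia.
Qed.

(** * The algebra and its monomial coefficients *)

Section Algebra.

Variables (A : algType C) (pi : {lrmorphism free_alg C N -> A}).
Hypothesis A_pres : is_quotient_by pi (qrelator (n := n) (oddN := oddN) q s).

Local Notation x := (x pi).

Lemma lmul_lin (a : A) : linear (fun b => a * b).
Proof. by move=> c u v; rewrite mulrDr scalerAr. Qed.

Definition lx j : {linear A -> A} := linear_of (lmul_lin (x j)).

Lemma lxE j a : lx j a = x j * a. Proof. by []. Qed.

Definition Qlevel i : A := \sum_(i <= j < (mir i).+1) qrho (mir j) *: (x j * x (mir j)).

Local Notation Q := Qlevel.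

Lemma Qop_lx i a : Qop lx i a = Q i * a.
Proof.
by rewrite mulr_suml; apply: eq_bigr => j _; rewrite -scalerAl -mulrA.
Qed.

Lemma pi_relator a : qrelator q s a -> pi a = 0.
Proof. by move=> a_rel; apply/A_pres.2; apply: IdealGen. Qed.

Lemma piB (a b : free_alg C N) : pi (a - b) = pi a - pi b.
Proof. exact: linearB. Qed.

Lemma piZ c (a : free_alg C N) : pi (c *: a) = c *: pi a.
Proof. exact: linearZ. Qed.

Lemma piXX i j : pi (free_gen C n oddN i * free_gen C n oddN j : free_alg C N) = x i * x j.
Proof. exact: (rmorphM pi). Qed.

Lemma x_comm i j : (1 <= i)%N -> (i < j)%N -> (j <= N)%N -> i <> mir j ->
  x i * x j = q *: (x j * x i).
Proof.
move=> i_gt0 lt_ij le_jN ne_ij; apply: subr0_eq.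
rewrite -(pi_relator (RelComm q s i_gt0 lt_ij le_jN ne_ij)) piB piZ.
by congr (_ - _ *: _); rewrite -piXX.
Qed.

Lemma x_mir i : (1 <= i <= n)%N ->
  x (mir i) * x i = x i * x (mir i) + gam i *: Q i.+1.
Proof.
case/andP=> i_gt0; rewrite leq_eqVlt => /orP[/eqP e_in|lt_in];
  apply/eqP; rewrite addrC -subr_eq -subr_eq0; apply/eqP; last first.
  rewrite -(pi_relator (@RelMirror C n oddN q s i i_gt0 lt_in)) !piB piZ.
  congr (_ - _ - _ *: _); rewrite -?piXX //.
  rewrite (linear_sum pi); apply: eq_bigr => j _.
  by rewrite -piXX -piZ.
rewrite {i}e_in in i_gt0 *.
case oN: {-}oddN; last first.
  rewrite -(pi_relator (RelMiddleEven q s i_gt0 (negbT oN))) piB.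
  have e : mir n.+1 = n by move: oN i_gt0; mlia.
  rewrite /Qlevel e big_geq // scaler0 subr0.
  by congr (_ - _); rewrite -piXX.
rewrite -(pi_relator (RelMiddleOdd q s i_gt0 oN)) !piB piZ.
have e : mir n.+1 = n.+1 by move: oN; mlia.
congr (_ - _ - _); rewrite -?piXX //.
rewrite /Qlevel e big_nat1 e qrho_mid // scale1r -piXX expr2; congr (_ *: _).
rewrite /gam qrho_n oN -s_sqrt; field.
by rewrite s_neq0 -expr2 s_sqrt addrC; exact: (expqD_neq0 1 0).
Qed.

Lemma lx_rels : quantum_rels lx 1.
Proof.
split=> [j k a j_gt0 lt_jk le_k ne_jk|j a j_bd].
  rewrite -[LHS]/(x j * (x k * a)) -[RHS]/(q *: (x k * (x j * a))).
  by rewrite !mulrA x_comm ?scalerAl //; move: le_k; mlia.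
rewrite -[LHS]/(x (mir j) * (x j * a)) Qop_lx.
rewrite -[RHS]/(x j * (x (mir j) * a) + gam j *: (Q j.+1 * a)).
by rewrite mulrA x_mir // mulrDl -scalerAl mulrA.
Qed.

Lemma lx_rels_at i : (1 <= i)%N -> quantum_rels lx i.
Proof.
by case: i => // i _; elim: i => [|i /quantum_relsS //]; exact: lx_rels.
Qed.

Lemma Q_rec i : (1 <= i <= n)%N ->
  Q i = alp i *: (x i * x (mir i) + bet i *: Q i.+1).
Proof.
move=> i_bd; have i_gt0 : (1 <= i)%N by case/andP: i_bd.
have := Qop_rec 1 i_bd (lx_rels_at i_gt0); by rewrite !Qop_lx !lxE !mulr1.
Qed.

Lemma x_Q i : (1 <= i <= n)%N -> x i * Q i.+1 = q ^+ 2 *: (Q i.+1 * x i).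
Proof.
move=> i_bd; have i_gt0 : (1 <= i)%N by case/andP: i_bd.
have := Qop_shift_l 1 i_bd (lx_rels_at i_gt0); by rewrite !Qop_lx !lxE !mulr1.
Qed.

(** Each crossing of an x_i leaves [gam i] Q_{i+1}; moving it to the right end costs powers of q^-2,
    and the geometric sum [gam i] (1 + q^-2 + ... + q^-2(a-1)) equals [bet i] (1 - q^-2a). At a = 0
    the coefficient vanishes, so the value of [a.-1] there is harmless. *)
Lemma x_mirX i a : (1 <= i <= n)%N ->
  x (mir i) * x i ^+ a = x i ^+ a * x (mir i)
    + (bet i * (1 - (q ^+ a) ^- 2)) *: (x i ^+ a.-1 * Q i.+1).
Proof.
move=> i_bd; elim: a => [|a IHa].
  by rewrite !expr0 mulr1 mul1r expr1n invr1 subrr mulr0 scale0r addr0.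
rewrite exprSr mulrA IHa mulrDl -mulrA x_mir // mulrDr -addrA mulrA; congr (_ + _).
have Qx : Q i.+1 * x i = q ^- 2 *: (x i * Q i.+1).
  by rewrite x_Q // scalerA mulVf ?expf_neq0 // scale1r.
rewrite -scalerAl -[_ * Q _ * x i]mulrA Qx -!scalerAr scalerA mulrA -exprSr.
rewrite -[_.+1.-1]/a gamE; last by case/andP: i_bd.
case: a {IHa} => [|a].
  rewrite expr0 expr1n invr1 subrr mulr0 mul0r scale0r addr0.
  by congr (_ *: _); rewrite expr1.
by rewrite -scalerDl; congr (_ *: _); qfield a.+1.
Qed.

(** * Action of the free algebra by operators satisfying the relations *)

Section FreeAction.

Variables (V : lmodType C) (T : nat -> {linear V -> V}).
Hypothesis T_rels : quantum_rels T 1.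

(** The letters in ['I_N] count from 0 and the generators from 1. *)
Definition word_act (w : seq 'I_N) (v : V) : V := foldr (fun (j : 'I_N) u => T j.+1 u) v w.

Definition free_act (g : free_alg C N) (v : V) : V :=
  \sum_(k <- msupp g) g@_k *: word_act k v.

Lemma free_act_on (d : {fset {fmonom 'I_N}}) g v : (msupp g `<=` d)%fset ->
  free_act g v = \sum_(k <- d) g@_k *: word_act k v.
Proof.
move=> le_d; rewrite /free_act (big_fset_incl _ le_d) //= => k _ k_out.
by rewrite mcoeff_outdom // scale0r.
Qed.

Lemma free_actD g h v : free_act (g + h) v = free_act g v + free_act h v.
Proof.
rewrite (free_act_on v (msuppD_le g h)) (free_act_on v (fsubsetUl (msupp g) (msupp h))).
rewrite (free_act_on v (fsubsetUr (msupp g) (msupp h))) -big_split.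
by apply: eq_bigr => k _; rewrite mcoeffD scalerDl.
Qed.

Lemma free_actZ c g v : free_act (c *: g) v = c *: free_act g v.
Proof.
rewrite (free_act_on v (msuppZ_le c g)) scaler_sumr.
by apply: eq_bigr => k _; rewrite mcoeffZ scalerA.
Qed.

Lemma free_actN g v : free_act (- g) v = - free_act g v.
Proof.
have -> : - g = (-1) *: g by rewrite scaleN1r.
by rewrite free_actZ scaleN1r.
Qed.

Lemma free_act_sum (I : Type) (r : seq I) (F : I -> free_alg C N) v :
  free_act (\sum_(i <- r) F i) v = \sum_(i <- r) free_act (F i) v.
Proof.
have fact0 : free_act 0 v = 0 by rewrite -(scale0r 0) free_actZ scale0r.
by elim: r => [|i r IHr]; rewrite ?big_nil ?big_cons ?free_actD ?IHr.
Qed.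

Lemma free_actU c k v : free_act << c *g k >> v = c *: word_act k v.
Proof.
by rewrite (free_act_on v msuppU_le) big_seq_fset1 mcoeffUU.
Qed.

Lemma word_act_lin w c u v : word_act w (c *: u + v) = c *: word_act w u + word_act w v.
Proof. by elim: w => //= j w ->; rewrite linearP. Qed.

Lemma free_actM g h v : free_act (g * h) v = free_act g (free_act h v).
Proof.
have act_sum w (r : seq {fmonom 'I_N}) F :
    word_act w (\sum_(k <- r) F k) = \sum_(k <- r) word_act w (F k).
  have w0 : word_act w 0 = 0 by elim: w => //= j w ->; rewrite linear0.
  elim: r => [|k r IHr]; rewrite ?big_nil ?big_cons //.
  by rewrite -{1}[F k]scale1r word_act_lin IHr scale1r.
have actZ w c u : word_act w (c *: u) = c *: word_act w u.
  by elim: w => //= j w ->; rewrite linearZ.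
rewrite malgME free_act_sum /free_act; apply: eq_bigr => k _.
rewrite -/(free_act _ v) free_act_sum act_sum scaler_sumr; apply: eq_bigr => l _.
by rewrite free_actU actZ scalerA fmM /word_act foldr_cat.
Qed.

Lemma free_act1 v : free_act 1 v = v.
Proof. by rewrite -[1]/(<< 1 *g mone >>) free_actU scale1r fm1. Qed.

Lemma free_actX j v : (1 <= j <= N)%N -> free_act (free_gen C n oddN j) v = T j v.
Proof.
case: j => //= j lt_jN; rewrite insubT free_actU scale1r.
by rewrite /word_act fmU.
Qed.

Lemma free_act_Xmon nu v :
  free_act (\prod_(1 <= j < N.+1) free_gen C n oddN j ^+ nu j) v = Tmon T 1 nu v.
Proof.
have -> : Tmon T 1 nu v = foldr (fun j w => iter (nu j) (T j) w) v (index_iota 1 N.+1).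
  by rewrite /Tmon; have -> : mir 1 = N by mlia.
have : all (fun j => 1 <= j <= N)%N (index_iota 1 N.+1).
  by apply/allP => j; rewrite mem_index_iota.
elim: (index_iota _ _) => [|j r IHr] /=; first by rewrite big_nil free_act1.
case/andP=> j_bd /IHr{}IHr; rewrite big_cons free_actM IHr.
move: (foldr _ _ _) => u; elim: (nu j) => [|k IHk]; first by rewrite free_act1.
by rewrite exprS free_actM IHk free_actX.
Qed.

Lemma free_actXX i j v : (1 <= i <= N)%N -> (1 <= j <= N)%N ->
  free_act (free_gen C n oddN i * free_gen C n oddN j : free_alg C N) v = T i (T j v).
Proof. by move=> i_bd j_bd; rewrite free_actM !free_actX. Qed.

Lemma free_act_relator a v : qrelator q s a -> free_act a v = 0.
Proof.
case: T_rels => T_comm T_mir.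
case=> [i j i_gt0 lt_ij le_jN ne_ij|i i_gt0 lt_in|n_gt0' oN|n_gt0' oN].
- transitivity (T i (T j v) - q *: T j (T i v)); last first.
    by rewrite T_comm ?subrr //; move: le_jN; mlia.
  rewrite free_actD free_actN free_actZ.
  by congr (_ - _ *: _); apply: free_actXX; move: i_gt0 lt_ij le_jN; lia.
- transitivity (T (mir i) (T i v) - T i (T (mir i) v) - gam i *: Qop T i.+1 v).
    rewrite 2!free_actD 2!free_actN free_actZ; congr (_ - _ - _ *: _).
    + by apply: free_actXX; move: i_gt0 lt_in; mlia.
    + by apply: free_actXX; move: i_gt0 lt_in; mlia.
    rewrite free_act_sum /Qop !big_nat; apply: eq_bigr => j j_bd.
    by rewrite free_actZ free_actXX //; move: i_gt0 lt_in j_bd; mlia.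
  rewrite T_mir; last by lia.
  by rewrite addrAC addrK subrr.
- transitivity (T (mir n) (T n v) - T n (T (mir n) v) - (s - s^-1) *: T n.+1 (T n.+1 v)).
    rewrite 2!free_actD 2!free_actN free_actZ; congr (_ - _ - _ *: _).
    + by apply: free_actXX; move: n_gt0' oN; mlia.
    + by apply: free_actXX; move: n_gt0' oN; mlia.
    by rewrite expr2; apply: free_actXX; move: n_gt0' oN; mlia.
  rewrite T_mir; last by lia.
  rewrite [X in X - _ - _]addrC addrK Qop_mid oN [gam n](_ : _ = s - s^-1) ?subrr //.
  rewrite /gam qrho_n oN -s_sqrt; field.
  by rewrite s_neq0 -expr2 s_sqrt addrC; exact: (expqD_neq0 1 0).
transitivity (T (mir n) (T n v) - T n (T (mir n) v)).
  by rewrite free_actD free_actN; congr (_ - _); apply: free_actXX; move: n_gt0' oN; mlia.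
by rewrite T_mir ?leqnn ?n_gt0' // Qop_mid (negbTE oN) scaler0 addr0 subrr.
Qed.

Lemma free_act_ideal a v : two_sided_ideal (@qrelator C n oddN q s) a -> free_act a v = 0.
Proof.
move=> a_id; elim: a_id v => {a} [|a a_rel|a b _ IHa _ IHb|a l r _ IHa] v.
- by rewrite -(scale0r 0) free_actZ scale0r.
- exact: free_act_relator.
- by rewrite free_actD IHa IHb addr0.
rewrite !free_actM IHa /free_act big1 // => k _.
have -> : word_act k 0 = 0 by elim: (k : seq _) => //= j w ->; rewrite linear0.
by rewrite scaler0.
Qed.

End FreeAction.

(** This is the linear independence of the ordered monomials, in the form in which it is used. An
    element of the algebra is lifted to the free algebra, applied to the Fock vacuum, and measured
    by the Fock functionals. *)
Lemma coef_exists : exists cf : (nat -> nat) -> {scalar A},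
  forall mu nu, cf mu (xmon pi nu) = (agree 1 mu nu)%:R.
Proof.
have [V [T [D [v0 [cf [T_rels _ _ cfE]]]]]] := fock_exists.
have liftP a : exists b, pi b == a by have [b <-] := A_pres.1 a; exists b.
pose lift a := xchoose (liftP a).
have liftK a : pi (lift a) = a by apply/eqP/(xchooseP (liftP a)).
(* Two lifts differ by an element of the ideal, which acts by zero. Independence of the lift yields
   both linearity and the values on monomials. *)
have free_act_pi b c : pi b = pi c -> free_act T b v0 = free_act T c v0.
  move=> e; apply/eqP; rewrite -subr_eq0 -free_actN -free_actD; apply/eqP.
  by apply: free_act_ideal => //; apply/A_pres.2; rewrite piB e subrr.
have cf_lin mu : linear ((fun a => cf mu (free_act T (lift a) v0)) : A -> C^o).
  move=> c a b; rewrite -linearP -free_actZ -free_actD; congr (cf mu _).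
  apply: free_act_pi; transitivity (c *: pi (lift a) + pi (lift b)).
    by rewrite !liftK.
  exact/esym/linearP.
exists (fun mu => linear_of (cf_lin mu)) => mu nu.
rewrite -cfE -free_act_Xmon -[LHS]/(cf mu (free_act T (lift (xmon pi nu)) v0)).
congr (cf mu _); apply: free_act_pi; rewrite liftK rmorph_prod.
by apply: eq_bigr => j _; rewrite rmorphXn.
Qed.

(** * Graded components *)

Definition xmonI i nu := \prod_(i <= j < (mir i).+1) x j ^+ nu j.

Definition degI i nu := (\sum_(i <= j < (mir i).+1) nu j)%N.

(** The degree governs the power of q picked up when x_{i'} crosses an inner element; the weights
    are what the K_k and the invariant functional see. Only the values of w at i, ..., n matter. *)
Definition graded i d (w : nat -> int) : A -> Prop :=
  lin_span (fun v => exists nu, [/\ degI i nu = d,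
    forall k, (i <= k <= n)%N -> wt_hat n oddN k nu = w k & v = xmonI i nu]).

Lemma mir1 : mir 1 = N. Proof. mlia. Qed.

Lemma xmonI1 nu : xmonI 1 nu = xmon pi nu.
Proof. by rewrite /xmonI mir1. Qed.

Lemma degI1 nu : degI 1 nu = mdegree n oddN nu.
Proof. by rewrite /degI mir1. Qed.

Lemma xmonI_split i nu : (1 <= i <= n)%N ->
  xmonI i nu = x i ^+ nu i * xmonI i.+1 nu * x (mir i) ^+ nu (mir i).
Proof. by move=> i_bd; rewrite /xmonI index_iota_split // big_cons big_rcons /= mulrA. Qed.

Lemma degI_split i nu : (1 <= i <= n)%N ->
  degI i nu = (nu i + degI i.+1 nu + nu (mir i))%N.
Proof. by move=> i_bd; rewrite /degI index_iota_split // big_cons big_rcons /= addnA. Qed.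

Lemma xmonI_ext i mu nu : (forall j, (i <= j <= mir i)%N -> mu j = nu j) ->
  xmonI i mu = xmonI i nu.
Proof. by move=> e; apply: eq_big_nat => j j_bd; rewrite e. Qed.

Lemma degI_ext i mu nu : (forall j, (i <= j <= mir i)%N -> mu j = nu j) ->
  degI i mu = degI i nu.
Proof. by move=> e; apply: eq_big_nat => j j_bd; rewrite e. Qed.

Definition upd i a b (nu : nat -> nat) : nat -> nat :=
  fun k => if k == i then a else if k == mir i then b else nu k.

Lemma upd_in i a b nu j : (i < j < mir i)%N -> upd i a b nu j = nu j.
Proof. by move=> j_bd; rewrite /upd !ifN //; lia. Qed.

Lemma upd_l i a b nu : upd i a b nu i = a.
Proof. by rewrite /upd eqxx. Qed.

Lemma upd_r i a b nu : (1 <= i <= n)%N -> upd i a b nu (mir i) = b.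
Proof. by move=> i_bd; rewrite /upd eqxx ifN //; move: i_bd; mlia. Qed.

Lemma xmonI_upd i a b nu : (1 <= i <= n)%N ->
  xmonI i (upd i a b nu) = x i ^+ a * xmonI i.+1 nu * x (mir i) ^+ b.
Proof.
move=> i_bd; rewrite xmonI_split // upd_l upd_r //; congr (_ * _ * _).
by apply: xmonI_ext => j j_bd; rewrite upd_in //; move: i_bd j_bd; mlia.
Qed.

Lemma degI_upd i a b nu : (1 <= i <= n)%N ->
  degI i (upd i a b nu) = (a + degI i.+1 nu + b)%N.
Proof.
move=> i_bd; rewrite degI_split // upd_l upd_r //; congr (_ + _ + _)%N.
by apply: degI_ext => j j_bd; rewrite upd_in //; move: i_bd j_bd; mlia.
Qed.

Lemma graded_ext i d d' w w' p : d = d' ->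
  (forall k, (i <= k <= n)%N -> w k = w' k) -> graded i d w p -> graded i d' w' p.
Proof.
move=> <- e; move: p; apply: lin_span_ind => [|c u v|v [nu [nu_d nu_w ->]]].
- exact: lin_span0.
- exact: lin_spanP.
apply: lin_span_gen; exists nu; split=> // k k_bd.
by rewrite nu_w // e.
Qed.

Lemma graded_mon i nu : graded i (degI i nu) (fun k => wt_hat n oddN k nu) (xmonI i nu).
Proof. by apply: lin_span_gen; exists nu. Qed.

Lemma graded_step i a b d w y : (1 <= i <= n)%N -> graded i.+1 d w y ->
  graded i (a + d + b) (fun k => if k == i then a%:Z - b%:Z else w k)
    (x i ^+ a * y * x (mir i) ^+ b).
Proof.
move=> i_bd; move: y; apply: lin_span_ind => [|c u v gu gv|v [nu [<- nu_w ->]]].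
- by rewrite mulr0 mul0r; exact: lin_span0.
- rewrite mulrDr mulrDl -scalerAr -scalerAl; exact: lin_spanP.
rewrite -xmonI_upd // -degI_upd //; apply: lin_span_gen.
exists (upd i a b nu); split=> // k k_bd; rewrite /wt_hat.
case: eqVneq => [->|ne_ki]; first by rewrite upd_l upd_r.
rewrite -nu_w /wt_hat; last by lia.
by rewrite !upd_in //; move: i_bd k_bd ne_ki; mlia.
Qed.

Lemma graded_xcomm_r i d w y : (1 <= i <= n)%N -> graded i.+1 d w y ->
  y * x (mir i) = q ^+ d *: (x (mir i) * y).
Proof.
move=> i_bd; move: y; apply: lin_span_ind => [|c u v eu ev|v [nu [<- _ ->]]].
- by rewrite mulr0 mul0r scaler0.
- by rewrite mulrDr mulrDl -scalerAl eu ev -scalerAr scalerDr !scalerA mulrC.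
rewrite /xmonI /degI.
have : all (fun j => i < j < mir i)%N (index_iota i.+1 (mir i.+1).+1).
  by apply/allP => j; rewrite mem_index_iota; move: i_bd; mlia.
elim: (index_iota _ _) => [|j r IHr] /=.
  by rewrite !big_nil mulr1 mul1r expr0 scale1r.
case/andP=> j_bd /IHr{}IHr; rewrite !big_cons mulrA.
have e : x j ^+ nu j * x (mir i) = q ^+ nu j *: (x (mir i) * x j ^+ nu j).
  elim: (nu j) => [|k IHk]; first by rewrite mulr1 mul1r expr0 scale1r.
  rewrite exprSr -mulrA x_comm; try by move: i_bd j_bd; mlia.
  by rewrite -scalerAr !mulrA IHk -scalerAl scalerA -exprS.
by rewrite -!mulrA IHr -scalerAr !mulrA e -scalerAl scalerA -exprD addnC.
Qed.

Lemma ne_mir i k : (1 <= i <= n)%N -> (1 <= k <= n)%N -> (k == mir i) = false.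
Proof. mlia. Qed.

(* The eigenvalue of \hat K_k on x_j is q ^ [wtx j k]. *)
Definition wtx j (k : nat) : int := (k == j)%:Z - (k == mir j)%:Z.

(** Closure under the x_j is a hypothesis here because the lemma is applied inside the induction
    that proves this closure, one level down. Q_i carries no weight, since those of x_j and x_{j'}
    are opposite. *)
Lemma graded_Q_of i :
    (forall j d w y, (i <= j <= mir i)%N -> graded i d w y ->
      graded i d.+1 (fun k => w k + wtx j k) (x j * y)) ->
    (1 <= i)%N ->
  forall d w y, graded i d w y -> graded i d.+2 w (Q i * y).
Proof.
move=> mulx i_gt0 d w y gy; rewrite mulr_suml; apply: lin_span_sum => j.
rewrite mem_index_iota => j_bd; rewrite -scalerAl -mulrA; apply: lin_spanZ.
apply: (@graded_ext _ d.+2 _ (fun k => w k + wtx (mir j) k + wtx j k)) => //.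
  move=> k k_bd; rewrite /wtx mirK; last by move: j_bd i_gt0; mlia.
  by rewrite -addrA addrACA [X in _ + (_ + X)]addrC addrACA !subrr !addr0.
by apply: (mulx); last apply: (mulx) => //; move: j_bd i_gt0; mlia.
Qed.

(** This is straightening. Only j = i' produces a second term, x_i^(a-1) Q_{i+1} Y x_{i'}^b. It has
    the right degree and weight because Q_{i+1} adds 2 to the degree and nothing to the weights, by
    the statement at level i+1. *)
Lemma graded_mulx i j d w y : (1 <= i <= n.+1)%N -> (i <= j <= mir i)%N ->
  graded i d w y -> graded i d.+1 (fun k => w k + wtx j k) (x j * y).
Proof.
have [m] := ubnP (n.+1 - i); elim: m => // m IHm in i j d w y *.
rewrite ltnS => le_m i_bd j_bd.
case: (ltnP n i) => lt_ni.
  have ei : i = n.+1 by lia.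
  have ej : j = n.+1 by move: j_bd lt_ni i_bd; mlia.
  have oN : oddN by move: j_bd lt_ni i_bd; mlia.
  rewrite ei ej; move: y; apply: lin_span_ind => [|c u v gu gv|v [nu [<- nu_w ->]]].
  - by rewrite mulr0; exact: lin_span0.
  - by rewrite mulrDr -scalerAr; exact: lin_spanP.
  have eI : index_iota n.+1 (mir n.+1).+1 = [:: n.+1] by rewrite index_iota_mid oN.
  rewrite /degI /xmonI eI !big_seq1 -exprS.
  apply: lin_span_gen; exists (fun=> (nu n.+1).+1).
  split=> [|k|]; [|by rewrite ltnNge andbC; case: (k <= n)%N|].
    by rewrite /degI eI big_seq1.
  by rewrite /xmonI eI big_seq1.
have {}i_bd : (1 <= i <= n)%N by lia.
have le_mS : (n.+1 - i.+1 < m)%N by move: le_m i_bd; lia.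
have iS_bd : (1 <= i.+1 <= n.+1)%N by move: i_bd; lia.
have mulxS k d' w' y' : (i.+1 <= k <= mir i.+1)%N -> graded i.+1 d' w' y' ->
    graded i.+1 d'.+1 (fun l => w' l + wtx k l) (x k * y').
  exact: IHm.
move: y; apply: lin_span_ind => [|c u v gu gv|v [nu [<- nu_w ->]]].
- by rewrite mulr0; exact: lin_span0.
- by rewrite mulrDr -scalerAr; exact: lin_spanP.
rewrite xmonI_split // degI_split //.
have gY := graded_mon i.+1 nu.
move: (xmonI _ _) (degI _ _) gY => Y e gY.
have wE k : (i <= k <= n)%N -> w k = if k == i then (nu i)%:Z - (nu (mir i))%:Z
    else wt_hat n oddN k nu.
  by move=> k_bd; rewrite -nu_w //; case: eqVneq => [->|].
move: (nu i) (nu (mir i)) wE => a b wE.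
case: (eqVneq j i) => [->|ne_ji].
  rewrite mulrA mulrA -exprS; apply: graded_ext (graded_step a.+1 b i_bd gY).
    by rewrite !addSn.
  move=> k k_bd; rewrite wE // /wtx; case: eqVneq => [->|ne_ki].
    rewrite ne_mir //; lia.
  rewrite ne_mir ?subr0 ?addr0 //; lia.
case: (eqVneq j (mir i)) => [->|ne_jm]; last first.
  have j_in : (i < j < mir i)%N by lia.
  have xjX c : x j * x i ^+ c = q ^- c *: (x i ^+ c * x j).
    elim: c => [|c IHc]; first by rewrite mulr1 mul1r expr0 invr1 scale1r.
    have e1 : x j * x i = q^-1 *: (x i * x j).
      rewrite (@x_comm i j) ?scalerA ?mulVf ?scale1r //; by move: i_bd j_in; mlia.
    rewrite [x i ^+ _]exprS mulrA e1 -scalerAl -!mulrA IHc -scalerAr scalerA.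
    by rewrite exprS invfM.
  rewrite !mulrA xjX -!scalerAl; apply: lin_spanZ; rewrite -[_ * x j * Y]mulrA.
  have gxY : graded i.+1 e.+1 _ (x j * Y) := mulxS j _ _ _ _ gY.
  apply: graded_ext (graded_step a b i_bd (mulxS j _ _ _ _ gY)) => //.
  - by rewrite addnS addSn.
  - move=> k k_bd; rewrite wE //; case: eqVneq => // ->.
    rewrite /wtx.
    have -> : (i == j) = false by lia.
    have -> : (i == mir j) = false by move: j_in i_bd; mlia.
    by rewrite addr0.
  by move: j_in i_bd; mlia.
rewrite !mulrA x_mirX // !mulrDl; apply: lin_spanD; last first.
  case: a wE => [|a] wE.
    by rewrite expr0 expr1n invr1 subrr mulr0 scale0r !mul0r; exact: lin_span0.
  rewrite -!scalerAl; apply: lin_spanZ; rewrite -[_.+1.-1]/a -[_ * Q _ * _]mulrA.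
  have gQY : graded i.+1 e.+2 _ (Q i.+1 * Y) := graded_Q_of mulxS isT gY.
  apply: graded_ext (graded_step a b i_bd gQY) => //; first by rewrite !addnS !addSn.
  move=> k k_bd; rewrite wE // /wtx; case: eqVneq => [->|ne_ki].
    rewrite ne_mir //.
    rewrite mirK ?eqxx; last by move: i_bd; mlia.
    lia.
  rewrite ne_mir //; last by lia.
  rewrite mirK ?(negbTE ne_ki) ?addr0 //; by move: i_bd; mlia.
have xY : x (mir i) * Y = q ^- e *: (Y * x (mir i)).
  by rewrite (graded_xcomm_r i_bd gY) scalerA mulVf ?expf_neq0 // scale1r.
rewrite -[_ * x (mir i) * Y]mulrA xY -scalerAr -!scalerAl; apply: lin_spanZ.
rewrite [_ * (Y * _)]mulrA -[_ * x (mir i) * _]mulrA -exprS.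
apply: graded_ext (graded_step a b.+1 i_bd gY) => //; first by rewrite !addnS.
move=> k k_bd; rewrite wE // /wtx; case: eqVneq => [->|ne_ki].
  rewrite ne_mir //.
  rewrite mirK ?eqxx; last by move: i_bd; mlia.
  lia.
rewrite ne_mir //; last by lia.
rewrite mirK ?(negbTE ne_ki) ?addr0 //; by move: i_bd; mlia.
Qed.

Lemma graded_Q i d w y : (1 <= i <= n.+1)%N -> graded i d w y ->
  graded i d.+2 w (Q i * y).
Proof.
move=> i_bd; apply: graded_Q_of; last by lia.
by move=> j e v z j_bd; apply: graded_mulx.
Qed.

Lemma graded1 i : graded i 0 (fun=> 0) 1.
Proof.
apply: lin_span_gen; exists (fun=> 0%N); split=> [|k _|].
- by rewrite /degI big1.
- by rewrite /wt_hat subrr.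
by rewrite /xmonI big1.
Qed.

Lemma graded_QX i l : (1 <= i <= n.+1)%N -> graded i l.*2 (fun=> 0) (Q i ^+ l).
Proof.
move=> i_bd; elim: l => [|l IHl]; first exact: graded1.
by rewrite exprS doubleS; apply: graded_Q.
Qed.

Lemma graded_mulX r i d w y (nu : nat -> nat) : (1 <= i <= n.+1)%N ->
  all (fun j => i <= j <= mir i)%N r -> graded i d w y ->
  graded i (\sum_(j <- r) nu j + d) (fun k => w k + \sum_(j <- r) (nu j)%:Z * wtx j k)
    (\prod_(j <- r) x j ^+ nu j * y).
Proof.
move=> i_bd r_bd gy; elim: r r_bd => [|j r IHr] /=.
  move=> _; rewrite [\prod_(_ <- _) _]big_nil mul1r.
  by apply: graded_ext gy => [|k _]; rewrite ?big_nil ?addr0.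
case/andP=> j_bd /IHr{}IHr; rewrite !big_cons -mulrA.
have: graded i (nu j + (\sum_(j <- r) nu j + d))
    (fun k => w k + \sum_(j <- r) (nu j)%:Z * wtx j k + (nu j)%:Z * wtx j k)
    (x j ^+ nu j * (\prod_(j <- r) x j ^+ nu j * y)).
  elim: (nu j) => [|c IHc].
    by rewrite mul1r; apply: graded_ext IHr => // k _; rewrite mul0r addr0.
  rewrite exprS -mulrA; apply: graded_ext (graded_mulx i_bd j_bd IHc) => // k _.
  by rewrite -addrA; congr (_ + _); rewrite -addn1 PoszD mulrDl mul1r.
apply: graded_ext => [|k _]; rewrite ?big_cons; first by rewrite addnA.
by rewrite -addrA; congr (_ + _); rewrite addrC.
Qed.

Lemma sum_wtx i k nu : (1 <= i)%N -> (i <= k <= n)%N ->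
  \sum_(i <= j < (mir i).+1) (nu j)%:Z * wtx j k = wt_hat n oddN k nu.
Proof.
move=> i_gt0 k_bd.
have pick (l : nat) : (i <= l <= mir i)%N ->
    \sum_(i <= j < (mir i).+1) (nu j)%:Z * (j == l)%:Z = (nu l)%:Z.
  move=> l_bd; rewrite (bigD1_seq l) ?iota_uniq ?mem_index_iota //= eqxx mulr1.
  by rewrite big1 ?addr0 // => j /negbTE->; rewrite mulr0.
rewrite /wt_hat -(pick k); last by move: i_gt0 k_bd; mlia.
rewrite -(pick (mir k)); last by move: i_gt0 k_bd; mlia.
rewrite -sumrB !big_nat; apply: eq_bigr => j j_bd; rewrite -mulrBr /wtx.
congr (_ * (_%:Z - _%:Z)); congr (nat_of_bool _); first exact: eq_sym.
by move: i_gt0 k_bd j_bd; mlia.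
Qed.

Lemma graded_mul i d d' w w' y z : (1 <= i <= n.+1)%N ->
  graded i d w y -> graded i d' w' z ->
  graded i (d + d') (fun k => w k + w' k) (y * z).
Proof.
move=> i_bd gy gz; move: y gy; apply: lin_span_ind => [|c u v gu gv|v [nu [<- nu_w ->]]].
- by rewrite mul0r; exact: lin_span0.
- by rewrite mulrDl -scalerAl; exact: lin_spanP.
have r_bd : all (fun j => i <= j <= mir i)%N (index_iota i (mir i).+1).
  by apply/allP => j; rewrite mem_index_iota.
apply: graded_ext (graded_mulX nu i_bd r_bd gz) => // k k_bd.
by rewrite addrC -nu_w // sum_wtx //; lia.
Qed.

Lemma graded_x j : (1 <= j <= N)%N -> graded 1 1 (wtx j) (x j).
Proof.
move=> j_bd; rewrite -[x j]mulr1.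
apply: graded_ext (graded_mulx _ _ (graded1 1)) => //; first by move=> k _; rewrite add0r.
by rewrite mir1.
Qed.

Lemma graded_homog d w p : graded 1 d w p -> homog pi d p.
Proof.
move: p; apply: lin_span_ind => [|c u v|v [nu [nu_d _ ->]]].
- exact: lin_span0.
- exact: lin_spanP.
apply: lin_span_gen; exists nu; split; last exact: xmonI1.
by rewrite -degI1.
Qed.

(** * The Laplacian on the zonal elements *)

Definition ezon i a l b := x i ^+ a * Q i.+1 ^+ l * x (mir i) ^+ b.

Lemma QX_x i l : (1 <= i <= n)%N ->
  x (mir i) * Q i.+1 ^+ l = (q ^+ l) ^- 2 *: (Q i.+1 ^+ l * x (mir i)).
Proof.
move=> i_bd; have gQ : graded i.+1 l.*2 (fun=> 0) (Q i.+1 ^+ l) by apply: graded_QX; case/andP: i_bd.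
rewrite (graded_xcomm_r i_bd gQ) -muln2 exprM scalerA mulVf ?scale1r //.
by rewrite !expf_neq0.
Qed.

Lemma Q_xX i a : (1 <= i <= n)%N ->
  Q i.+1 * x i ^+ a = (q ^+ a) ^- 2 *: (x i ^+ a * Q i.+1).
Proof.
move=> i_bd; elim: a => [|a IHa]; first by rewrite expr1n invr1 scale1r mulr1 mul1r.
have Qx : Q i.+1 * x i = q ^- 2 *: (x i * Q i.+1).
  by rewrite x_Q // scalerA mulVf ?expf_neq0 // scale1r.
rewrite exprSr mulrA IHa -scalerAl -[_ * Q _ * x i]mulrA Qx -scalerAr scalerA mulrA.
by congr (_ *: _); qfield a.
Qed.

(** Two terms contribute to e(a,l+1,b): Q_{i+1} crossing x_i^a gives [bet i] q^-2a, and x_{i'}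
    crossing x_i^a gives [bet i] (1 - q^-2a). They add up to [bet i], whatever a is. *)
Lemma Q_ezon i a l b : (1 <= i <= n)%N ->
  Q i * ezon i a l b = alp i *: ((q ^+ l) ^- 2 *: ezon i a.+1 l b.+1
    + bet i *: ezon i a l.+1 b).
Proof.
move=> i_bd; rewrite Q_rec // -scalerAl; congr (_ *: _).
rewrite mulrDl -scalerAl.
have -> : Q i.+1 * ezon i a l b = (q ^+ a) ^- 2 *: ezon i a l.+1 b.
  by rewrite /ezon !mulrA Q_xX // -!scalerAl -!mulrA [Q _ ^+ _.+1]exprS -!mulrA.
have -> : x i * x (mir i) * ezon i a l b =
    (q ^+ l) ^- 2 *: ezon i a.+1 l b.+1
    + (bet i * (1 - (q ^+ a) ^- 2)) *: ezon i a l.+1 b.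
  rewrite /ezon !mulrA -[_ * _ * x i ^+ a]mulrA x_mirX // mulrDr !mulrDl.
  congr (_ + _).
    rewrite !mulrA -[x i * x i ^+ _]exprS -[_ * x (mir i) * _]mulrA QX_x //.
    by rewrite -scalerAr -!scalerAl -!mulrA -[x (mir i) * _]exprS.
  case: a => [|a]; first by rewrite expr1n invr1 subrr mulr0 !scale0r mulr0 !mul0r.
  by rewrite -scalerAr -!scalerAl !mulrA -[x i * _]exprS -!mulrA [Q _ * _]mulrA -[Q _ * _]exprS.
rewrite -addrA scalerA -scalerDl; congr (_ + _ *: _).
by rewrite mulrBr mulr1 subrK.
Qed.

Lemma graded_ezon i a l b : (1 <= i <= n)%N ->
  graded i (a + l.*2 + b) (fun k => if k == i then a%:Z - b%:Z else 0) (ezon i a l b).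
Proof. by move=> i_bd; apply: graded_step => //; apply: graded_QX; case/andP: i_bd. Qed.

(** The Laplacian is given on full monomials only, so a monomial of level i is read as a full one
    whose exponents vanish outside i, ..., i'. *)
Definition supp i (nu : nat -> nat) :=
  forall k, (1 <= k <= N)%N -> ~~ (i <= k <= mir i)%N -> nu k = 0%N.

Lemma xmon_supp i nu : (1 <= i <= n.+1)%N -> supp i nu -> xmon pi nu = xmonI i nu.
Proof.
move=> i_bd nu_s; rewrite /xmon.
rewrite (@big_cat_nat _ _ _ i) /=; [|by move: i_bd; mlia..].
rewrite (@big_cat_nat _ _ _ (mir i).+1 i) /=; [|by move: i_bd; mlia..].
rewrite [X in X * _]big1_seq ?mul1r; last first.
  move=> j /andP[_]; rewrite mem_index_iota => j_bd; rewrite nu_s //; last by lia.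
  by move: i_bd j_bd; mlia.
rewrite [X in _ * X]big1_seq ?mulr1 //.
move=> j /andP[_]; rewrite mem_index_iota => j_bd; rewrite nu_s //.
  by move: i_bd j_bd; mlia.
by move: i_bd j_bd; mlia.
Qed.

Lemma mdegree_supp i nu : (1 <= i <= n.+1)%N -> supp i nu ->
  mdegree n oddN nu = degI i nu.
Proof.
move=> i_bd nu_s; rewrite /mdegree.
rewrite (@big_cat_nat _ _ _ i) /=; [|by move: i_bd; mlia..].
rewrite (@big_cat_nat _ _ _ (mir i).+1 i) /=; [|by move: i_bd; mlia..].
rewrite [X in (X + _)%N]big1_seq ?add0n; last first.
  move=> j /andP[_]; rewrite mem_index_iota => j_bd; rewrite nu_s //; last by lia.
  by move: i_bd j_bd; mlia.
rewrite [X in (_ + X)%N]big1_seq ?addn0 //.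
move=> j /andP[_]; rewrite mem_index_iota => j_bd; rewrite nu_s //.
  by move: i_bd j_bd; mlia.
by move: i_bd j_bd; mlia.
Qed.

Lemma xmon_ext mu nu : (forall j, (1 <= j <= N)%N -> mu j = nu j) ->
  xmon pi mu = xmon pi nu.
Proof. by move=> e; apply: eq_big_nat => j j_bd; rewrite e. Qed.

Definition res i (nu : nat -> nat) : nat -> nat :=
  fun k => if (i <= k <= mir i)%N then nu k else 0%N.

Lemma supp_res i nu : supp i (res i nu).
Proof. by move=> k _ /negbTE k_out; rewrite /res k_out. Qed.

Lemma xmonI_res i nu : (1 <= i <= n.+1)%N -> xmonI i nu = xmon pi (res i nu).
Proof.
move=> i_bd; rewrite (xmon_supp i_bd (@supp_res i nu)).
by apply: xmonI_ext => j j_bd; rewrite /res j_bd.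
Qed.

Lemma supp_upd i a b nu : (1 <= i <= n)%N -> supp i.+1 nu -> supp i (upd i a b nu).
Proof.
move=> i_bd nu_s k k_bd k_out; rewrite /upd !ifN; try by move: i_bd k_out; mlia.
by apply: nu_s => //; move: i_bd k_out; mlia.
Qed.

Lemma xmon_upd i a b nu : (1 <= i <= n)%N -> supp i.+1 nu ->
  xmon pi (upd i a b nu) = x i ^+ a * xmon pi nu * x (mir i) ^+ b.
Proof.
move=> i_bd nu_s; rewrite (xmon_supp _ (supp_upd a b i_bd nu_s)); last by lia.
by rewrite xmonI_upd // (xmon_supp _ nu_s) //; lia.
Qed.

Lemma mdegree_upd i a b nu : (1 <= i <= n)%N -> supp i.+1 nu ->
  mdegree n oddN (upd i a b nu) = (a + b + mdegree n oddN nu)%N.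
Proof.
move=> i_bd nu_s; rewrite (mdegree_supp _ (supp_upd a b i_bd nu_s)); last by lia.
by rewrite degI_upd // (mdegree_supp _ nu_s); lia.
Qed.

Lemma supp_lower2 i nu j k : supp i nu -> supp i (lower2 nu j k).
Proof. by move=> nu_s l l_bd l_out; rewrite /lower2 nu_s. Qed.

Lemma dexp_upd i a b nu j : (1 <= i)%N -> (i < j)%N -> (j <= n.+1)%N -> supp i.+1 nu ->
  dexp n oddN (upd i a b nu) j = (a + b + dexp n oddN nu j)%N.
Proof.
move=> i_gt0 lt_ij le_jn nu_s; rewrite /dexp.
have -> : (a + b = \sum_(1 <= k < j) (k == i) * (a + b))%N.
  rewrite (bigD1_seq i) ?iota_uniq ?mem_index_iota ?i_gt0 //= eqxx mul1n.
  by rewrite big1 ?addn0 // => k /negbTE->.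
rewrite -big_split !big_nat; apply: eq_bigr => k k_bd /=.
have i_bd : (1 <= i <= n)%N by lia.
case: eqVneq => [->|ne_ki].
  rewrite upd_l upd_r // mul1n !nu_s ?addn0 //; by move: i_bd; mlia.
rewrite mul0n add0n /upd (negbTE ne_ki) !ifN //; by move: i_bd k_bd ne_ki; mlia.
Qed.

Lemma dexp_low i nu : (1 <= i <= n)%N -> supp i nu -> dexp n oddN nu i = 0%N.
Proof.
move=> i_bd nu_s; rewrite /dexp big_nat big1 // => k k_bd.
by rewrite !nu_s //; move: i_bd k_bd; mlia.
Qed.

Section Laplacian.

Variable Delta : {linear A -> A}.
Hypothesis Delta_def : is_qlaplace q s pi Delta.

Definition w0 := 1 + q ^ (N%:Z - 2).

(** The coefficient with which the Laplacian removes one pair x_i, x_{i'} from x_i^a y x_{i'}^b, for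
    y in the inner generators of degree d. *)
Definition lower_coef i a b d :=
  w0 * q ^ ((a + b + d)%:Z - 1) * (qnum_sym q a%:Z * qnum_sym q b%:Z / qrho i).

Lemma qnum_sym0 : qnum_sym q 0 = 0.
Proof. by rewrite /qnum_sym oppr0 subrr mul0r. Qed.

Lemma eq_if0 (b : bool) (u v : A) : (b -> u = v) ->
  (if b then u else 0) = (if b then v else 0).
Proof. by case: b => // ->. Qed.

Lemma if0_lin (b : bool) (c : C) (u t v : A) :
  c *: (u * (if b then t else 0) * v) = if b then c *: (u * t * v) else 0.
Proof. by case: b => //; rewrite mulr0 mul0r scaler0. Qed.

(** The prefactor q^(|nu|-1) supplies one factor q^(a+b). The other comes from d_j for the inner
    pairs, and from q^(|nu| - 2 nu_{n+1} + 2) for the middle generator. Pairs j < i drop out since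
    [0]_q = 0. *)
Lemma Delta_xmon_upd i a b nu : (1 <= i <= n)%N -> supp i.+1 nu ->
  Delta (xmon pi (upd i a b nu)) =
    lower_coef i a b (mdegree n oddN nu) *: (x i ^+ a.-1 * xmon pi nu * x (mir i) ^+ b.-1)
    + (q ^+ (a + b)) ^+ 2 *: (x i ^+ a * Delta (xmon pi nu) * x (mir i) ^+ b).
Proof.
move=> i_bd nu_s; rewrite !Delta_def mdegree_upd //.
set u := upd i a b nu.
set K := (qnum_sym q a%:Z * qnum_sym q b%:Z / qrho i) *:
  (x i ^+ a.-1 * xmon pi nu * x (mir i) ^+ b.-1).
set Su := \sum_(_ <= _ < _) _; set Mu := (if _ then _ else _).
set Sn := \sum_(_ <= _ < _) _; set Mn := (if _ then _ else _).
have lower_upd j : (i < j < mir i)%N ->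
    xmon pi (lower2 u j (mir j)) = x i ^+ a * xmon pi (lower2 nu j (mir j)) * x (mir i) ^+ b.
  move=> j_bd; rewrite -xmon_upd //; last exact: supp_lower2.
  apply: xmon_ext => k k_bd; rewrite /lower2 /u /upd.
  case: (eqVneq k i) => [->|_].
    have [-> ->] : (i == j = false) /\ (i == mir j = false).
      by split; move: i_bd j_bd; mlia.
    by rewrite !subn0.
  case: (eqVneq k (mir i)) => [->|_] //.
  have [-> ->] : (mir i == j = false) /\ (mir i == mir j = false).
    by split; move: i_bd j_bd; mlia.
  by rewrite !subn0.
have -> : Mu = q ^+ (a + b) *: (x i ^+ a * Mn * x (mir i) ^+ b).
  rewrite /Mu /Mn if0_lin; apply: eq_if0 => oN.
  have n1_in : (i < n.+1 < mir i)%N by move: i_bd oN; mlia.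
  have e : mir n.+1 = n.+1 by move: oN; mlia.
  have := lower_upd _ n1_in; rewrite e => ->.
  rewrite /u upd_in // -scalerAr -scalerAl scalerA; congr (_ *: _).
  rewrite [RHS]mulrCA; congr (_ * _); rewrite mulrA; congr (_ / _).
  rewrite exprnP -expfzDr //; congr (q ^ _); lia.
have -> : Su = K + q ^+ (a + b) *: (x i ^+ a * Sn * x (mir i) ^+ b).
  have -> : K = \sum_(1 <= j < n.+1) (if j == i then K else 0).
    rewrite (bigD1_seq i) ?iota_uniq ?mem_index_iota //= eqxx big1 ?addr0 //.
    by move=> j /negbTE->.
  rewrite /Su /Sn mulr_sumr mulr_suml scaler_sumr -big_split !big_nat.
  apply: eq_bigr => j j_bd /=; rewrite -scalerAr -scalerAl scalerA.
  case: (ltngtP j i) => [lt_ji|lt_ij|->].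
  - have out : ~~ (i <= j <= mir i)%N by lia.
    rewrite [u j](supp_upd a b i_bd nu_s) //; last by move: j_bd; mlia.
    rewrite [nu j]nu_s; [|by move: j_bd; mlia|by lia].
    by rewrite qnum_sym0 !mul0r mulr0 !scale0r addr0.
  - rewrite lower_upd; last by move: j_bd lt_ij; mlia.
    rewrite add0r; congr (_ *: _); rewrite /u !upd_in; try by move: j_bd lt_ij; mlia.
    rewrite dexp_upd //; [|by lia..].
    by rewrite exprD; ring.
  rewrite [nu i]nu_s; [|by move: i_bd; mlia|by lia].
  rewrite qnum_sym0 !mul0r mulr0 scale0r addr0 /u upd_l upd_r // dexp_low //; last first.
    exact: supp_upd.
  rewrite expr0 mulr1 /K -xmon_upd //; congr (_ *: _); apply: xmon_ext => k k_bd.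
  rewrite /lower2 /upd; case: (eqVneq k i) => [->|_].
    by rewrite ne_mir // subn0 subn1.
  by case: eqVneq => _; rewrite ?subn0 ?subn1.
rewrite -addrA -scalerDr -mulrDl -mulrDr scalerDr; congr (_ + _).
  by rewrite /K scalerA.
rewrite -scalerAr -scalerAl !scalerA; congr (_ *: _).
rewrite -/w0 PoszD -addrA [q ^ (_ + (_ - 1))]expfzDr // -exprnP expr2; ring.
Qed.

Lemma Delta_step i a b d w t : (1 <= i <= n)%N -> graded i.+1 d w t ->
  Delta (x i ^+ a * t * x (mir i) ^+ b) =
    lower_coef i a b d *: (x i ^+ a.-1 * t * x (mir i) ^+ b.-1)
    + (q ^+ (a + b)) ^+ 2 *: (x i ^+ a * Delta t * x (mir i) ^+ b).
Proof.
move=> i_bd; have iS_bd : (1 <= i.+1 <= n.+1)%N by case/andP: i_bd.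
move: t; apply: lin_span_ind => [|c u v eu ev|v [nu [<- _ ->]]].
- by rewrite !linear0 !mulr0 !mul0r linear0 !scaler0 addr0.
- rewrite mulrDr mulrDl -scalerAr -scalerAl !(linearP Delta) eu ev.
  rewrite !(mulrDr, mulrDl) -!(scalerAr, scalerAl) !scalerDr !scalerA.
  by rewrite ![c * _]mulrC addrACA.
rewrite xmonI_res //.
have -> : degI i.+1 nu = degI i.+1 (res i.+1 nu).
  by apply: degI_ext => j j_bd; rewrite /res j_bd.
by rewrite -(mdegree_supp iS_bd (@supp_res i.+1 nu)) -xmon_upd ?Delta_xmon_upd //; exact: supp_res.
Qed.

(* [mm i] is the number of the generators x_i, ..., x_{i'}; [lam] and [theta] are
   determined by Delta (Q_i f) = q^2 Q_i Delta f + lam i k f, for f in the span of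
   the e(j,l,j) with j + l = k, and by Delta (Q_i^l) = theta i l Q_i^(l-1). *)
Definition mm i := (N + 2 - i.*2)%N.

Definition lam i k : C :=
  w0 * (q ^+ 2 - 1) / (q - q^-1) ^+ 2 * (1 + q ^+ mm i / q ^+ 2)
  * (q / q ^+ mm i) * (q ^+ mm i * (q ^+ k) ^+ 4 - 1).

Fixpoint theta i l : C :=
  if l is k.+1 then q ^+ 2 * theta i k + lam i k else 0.

Lemma qq_neq0 : q ^+ 2 - 1 != 0.
Proof. by rewrite subr_eq0; apply: q_nroot. Qed.

Lemma lower_coefE i a b d : lower_coef i a b d =
  w0 * (q ^+ a * q ^+ b * q ^+ d / q)
   * ((q ^+ a - (q ^+ a)^-1) / (q - q^-1) * ((q ^+ b - (q ^+ b)^-1) / (q - q^-1)) / qrho i).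
Proof.
rewrite /lower_coef /qnum_sym -!exprnN -!exprnP; congr (_ * _ * _).
by rewrite expfzDr // -exprnN expr1 -exprnP !exprD.
Qed.

Lemma lower_coef0 i b d : lower_coef i 0 b d = 0.
Proof. by rewrite lower_coefE expr0 invr1 subrr !mul0r mulr0. Qed.

(** Rewrites [lam i] in the single unknown [qrho i], as [lamSE] does for [lam i.+1], so that the two
    levels can be compared by a rational identity. *)
Lemma lamE i k : (1 <= i <= n)%N -> lam i k =
  w0 * (q ^+ 2 - 1) / (q - q^-1) ^+ 2 * (1 + qrho i ^+ 2)
  / (q * qrho i ^+ 2) * (q ^+ 2 * qrho i ^+ 2 * (q ^+ k) ^+ 4 - 1).
Proof.
move=> i_bd; rewrite /lam; have -> : q ^+ mm i = q ^+ 2 * qrho i ^+ 2.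
  by rewrite sqr_qrho -?exprD; [congr (_ ^+ _); move: i_bd; rewrite /mm; mlia | lia].
by field; rewrite q_neq0 qrho_neq0 -expr2 qq_neq0.
Qed.

Lemma lamSE i k : (1 <= i <= n)%N -> lam i.+1 k =
  w0 * (q ^+ 2 - 1) / (q - q^-1) ^+ 2 * (1 + qrho i ^+ 2 / q ^+ 2)
  * (q / qrho i ^+ 2) * (qrho i ^+ 2 * (q ^+ k) ^+ 4 - 1).
Proof.
move=> i_bd; rewrite /lam; have -> // : q ^+ mm i.+1 = qrho i ^+ 2.
by rewrite sqr_qrho; [congr (_ ^+ _); move: i_bd; rewrite /mm; mlia | lia].
Qed.

Lemma Delta_ezon i a l b (th : nat -> C) : (1 <= i <= n)%N ->
    (forall l, Delta (Q i.+1 ^+ l) = th l *: Q i.+1 ^+ l.-1) ->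
  Delta (ezon i a l b) = lower_coef i a b l.*2 *: ezon i a.-1 l b.-1
    + ((q ^+ (a + b)) ^+ 2 * th l) *: ezon i a l.-1 b.
Proof.
move=> i_bd DQ.
have gQ : graded i.+1 l.*2 (fun=> 0) (Q i.+1 ^+ l).
  by apply: graded_QX; case/andP: i_bd.
by rewrite (Delta_step a b i_bd gQ) DQ -scalerAr -scalerAl scalerA.
Qed.

Lemma lower_coefS i a b d : lower_coef i a b d.+2 = q ^+ 2 * lower_coef i a b d.
Proof. by rewrite !lower_coefE !exprS; ring. Qed.

(** Up to [alp i], the left side is the coefficient of e(j,l,j) in Delta (Q_i e(j,l,j)) - q^2 Q_i
    Delta e(j,l,j). It depends on j and l through j + l only, which is why that difference is a
    scalar on all e(j,l,j) with j + l fixed. *)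
Lemma lower_coef_lam i j l : (1 <= i <= n)%N ->
  (q ^+ l) ^- 2 * (lower_coef i j.+1 j.+1 l.*2 - q ^+ 2 * lower_coef i j j l.*2)
    + bet i * (q ^+ j) ^+ 4 * lam i.+1 l = lam i (j + l) / alp i.
Proof.
move=> i_bd; have [_ le_in] := andP i_bd.
rewrite (lamE _ i_bd) (lamSE _ i_bd) !lower_coefE /alp /bet -muln2 exprM !exprS exprD.
have := den_neq0 le_in; have := qq_neq0; have := qrho_neq0 i.
have : qrho i ^+ 2 + 1 != 0 by rewrite sqr_qrho //; exact: (expqD_neq0 _ 0).
have := expf_neq0 j q_neq0; have := expf_neq0 l q_neq0.
move: (qrho i) (q ^+ j) (q ^+ l) => r X Y Y0 X0 r1 r0 q1 d0.
field; rewrite X0 Y0 r0 q_neq0 -!expr2 q1 r1 d0 //.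
Qed.

Lemma lin_comb3 (c1 c2 c3 c4 d1 d2 d3 d4 d5 : C) (e e1 e2 : A) :
    c1 + c4 = d1 + d4 + d5 -> c2 = d3 -> c3 = d2 ->
  c1 *: e + c2 *: e1 + (c3 *: e2 + c4 *: e) =
  d1 *: e + d2 *: e2 + (d3 *: e1 + d4 *: e) + d5 *: e.
Proof.
move=> e_c <- <-; rewrite [c3 *: e2 + _]addrC addrACA -scalerDl e_c.
rewrite [c2 *: e1 + d4 *: e]addrC [X in _ = X + _]addrACA.
by rewrite [RHS]addrAC -!scalerDl [c2 *: e1 + _]addrC.
Qed.

(** Both sides are combinations of e(j,l,j), e(j+1,l-1,j+1) and e(j-1,l+1,j-1). The coefficients of
    the last two agree by powers of q alone; that of the first is [lower_coef_lam]. *)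
Lemma Delta_Q_ezon i j l : (1 <= i <= n)%N ->
    (forall l, Delta (Q i.+1 ^+ l) = theta i.+1 l *: Q i.+1 ^+ l.-1) ->
  Delta (Q i * ezon i j l j) =
    q ^+ 2 *: (Q i * Delta (ezon i j l j)) + lam i (j + l) *: ezon i j l j.
Proof.
move=> i_bd DQ; have [_ le_in] := andP i_bd.
have DE a k b := Delta_ezon a k b i_bd DQ.
rewrite DE mulrDr -!scalerAr.
have eU : lower_coef i j j l.*2 *: (Q i * ezon i j.-1 l j.-1) =
    (lower_coef i j j l.*2 * alp i) *: ((q ^+ l) ^- 2 *: ezon i j l j
      + bet i *: ezon i j.-1 l.+1 j.-1).
  (* At j = 0 the meaningless [j.-1] is multiplied by zero, as is [l.-1] at l = 0 in the next
     identity. *)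
  case: j => [|j]; first by rewrite lower_coef0 mul0r !scale0r.
  by rewrite Q_ezon // scalerA.
have eT : theta i.+1 l *: (Q i * ezon i j l.-1 j) =
    (theta i.+1 l * alp i) *: ((q ^+ 2 * (q ^+ l) ^- 2) *: ezon i j.+1 l.-1 j.+1
      + bet i *: ezon i j l j).
  case: l {eU} => [|l]; first by rewrite mul0r !scale0r.
  rewrite Q_ezon // scalerA; congr (_ *: (_ *: _ + _)); qfield l.
rewrite -[(_ * theta _ _) *: _]scalerA eU eT Q_ezon // linearZ linearD !linearZ /= !DE.
rewrite -[j.+1.-1]/j -[l.+1.-1]/l !scalerDr !scalerA.
move: (ezon i j l j) (ezon i j.+1 l.-1 j.+1) (ezon i j.-1 l.+1 j.-1) => e e1 e2.
rewrite doubleS lower_coefS.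
have a0 := alp_neq0 le_in.
have := lower_coef_lam j l i_bd; rewrite [theta _ l.+1]/=.
have -> : q ^+ (j.+1 + j.+1) = (q ^+ 2 * (q ^+ j) ^+ 2) by rewrite addSn addnS !exprS exprD; ring.
have -> : q ^+ (j + j) = (q ^+ j) ^+ 2 by rewrite exprD expr2.
move: (lower_coef _ _ _ _) (lower_coef _ _ _ _) (lam i.+1 l) (lam i _) (theta _ _).
move=> U U1 L' L th e_L.
have -> : L = alp i * ((q ^+ l) ^- 2 * (U1 - q ^+ 2 * U) + bet i * (q ^+ j) ^+ 4 * L').
  by rewrite e_L mulrC divfK.
have X0 := expf_neq0 j q_neq0; have Y0 := expf_neq0 l q_neq0.
by apply: lin_comb3; field; rewrite ?X0 ?Y0.
Qed.

(** Keeps the powers of Q_i inside the span on which [Delta_Q_ezon] gives one and the same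
    scalar. *)
Lemma Q_pow i k : (1 <= i <= n)%N ->
  lin_span (fun v => exists j l, (j + l = k)%N /\ v = ezon i j l j) (Q i ^+ k).
Proof.
move=> i_bd; elim: k => [|k IHk].
  by apply: lin_span_gen; exists 0%N, 0%N; rewrite /ezon !mulr1.
rewrite exprS; move: (Q i ^+ k) IHk; apply: lin_span_ind => [|c u v gu gv|v [j [l [e ->]]]].
- by rewrite mulr0; exact: lin_span0.
- by rewrite mulrDr -scalerAr; exact: lin_spanP.
rewrite Q_ezon // scalerDr !scalerA; apply: lin_spanP.
  by apply: lin_span_gen; exists j.+1, l; rewrite addSn e.
by apply/lin_spanZ/lin_span_gen; exists j, l.+1; rewrite addnS e.
Qed.

Lemma Delta1 : Delta 1 = 0.
Proof.
have -> : 1 = xmon pi (fun=> 0%N) by rewrite /xmon big1.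
rewrite Delta_def big1 ?add0r => [|j _]; last by rewrite qnum_sym0 !mul0r scale0r.
have -> : qnum q 0 = 0 by rewrite /qnum expr0z subrr mul0r.
by rewrite mulr0 mul0r scale0r if_same scaler0.
Qed.

Lemma xmon_mid c : oddN ->
  xmon pi (fun k => if k == n.+1 then c else 0%N) = x n.+1 ^+ c.
Proof.
move=> oN; rewrite (@xmon_supp n.+1) ?leqnn //; last first.
  by move=> k _; case: eqVneq => // ->; move: oN; mlia.
have eI : index_iota n.+1 (mir n.+1).+1 = [:: n.+1] by rewrite index_iota_mid oN.
by rewrite /xmonI eI big_seq1 eqxx.
Qed.

Lemma Delta_mid c : oddN -> Delta (x n.+1 ^+ c) =
  (w0 * q ^ (c%:Z - 1) * (qnum q (c%:Z - 1) * qnum q c%:Z * (q ^ (2 - c%:Z) / (1 + q))))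
  *: x n.+1 ^+ c.-2.
Proof.
move=> oN; rewrite -(xmon_mid c oN) Delta_def.
have -> : mdegree n oddN (fun k => if k == n.+1 then c else 0%N) = c.
  rewrite (@mdegree_supp n.+1) ?leqnn //; last first.
    by move=> k _; case: eqVneq => // ->; move: oN; mlia.
  have eI : index_iota n.+1 (mir n.+1).+1 = [:: n.+1] by rewrite index_iota_mid oN.
  by rewrite /degI eI big_seq1 eqxx.
rewrite big_nat big1 ?add0r => [|j j_bd]; last first.
  have -> : (j == n.+1) = false by lia.
  by rewrite qnum_sym0 !mul0r scale0r.
rewrite [if oddN then _ else _](_ : _ = (qnum q (c%:Z - 1) * qnum q c%:Z *
  (q ^ (2 - c%:Z) / (1 + q))) *: x n.+1 ^+ c.-2) ?scalerA //.
rewrite ifT // eqxx -(xmon_mid _ oN).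
have -> : c%:Z - c.*2%:Z + 2 = 2 - c%:Z by lia.
congr (_ *: _); apply: xmon_ext => k k_bd; rewrite /lower2.
by case: eqVneq => // _; rewrite !subn1.
Qed.

Lemma Delta_Qmid l : Delta (Q n.+1 ^+ l) = theta n.+1 l *: Q n.+1 ^+ l.-1.
Proof.
have Qmid : Q n.+1 = if oddN then x n.+1 ^+ 2 else 0.
  have := Qop_mid lx 1; rewrite Qop_lx mulr1 => ->.
  by apply: eq_if0 => _; rewrite !lxE mulr1 expr2.
case oN: {-}oddN; last first.
  rewrite Qmid ifF //.
  (* Although Q_{n+1} = 0 here, for l = 1 the right side is a multiple of Q_{n+1}^0 = 1, so the
     factor itself has to vanish. It does because [mm n.+1] is 0. *)
  have th1 : theta n.+1 1 = 0.
    rewrite /= mulr0 add0r /lam.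
    have -> : mm n.+1 = 0%N by move: oN; rewrite /mm; mlia.
    by rewrite expr0 expr1n mulr1 subrr mulr0.
  case: l => [|[|l]]; last by rewrite !expr0n /= scaler0 linear0.
    by rewrite !expr0 Delta1 scale0r.
  by rewrite th1 scale0r expr1 linear0.
have {}Qmid : Q n.+1 = x n.+1 ^+ 2 by rewrite Qmid ifT.
rewrite Qmid -!exprM Delta_mid //.
have -> : (2 * l.-1 = (2 * l).-2)%N by lia.
congr (_ *: _).
have q1 : 1 - q != 0 by rewrite subr_eq0 eq_sym; exact: (@q_nroot 1).
have q1' : 1 + q != 0 by exact: (expqD_neq0 0 1).
have q2 := qq_neq0.
have -> : w0 * q ^ ((2 * l)%:Z - 1) * (qnum q ((2 * l)%:Z - 1) * qnum q (2 * l)%:Z *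
   (q ^ (2 - (2 * l)%:Z) / (1 + q))) =
   w0 * q / (1 + q) / (1 - q) ^+ 2 * ((1 - (q ^+ l) ^+ 2 / q) * (1 - (q ^+ l) ^+ 2)).
  rewrite /qnum !expfzDr // -!exprnN -!exprnP expr1 mulnC exprM.
  have z0 := expf_neq0 l q_neq0; move: (q ^+ l) z0 => z z0.
  by field; rewrite q_neq0 q1 q1' z0.
have e : mm n.+1 = 1%N by move: oN; rewrite /mm; mlia.
elim: l => [|l IHl] /=; first by rewrite expr1n subrr !mulr0.
rewrite -IHl /lam e expr1; have z0 := expf_neq0 l q_neq0.
rewrite !exprS; move: (q ^+ l) z0 => z z0.
by field; rewrite -expr2 q_neq0 q1 q1' q2.
Qed.

Lemma Delta_QX i l : (1 <= i <= n.+1)%N ->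
  Delta (Q i ^+ l) = theta i l *: Q i ^+ l.-1.
Proof.
have [m] := ubnP (n.+1 - i); elim: m => // m IHm in i l *.
rewrite ltnS => le_m i_bd.
case: (ltnP n i) => lt_ni.
  have -> : i = n.+1 by lia.
  exact: Delta_Qmid.
have {}i_bd : (1 <= i <= n)%N by lia.
have DQ k : Delta (Q i.+1 ^+ k) = theta i.+1 k *: Q i.+1 ^+ k.-1.
  by apply: IHm; lia.
(* With v = Q_i^k this becomes the recursion that defines [theta]. *)
have DQS k v : lin_span (fun v => exists j l, (j + l = k)%N /\ v = ezon i j l j) v ->
    Delta (Q i * v) = q ^+ 2 *: (Q i * Delta v) + lam i k *: v.
  move: v; apply: lin_span_ind => [|c u v eu ev|v [j [l' [<- ->]]]].
  - by rewrite mulr0 !linear0 mulr0 !scaler0 addr0.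
  - rewrite mulrDr -scalerAr !(linearP Delta) eu ev.
    rewrite mulrDr -scalerAr !scalerDr !scalerA.
    by rewrite ![c * _]mulrC addrACA.
  exact: Delta_Q_ezon.
elim: l => [|l IHl]; first by rewrite expr0 Delta1 scale0r.
rewrite exprS (DQS l) ?IHl /=; last exact: Q_pow.
rewrite scalerDl; congr (_ + _); rewrite -scalerAr scalerA.
by case: l {IHl} => [|l] /=; rewrite ?mulr0 ?scale0r // -exprS.
Qed.

(** * The action of the quantum algebra *)

Section Action.

Variable U : so_action q s pi.

Definition wtw i (w : nat -> int) : int :=
  if (i < n)%N then w i - w i.+1
  else if oddN then w n else w n.-1 + w n.

Lemma K_graded i d w p : (1 <= i <= n)%N -> graded 1 d w p ->
  Kop U i p = q ^ wtw i w *: p /\ KVop U i p = q ^ (- wtw i w) *: p.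
Proof.
move=> i_bd; move: p; apply: lin_span_ind => [|c u v [eu eu'] [ev ev']|v [nu [_ nu_w ->]]].
- by rewrite !linear0.
- rewrite (linearP (Kop U i)) (linearP (KVop U i)) eu ev eu' ev' !scalerDr !scalerA.
  by rewrite ![c * _]mulrC.
rewrite xmonI1 (Kop_mon U) // (KVop_mon U) //.
suff -> : wt n oddN i nu = wtw i w by [].
rewrite /wt /wtw; case: ifP => lt_in; first by rewrite !nu_w //; lia.
case: ifP => oN; first by rewrite nu_w //; lia.
by rewrite !nu_w //; move: oN i_bd N_ge3; rewrite /dimN; lia.
Qed.

Lemma K_x i j : (1 <= i <= n)%N -> (1 <= j <= N)%N ->
  Kop U i (x j) = q ^ wtw i (wtx j) *: x j /\
  KVop U i (x j) = q ^ (- wtw i (wtx j)) *: x j.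
Proof. by move=> i_bd j_bd; apply: K_graded i_bd (graded_x j_bd). Qed.

Definition shiftn i p (nu : nat -> nat) : nat -> nat :=
  fun k => (nu k + (k == i) - (k == p))%N.

(** The shape of E_k on monomials: one unit moves from p to i, or from p' to j. Only the vanishing
    of the two coefficients matters later, and it also neutralizes the truncated subtraction in
    [shiftn]. *)
Definition raising (E : A -> A) i p j p' := forall nu, exists u v,
  [/\ E (xmon pi nu) = u *: xmon pi (shiftn i p nu) + v *: xmon pi (shiftn j p' nu),
      (u == 0) = (nu p == 0%N) & (v == 0) = (nu p' == 0%N)].

Lemma geom_neq0 m c : (0 < m)%N -> (0 < c)%N -> \sum_(t < c) (q ^- m) ^+ t != 0.
Proof.
move=> m_gt0 c_gt0; apply/negP => /eqP sum0.
have := subrX1 (q ^- m) c; rewrite sum0 mulr0 => /eqP; rewrite subr_eq0.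
rewrite exprVn -exprM -[1]invr1 (inj_eq (@invr_inj _)) (negPf (q_nroot _)) //.
by rewrite muln_gt0 m_gt0.
Qed.

(** The t-th copy of x_p contributes q^(-mt) from K_k acting on the preceding copies and q^-t from
    moving x_i in front of them, whence the ratio q^-(m+1). *)
Lemma E_pow k p i e m c : (1 <= k <= n)%N ->
    Eop U k (x p) = e *: x i -> Kop U k (x p) = q ^- m *: x p ->
    x p * x i = q^-1 *: (x i * x p) ->
  Eop U k (x p ^+ c) = (e * \sum_(t < c) (q ^- m.+1) ^+ t) *: (x i * x p ^+ c.-1).
Proof.
move=> k_bd Ep Kp xx; elim: c => [|c IHc].
  by rewrite (Eop1 U) // big_ord0 mulr0 scale0r.
rewrite exprS (EopM U) // Ep Kp IHc -scalerAl -scalerAr -scalerAl scalerA.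
rewrite mulrA xx -scalerAl scalerA big_ord_recl expr0 mulrDr mulr1 scalerDl.
congr (_ + _); case: c {IHc} => [|c].
  by rewrite !big_ord0 !mulr0 !mul0r !scale0r.
rewrite -[_ * x p * _]mulrA -[x p * _]exprS; congr (_ *: _).
have -> : \sum_(t < c.+1) (q ^- m.+1) ^+ lift ord0 t =
    q ^- m.+1 * \sum_(t < c.+1) (q ^- m.+1) ^+ t.
  by rewrite mulr_sumr; apply: eq_bigr => t _; rewrite -exprS.
move: (\sum_(_ < _) _) => z; qfield m.
Qed.

Lemma prod_mulx p i (nu : nat -> nat) : (1 <= i)%N -> (i < p)%N ->
    (forall l, (i < l < p)%N -> exists2 c, c != 0 & x l * x i = c *: (x i * x l)) ->
  exists2 c, c != 0 & (\prod_(1 <= l < p) x l ^+ nu l) * x i =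
    c *: \prod_(1 <= l < p) x l ^+ (nu l + (l == i)).
Proof.
move=> i_gt0 lt_ip xx.
have [c c_neq0 e] : exists2 c, c != 0 & (\prod_(i.+1 <= l < p) x l ^+ nu l) * x i =
    c *: (x i * \prod_(i.+1 <= l < p) x l ^+ nu l).
  have : forall l, l \in index_iota i.+1 p -> (i < l < p)%N by move=> l; rewrite mem_index_iota.
  elim: (index_iota _ _) => [|l r IHr] r_bd.
    by exists 1; rewrite ?oner_eq0 // big_nil mulr1 mul1r scale1r.
  have [|c c_neq0 e] := IHr; first by move=> l' l'_r; apply: r_bd; rewrite inE l'_r orbT.
  have [c' c'_neq0 e'] := xx l (r_bd l (mem_head _ _)).
  exists (c * c' ^+ nu l); first by rewrite mulf_neq0 ?expf_neq0.
  have eX : x l ^+ nu l * x i = c' ^+ nu l *: (x i * x l ^+ nu l).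
    elim: (nu l) => [|m IHm]; first by rewrite mulr1 mul1r scale1r.
    by rewrite [x l ^+ _]exprSr -mulrA e' -scalerAr !mulrA IHm -scalerAl scalerA -exprS.
  by rewrite !big_cons -mulrA e -scalerAr !mulrA eX -!scalerAl scalerA.
exists c => //.
rewrite !(@big_cat_nat _ _ _ i 1 p) //=; try lia.
rewrite !(@big_ltn _ _ _ i p) // eqxx addn1 exprSr -!mulrA e -!scalerAr; congr (_ *: (_ * _)).
  rewrite !big_nat; apply: eq_bigr => l l_bd.
  by rewrite (_ : (l == i) = false) ?addn0 //; lia.
congr (_ * (_ * _)); rewrite !big_nat; apply: eq_bigr => l l_bd.
by rewrite (_ : (l == i) = false) ?addn0 //; lia.
Qed.

(** E_k acts on the powers of x_p and x_{p'} only. K_k scales the factors before them by a nonzero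
    number, and the new generator is moved left to its place past generators with which it commutes
    up to a nonzero factor, so no straightening occurs. *)
Lemma raising_of k p i e m p' j e' m' : (1 <= k <= n)%N ->
    (1 <= i)%N -> (i < p)%N -> (p < p')%N -> (1 <= j)%N -> (j < p')%N -> (p' <= N)%N ->
    (forall l, (1 <= l <= N)%N -> l != p -> l != p' -> Eop U k (x l) = 0) ->
    e != 0 -> Eop U k (x p) = e *: x i -> Kop U k (x p) = q ^- m *: x p ->
    x p * x i = q^-1 *: (x i * x p) ->
    e' != 0 -> Eop U k (x p') = e' *: x j -> Kop U k (x p') = q ^- m' *: x p' ->
    x p' * x j = q^-1 *: (x j * x p') ->
    (forall l, (i < l < p)%N -> exists2 c, c != 0 & x l * x i = c *: (x i * x l)) ->
    (forall l, (j < l < p')%N -> exists2 c, c != 0 & x l * x j = c *: (x j * x l)) ->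
  raising (Eop U k) i p j p'.
Proof.
move=> k_bd i_gt0 lt_ip lt_pp j_gt0 lt_jp le_pN E0 e0 Ep Kp xp e'0 Ep' Kp' xp' xx xx' nu.
have Eseq r : all (fun l => [&& 1 <= l <= N, l != p & l != p']%N) r ->
    Eop U k (\prod_(l <- r) x l ^+ nu l) = 0.
  elim: r => [|l r IHr] /=; first by rewrite big_nil (Eop1 U).
  case/andP=> /and3P[l_bd l_p l_p'] /IHr{}IHr; rewrite big_cons (EopM U) // IHr mulr0 addr0.
  suff -> : Eop U k (x l ^+ nu l) = 0 by rewrite mul0r.
  elim: (nu l) => [|c IHc]; first by rewrite (Eop1 U).
  by rewrite exprS (EopM U) // E0 // IHc mulr0 mul0r addr0.
have Kpre h : (1 <= h <= N.+1)%N -> exists2 c, c != 0 &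
    Kop U k (\prod_(1 <= l < h) x l ^+ nu l) = c *: \prod_(1 <= l < h) x l ^+ nu l.
  move=> h_bd; have r_bd : all (fun j => 1 <= j <= mir 1)%N (index_iota 1 h).
    by apply/allP => l; rewrite mem_index_iota mir1; lia.
  have := graded_mulX nu (isT : (1 <= 1 <= n.+1)%N) r_bd (graded1 1); rewrite mulr1.
  by move/(K_graded k_bd) => [-> _]; eexists; last by []; rewrite expfz_neq0.
have [c1 c1_0 K1] : exists2 c, c != 0 & _ := Kpre p ltac:(lia).
have [c2 c2_0 K2] : exists2 c, c != 0 & _ := Kpre p' ltac:(lia).
have [d1 d1_0 M1] := prod_mulx nu i_gt0 lt_ip xx.
have [d2 d2_0 M2] := prod_mulx nu j_gt0 lt_jp xx'.
exists (c1 * (e * \sum_(t < nu p) (q ^- m.+1) ^+ t) * d1).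
exists (c2 * (e' * \sum_(t < nu p') (q ^- m'.+1) ^+ t) * d2).
have geomE c l : (\sum_(t < c) (q ^- l.+1) ^+ t == 0) = (c == 0%N).
  by case: c => [|c]; rewrite ?big_ord0 ?eqxx // (negbTE (geom_neq0 _ _)).
split; last 1 first.
- by rewrite !mulf_eq0 geomE (negbTE c2_0) (negbTE e'0) (negbTE d2_0) orbF.
- have split_at h (mu : nat -> nat) : (1 <= h <= N)%N -> xmon pi mu =
      \prod_(1 <= l < h) x l ^+ mu l * x h ^+ mu h * \prod_(h.+1 <= l < N.+1) x l ^+ mu l.
    move=> h_bd; rewrite /xmon (@big_cat_nat _ _ _ h) /=; try lia.
    by rewrite (@big_ltn _ _ _ h) ?mulrA //; lia.
  have term h f c d z w : (1 <= h <= N)%N -> f != h ->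
      Kop U k (\prod_(1 <= l < h) x l ^+ nu l) = c *: \prod_(1 <= l < h) x l ^+ nu l ->
      Eop U k (x h ^+ nu h) = z *: (x f * x h ^+ (nu h).-1) ->
      (\prod_(1 <= l < h) x l ^+ nu l) * x f =
        d *: \prod_(1 <= l < h) x l ^+ (nu l + (l == f)) ->
      Kop U k (\prod_(1 <= l < h) x l ^+ nu l) * Eop U k (x h ^+ nu h) * w =
      (c * z * d) *: (\prod_(1 <= l < h) x l ^+ shiftn f h nu l * x h ^+ shiftn f h nu h * w).
    move=> h_bd ne_fh -> -> e_f.
    rewrite -!scalerAl -!scalerAr -scalerAl !mulrA e_f -!scalerAl !scalerA.
    congr (_ *: (_ * _ * _)); last first.
      by rewrite /shiftn eqxx eq_sym (negbTE ne_fh) addn0 subn1.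
    rewrite !big_nat; apply: eq_bigr => l l_bd; rewrite /shiftn.
    by rewrite (_ : (l == h) = false) ?subn0 //; lia.
  have p_bd : (1 <= p <= N)%N by lia.
  have p'_bd : (1 <= p' <= N)%N by lia.
  have Ey := E_pow (nu p) k_bd Ep Kp xp.
  have Ey' := E_pow (nu p') k_bd Ep' Kp' xp'.
  have tail h f : (f < h)%N -> \prod_(h.+1 <= l < N.+1) x l ^+ shiftn f h nu l =
      \prod_(h.+1 <= l < N.+1) x l ^+ nu l.
    move=> lt_fh; rewrite !big_nat; apply: eq_bigr => l l_bd; rewrite /shiftn.
    have [-> ->] : (l == h) = false /\ (l == f) = false by split; lia.
    by rewrite addn0 subn0.
  rewrite (split_at p (shiftn i p nu) p_bd) (split_at p' (shiftn j p' nu) p'_bd).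
  rewrite !tail // (split_at p' nu p'_bd).
  have i_neq : i != p by lia.
  have j_neq : j != p' by lia.
  rewrite -(term _ _ _ _ _ _ p_bd i_neq K1 Ey M1) -(term _ _ _ _ _ _ p'_bd j_neq K2 Ey' M2).
  rewrite (EopM U) // [Eop U k (\prod_(p'.+1 <= _ < _) _)]Eseq ?mulr0 ?addr0; last first.
    by apply/allP => l; rewrite mem_index_iota; lia.
  rewrite (EopM U) // mulrDl; congr (_ + _).
  rewrite -!mulrA (@big_cat_nat _ _ _ p 1 p') //=; try lia.
  rewrite (@big_ltn _ _ _ p p') // (EopM U) // Eseq; last first.
    by apply/allP => l; rewrite mem_index_iota; lia.
  rewrite mul0r add0r (EopM U) // Eseq; last first.
    by apply/allP => l; rewrite mem_index_iota; lia.
  rewrite mulr0 addr0 -!mulrA; congr (_ * (_ * _)).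
  rewrite (@big_cat_nat _ _ _ p' p.+1 N.+1) //=; try lia.
  by rewrite (@big_ltn _ _ _ p' N.+1) //; lia.
by rewrite !mulf_eq0 geomE (negbTE c1_0) (negbTE e0) (negbTE d1_0) orbF.
Qed.

Lemma E_x k j : (1 <= k <= n)%N -> (1 <= j <= N)%N -> Eop U k (x j) = E_gen s pi k j.
Proof. exact: Eop_gen. Qed.

Lemma F_x k j : (1 <= k <= n)%N -> (1 <= j <= N)%N -> Fop U k (x j) = F_gen s pi k j.
Proof. exact: Fop_gen. Qed.

Lemma E_low k j : (1 <= k < n)%N -> (1 <= j <= N)%N -> Eop U k (x j) =
  if j == k.+1 then x k else if j == mir k then - x (mir k.+1) else 0.
Proof.
by case/andP=> k_gt0 lt_kn j_bd; rewrite E_x ?k_gt0 ?(ltnW lt_kn) // /E_gen lt_kn.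
Qed.

Lemma F_low k j : (1 <= k < n)%N -> (1 <= j <= N)%N -> Fop U k (x j) =
  if j == k then x k.+1 else if j == mir k.+1 then - x (mir k) else 0.
Proof.
by case/andP=> k_gt0 lt_kn j_bd; rewrite F_x ?k_gt0 ?(ltnW lt_kn) // /F_gen lt_kn.
Qed.

Lemma E_odd j : oddN -> (1 <= j <= N)%N -> Eop U n (x j) =
  if j == n.+1 then s *: x n else if j == n.+2 then - x n.+1 else 0.
Proof.
by move=> oN j_bd; rewrite E_x ?n_gt0 ?leqnn // /E_gen ltnn ifT.
Qed.

Lemma F_odd j : oddN -> (1 <= j <= N)%N -> Fop U n (x j) =
  if j == n then s^-1 *: x n.+1 else if j == n.+1 then - x n.+2 else 0.
Proof.
by move=> oN j_bd; rewrite F_x ?n_gt0 ?leqnn // /F_gen ltnn ifT.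
Qed.

Lemma E_even j : ~~ oddN -> (1 <= j <= N)%N -> Eop U n (x j) =
  if j == n.+1 then x n.-1 else if j == n.+2 then - x n else 0.
Proof.
by move=> oN j_bd; rewrite E_x ?n_gt0 ?leqnn // /E_gen ltnn ifN.
Qed.

Lemma F_even j : ~~ oddN -> (1 <= j <= N)%N -> Fop U n (x j) =
  if j == n.-1 then x n.+1 else if j == n then - x n.+2 else 0.
Proof.
by move=> oN j_bd; rewrite F_x ?n_gt0 ?leqnn // /F_gen ltnn ifN.
Qed.

Lemma wtw_low k w : (k < n)%N -> wtw k w = w k - w k.+1.
Proof. by rewrite /wtw => ->. Qed.

Lemma wtw_odd w : oddN -> wtw n w = w n.
Proof. by move=> oN; rewrite /wtw ltnn ifT. Qed.

Lemma wtw_even w : ~~ oddN -> wtw n w = w n.-1 + w n.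
Proof. by move=> oN; rewrite /wtw ltnn ifN. Qed.

Lemma x_comm_inv i j : (1 <= i)%N -> (i < j)%N -> (j <= N)%N -> i <> mir j ->
  x j * x i = q^-1 *: (x i * x j).
Proof.
by move=> i_gt0 lt_ij le_j ne; rewrite (@x_comm i j) // scalerA mulVf // scale1r.
Qed.

Lemma raising_low k : (1 <= k < n)%N -> raising (Eop U k) k k.+1 (mir k.+1) (mir k).
Proof.
move=> k_bd.
have [k1 k2] : (1 <= k <= n)%N /\ (1 <= k.+1 <= N)%N by split; move: k_bd; mlia.
have k3 : (1 <= mir k <= N)%N by move: k_bd; mlia.
apply: (@raising_of k _ _ 1 1 _ _ (-1) 1) => //; try by move: k_bd; mlia.
- move=> l l_bd l1 l2; rewrite E_low // (negbTE l1) (negbTE l2) //.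
- exact: oner_neq0.
- by rewrite E_low // eqxx scale1r.
- rewrite (K_x k1 k2).1 wtw_low; last by lia.
  have -> : wtx k.+1 k - wtx k.+1 k.+1 = -1 by rewrite /wtx; move: k_bd; mlia.
  by rewrite expr1.
- by apply: x_comm_inv; move: k_bd; mlia.
- by rewrite oppr_eq0 oner_neq0.
- rewrite E_low // eqxx scaleN1r ifN //; by move: k_bd; mlia.
- rewrite (K_x k1 k3).1 wtw_low; last by lia.
  have -> : wtx (mir k) k - wtx (mir k) k.+1 = -1 by rewrite /wtx; move: k_bd; mlia.
  by rewrite expr1.
by apply: x_comm_inv; move: k_bd; mlia.
Qed.

Lemma raising_odd : oddN -> raising (Eop U n) n n.+1 n.+1 n.+2.
Proof.
move=> oN; have n1 : (1 <= n <= n)%N by rewrite n_gt0 /=.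
have k2 : (1 <= n.+1 <= N)%N by mlia.
have k3 : (1 <= n.+2 <= N)%N by move: oN n1; mlia.
have en : n.+2 = mir n by move: oN n1; mlia.
apply: (@raising_of n _ _ s 0 _ _ (-1) 1) => //; try by move: n1 oN; mlia.
- by move=> l l_bd l1 l2; rewrite E_odd // (negbTE l1) (negbTE l2).
- exact: s_neq0.
- by rewrite E_odd // eqxx.
- rewrite (K_x n1 k2).1 wtw_odd //.
  have -> : wtx n.+1 n = 0 by rewrite /wtx; move: oN; mlia.
  by rewrite expr0 invr1.
- by apply: x_comm_inv; move: n1 oN; mlia.
- by rewrite oppr_eq0 oner_neq0.
- rewrite E_odd // eqxx scaleN1r ifN //; by lia.
- rewrite (K_x n1 k3).1 wtw_odd //.
  have -> : wtx n.+2 n = -1 by rewrite /wtx; move: oN n1; mlia.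
  by rewrite expr1.
by apply: x_comm_inv; move: n1 oN; mlia.
Qed.

Lemma Q_mid0 : ~~ oddN -> Q n.+1 = 0.
Proof. by move=> oN; have := Qop_mid lx 1; rewrite Qop_lx mulr1 ifN. Qed.

Lemma raising_even : ~~ oddN -> raising (Eop U n) n.-1 n.+1 n n.+2.
Proof.
move=> oN; have n1 : (1 <= n <= n)%N by rewrite n_gt0 /=.
have n2 : (1 < n)%N by move: N_ge3 oN; mlia.
have k2 : (1 <= n.+1 <= N)%N by move: n2; mlia.
have k3 : (1 <= n.+2 <= N)%N by move: n2; mlia.
(* The new x_n must pass x_{n+1}, its mirror image; they commute because Q_{n+1} = 0. *)
have x_swap : x n.+1 * x n = x n * x n.+1.
  have en : mir n = n.+1 by move: oN n1; mlia.
  by have := x_mir n1; rewrite en Q_mid0 // scaler0 addr0.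
apply: (@raising_of n _ _ 1 1 _ _ (-1) 1) => //; try by move: n2 oN; mlia.
- by move=> l l_bd l1 l2; rewrite E_even // (negbTE l1) (negbTE l2).
- exact: oner_neq0.
- by rewrite E_even // eqxx scale1r.
- rewrite (K_x n1 k2).1 wtw_even //.
  have -> : wtx n.+1 n.-1 + wtx n.+1 n = -1 by rewrite /wtx; move: n2 oN; mlia.
  by rewrite expr1.
- by apply: x_comm_inv; move: n2 oN; mlia.
- by rewrite oppr_eq0 oner_neq0.
- rewrite E_even // eqxx scaleN1r ifN //; by lia.
- rewrite (K_x n1 k3).1 wtw_even //.
  have -> : wtx n.+2 n.-1 + wtx n.+2 n = -1 by rewrite /wtx; move: n2 oN; mlia.
  by rewrite expr1.
- by apply: x_comm_inv; move: n2 oN; mlia.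
- move=> l l_bd; have -> : l = n by lia.
  exists q^-1; first by rewrite invr_eq0.
  by apply: x_comm_inv; move: n2 oN; mlia.
move=> l l_bd; have -> : l = n.+1 by lia.
by exists 1; rewrite ?oner_neq0 // scale1r.
Qed.

(** * Invariance of the quadratic elements Q_i *)

Definition mirror_pair i := (qrho i)^-1 *: (x i * x (mir i)) + qrho i *: (x (mir i) * x i).

Lemma Q_pair i : (1 <= i <= n)%N -> Q i = mirror_pair i + Q i.+1.
Proof.
move=> i_bd; have := Qop_split lx 1 i_bd; rewrite !Qop_lx !lxE !mulr1 => ->.
by rewrite addrAC.
Qed.

Lemma Q_kill (D : {linear A -> A}) i m : (1 <= i <= m)%N -> (m <= n.+1)%N ->
  (forall j, (i <= j < m)%N -> D (mirror_pair j) = 0) -> D (Q m) = 0 -> D (Q i) = 0.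
Proof.
move=> i_bd le_mn DP DQ; have [d] := ubnP (m - i); elim: d => // d IHd in i i_bd DP *.
rewrite ltnS => le_d; case: (eqVneq i m) => [->//|ne_im].
rewrite Q_pair; last by lia.
rewrite linearD DP ?IHd ?addr0 //; try by lia.
by move=> j j_bd; apply: DP; lia.
Qed.

Lemma E_mirror k j : (1 <= k <= n)%N ->
  Eop U k (x j) = 0 -> Eop U k (x (mir j)) = 0 -> Eop U k (mirror_pair j) = 0.
Proof.
move=> k_bd Ej Ej'; rewrite linearD (linearZ_LR (Eop U k)) (linearZ_LR (Eop U k)) /=.
by rewrite !(EopM U) // Ej Ej' !mulr0 !mul0r !addr0 !scaler0 addr0.
Qed.

Lemma F_mirror k j : (1 <= k <= n)%N ->
  Fop U k (x j) = 0 -> Fop U k (x (mir j)) = 0 -> Fop U k (mirror_pair j) = 0.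
Proof.
move=> k_bd Fj Fj'; rewrite linearD (linearZ_LR (Fop U k)) (linearZ_LR (Fop U k)) /=.
by rewrite !(FopM U) // Fj Fj' !mulr0 !mul0r !addr0 !scaler0 addr0.
Qed.

(** Meant for a = x_k, b = x_{k+1} and their mirror images. The two pairs yield multiples of a b'
    and b' a only, and these cancel because rho drops by 1 from one pair to the next. *)
Lemma E_two_pairs k (ra rb : C) (a a' b b' : A) : (1 <= k <= n)%N -> rb != 0 -> ra = q * rb ->
    Eop U k a = 0 -> Eop U k b' = 0 -> Eop U k b = a -> Eop U k a' = - b' ->
    Kop U k a = q *: a -> Kop U k b' = q *: b' ->
  Eop U k (ra^-1 *: (a * a') + ra *: (a' * a) + (rb^-1 *: (b * b') + rb *: (b' * b))) = 0.
Proof.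
move=> k_bd rb0 -> Ea Eb' Eb Ea' Ka Kb'.
rewrite !linearD !(linearZ_LR (Eop U k)) /= !(EopM U) // Ea Eb' Eb Ea' Ka Kb'.
rewrite !mulr0 !mul0r !addr0 !add0r mulNr mulrN -!scalerAl !scalerN !scalerA.
have -> : (q * rb)^-1 * q = rb^-1 by field; rewrite q_neq0 rb0.
by rewrite [rb * q]mulrC addrACA !addNr addr0.
Qed.

Lemma F_two_pairs k (ra rb : C) (a a' b b' : A) : (1 <= k <= n)%N -> rb != 0 -> ra = q * rb ->
    Fop U k b = 0 -> Fop U k a' = 0 -> Fop U k a = b -> Fop U k b' = - a' ->
    KVop U k a' = q *: a' -> KVop U k b = q *: b ->
  Fop U k (ra^-1 *: (a * a') + ra *: (a' * a) + (rb^-1 *: (b * b') + rb *: (b' * b))) = 0.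
Proof.
move=> k_bd rb0 -> Fb Fa' Fa Fb' Ka' Kb.
rewrite !linearD !(linearZ_LR (Fop U k)) /= !(FopM U) // Fb Fa' Fa Fb' Ka' Kb.
rewrite !mulr0 !mul0r !addr0 !add0r mulNr mulrN -!scalerAr !scalerN !scalerA.
have -> : (q * rb)^-1 * q = rb^-1 by field; rewrite q_neq0 rb0.
by rewrite [rb * q]mulrC addrACA !subrr addr0.
Qed.

(** For even N, E_n links the pairs n-1 and n, so both must occur in Q_i; hence the condition i < n.
    For N = 4 it admits Q_1 but not Q_2. *)
Lemma E_Q i k : (1 <= i <= k)%N -> (k <= n)%N -> (~~ oddN && (k == n) -> i < n)%N ->
  Eop U k (Q i) = 0.
Proof.
move=> i_bd; rewrite leq_eqVlt => /orP[/eqP ek|lt_kn] i_lt.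
  rewrite {k}ek eqxx andbT in i_bd i_lt *; have n1 : (1 <= n <= n)%N by lia.
  case oN: {-}oddN; last first.
    have {}oN := negbT oN; have {}i_lt := i_lt oN.
    have ev j := @E_even j oN.
    have en : mir n = n.+1 by move: n1 oN; mlia.
    have en' : mir n.-1 = n.+2 by move: n1 i_lt i_bd oN; mlia.
    have rn : qrho n = 1 by rewrite qrho_n ifN.
    have rn' : qrho n.-1 = q * 1 by rewrite qrhoS ?prednK ?rn //; lia.
    have bdn : (1 <= n.-1 <= N)%N /\ (1 <= n <= N)%N by split; move: i_bd i_lt; mlia.
    have bdn' : (1 <= n.+1 <= N)%N /\ (1 <= n.+2 <= N)%N by split; move: i_bd i_lt oN; mlia.
    case: bdn bdn' => [b1 b2] [b3 b4].
    apply: (@Q_kill (Eop U n) i n.-1); [lia | lia | |].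
      move=> j j_bd; apply: E_mirror => //; rewrite ev ?ifN //; by move: j_bd; mlia.
    rewrite Q_pair; last by lia.
    have en1 : n.-1.+1 = n by lia.
    rewrite en1 (Q_pair n1) (Q_mid0 oN) addr0.
    rewrite /mirror_pair en en' rn' rn.
    (* Since [qrho n] is 1, the last pair is symmetric, and its members exchange roles: E_n sends
       x_{n+1}, not x_n, to x_{n-1}. *)
    have -> : 1^-1 *: (x n * x n.+1) + 1 *: (x n.+1 * x n) =
        1^-1 *: (x n.+1 * x n) + 1 *: (x n * x n.+1) by rewrite invr1 addrC.
    apply: E_two_pairs => //; rewrite ?oner_neq0 ?ev ?eqxx ?ifN //; try by lia.
      rewrite (K_x n1 b1).1 wtw_even //.
      have -> : wtx n.-1 n.-1 + wtx n.-1 n = 1 by rewrite /wtx; move: oN i_bd i_lt; mlia.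
      by rewrite expr1z.
    rewrite (K_x n1 b2).1 wtw_even //.
    have -> : wtx n n.-1 + wtx n n = 1 by rewrite /wtx; move: oN i_bd i_lt; mlia.
    by rewrite expr1z.
  have od j := @E_odd j oN.
  have en : mir n = n.+2 by move: n1 oN; mlia.
  have b1 : (1 <= n <= N)%N by mlia.
  have b2 : (1 <= n.+1 <= N)%N by move: oN; mlia.
  have b3 : (1 <= n.+2 <= N)%N by move: oN n1; mlia.
  have Q1 : Q n.+1 = x n.+1 * x n.+1.
    by have := Qop_mid lx 1; rewrite Qop_lx mulr1 ifT // !lxE mulr1.
  apply: (@Q_kill (Eop U n) i n); [lia | lia | |].
    move=> j j_bd; apply: E_mirror => //; rewrite od ?ifN //; by move: j_bd oN; mlia.
  rewrite Q_pair // /mirror_pair en Q1 qrho_n ifT //.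
  rewrite !linearD !(linearZ_LR (Eop U n)) /= !(EopM U) //.
  have -> : Eop U n (x n) = 0 by rewrite od ?ifN //; lia.
  have -> : Eop U n (x n.+1) = s *: x n by rewrite od // eqxx.
  have -> : Eop U n (x n.+2) = - x n.+1 by rewrite od // eqxx ifN //; lia.
  have -> : Kop U n (x n) = q *: x n.
    rewrite (K_x n1 b1).1 wtw_odd // (_ : wtx n n = 1) ?expr1z //.
    by rewrite /wtx; move: oN n1; mlia.
  have -> : Kop U n (x n.+1) = x n.+1.
    rewrite (K_x n1 b2).1 wtw_odd // (_ : wtx n.+1 n = 0) ?expr0z ?scale1r //.
    by rewrite /wtx; move: oN n1; mlia.
  rewrite mulr0 mul0r addr0 add0r mulNr mulrN -!scalerAl -!scalerAr !scalerN !scalerA.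
  by rewrite -s_sqrt expr2 mulKf ?s_neq0 // addrACA !addNr addr0.
have {i_lt} k_bd : (1 <= k < n)%N by lia.
have k1 : (1 <= k <= n)%N by lia.
have [b1 b2] : (1 <= k <= N)%N /\ (1 <= k.+1 <= N)%N by split; move: k_bd; mlia.
have [b3 b4] : (1 <= mir k <= N)%N /\ (1 <= mir k.+1 <= N)%N by split; move: k_bd; mlia.
apply: (@Q_kill (Eop U k) i k); [lia | lia | |].
  move=> j j_bd; apply: E_mirror => //; rewrite E_low ?ifN //; by move: j_bd k_bd; mlia.
rewrite Q_pair // Q_pair; last by lia.
rewrite addrA linearD.
have -> : Eop U k (Q k.+2) = 0.
  apply: (@Q_kill (Eop U k) k.+2 n.+1); [lia | lia | |].
    move=> j j_bd; apply: E_mirror => //; rewrite E_low ?ifN //; by move: j_bd k_bd; mlia.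
  have -> : Q n.+1 = if oddN then x n.+1 * x n.+1 else 0.
    have := Qop_mid lx 1; rewrite Qop_lx mulr1 => ->.
    by apply: eq_if0 => _; rewrite !lxE mulr1.
  case oN: {-}oddN; last by rewrite ifF // linear0.
  rewrite ifT // (EopM U) // E_low ?ifN ?mulr0 ?mul0r ?addr0 //; by move: k_bd oN; mlia.
rewrite addr0 /mirror_pair; apply: E_two_pairs => //.
- exact: qrho_neq0.
- by rewrite qrhoS //; lia.
- by rewrite E_low ?ifN //; move: k_bd; mlia.
- by rewrite E_low ?ifN //; move: k_bd; mlia.
- by rewrite E_low ?eqxx.
- by rewrite E_low // ifN ?eqxx //; move: k_bd; mlia.
- rewrite (K_x k1 b1).1 wtw_low; last by lia.
  have -> : wtx k k - wtx k k.+1 = 1 by rewrite /wtx; move: k_bd; mlia.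
  by rewrite expr1z.
rewrite (K_x k1 b4).1 wtw_low; last by lia.
have -> : wtx (mir k.+1) k - wtx (mir k.+1) k.+1 = 1 by rewrite /wtx; move: k_bd; mlia.
by rewrite expr1z.
Qed.

Lemma F_Q i k : (1 <= i <= k)%N -> (k <= n)%N -> (~~ oddN && (k == n) -> i < n)%N ->
  Fop U k (Q i) = 0.
Proof.
move=> i_bd; rewrite leq_eqVlt => /orP[/eqP ek|lt_kn] i_lt.
  rewrite {k}ek eqxx andbT in i_bd i_lt *; have n1 : (1 <= n <= n)%N by lia.
  case oN: {-}oddN; last first.
    have {}oN := negbT oN; have {}i_lt := i_lt oN.
    have ev j := @F_even j oN.
    have en : mir n = n.+1 by move: n1 oN; mlia.
    have en' : mir n.-1 = n.+2 by move: n1 i_lt i_bd oN; mlia.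
    have rn : qrho n = 1 by rewrite qrho_n ifN.
    have rn' : qrho n.-1 = q * 1 by rewrite qrhoS ?prednK ?rn //; lia.
    have bdn : (1 <= n.-1 <= N)%N /\ (1 <= n <= N)%N by split; move: i_bd i_lt; mlia.
    have bdn' : (1 <= n.+1 <= N)%N /\ (1 <= n.+2 <= N)%N by split; move: i_bd i_lt oN; mlia.
    case: bdn bdn' => [b1 b2] [b3 b4].
    apply: (@Q_kill (Fop U n) i n.-1); [lia | lia | |].
      move=> j j_bd; apply: F_mirror => //; rewrite ev ?ifN //; by move: j_bd; mlia.
    rewrite Q_pair; last by lia.
    have en1 : n.-1.+1 = n by lia.
    rewrite en1 (Q_pair n1) (Q_mid0 oN) addr0.
    rewrite /mirror_pair en en' rn' rn.
    have -> : 1^-1 *: (x n * x n.+1) + 1 *: (x n.+1 * x n) =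
        1^-1 *: (x n.+1 * x n) + 1 *: (x n * x n.+1) by rewrite invr1 addrC.
    apply: F_two_pairs => //; rewrite ?oner_neq0 ?ev ?eqxx ?ifN //; try by lia.
      rewrite (K_x n1 b4).2 wtw_even //.
      have -> : wtx n.+2 n.-1 + wtx n.+2 n = -1 by rewrite /wtx; move: oN i_bd i_lt; mlia.
      by rewrite opprK expr1z.
    rewrite (K_x n1 b3).2 wtw_even //.
    have -> : wtx n.+1 n.-1 + wtx n.+1 n = -1 by rewrite /wtx; move: oN i_bd i_lt; mlia.
    by rewrite opprK expr1z.
  have od j := @F_odd j oN.
  have en : mir n = n.+2 by move: n1 oN; mlia.
  have b1 : (1 <= n <= N)%N by mlia.
  have b2 : (1 <= n.+1 <= N)%N by move: oN; mlia.
  have b3 : (1 <= n.+2 <= N)%N by move: oN n1; mlia.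
  have Q1 : Q n.+1 = x n.+1 * x n.+1.
    by have := Qop_mid lx 1; rewrite Qop_lx mulr1 ifT // !lxE mulr1.
  apply: (@Q_kill (Fop U n) i n); [lia | lia | |].
    move=> j j_bd; apply: F_mirror => //; rewrite od ?ifN //; by move: j_bd oN; mlia.
  rewrite Q_pair // /mirror_pair en Q1 qrho_n ifT //.
  rewrite !linearD !(linearZ_LR (Fop U n)) /= !(FopM U) //.
  have -> : Fop U n (x n) = s^-1 *: x n.+1 by rewrite od // eqxx.
  have -> : Fop U n (x n.+1) = - x n.+2 by rewrite od // eqxx ifN //; lia.
  have -> : Fop U n (x n.+2) = 0 by rewrite od ?ifN //; lia.
  have -> : KVop U n (x n.+2) = q *: x n.+2.
    rewrite (K_x n1 b3).2 wtw_odd // (_ : wtx n.+2 n = -1) ?opprK ?expr1z //.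
    by rewrite /wtx; move: oN n1; mlia.
  have -> : KVop U n (x n.+1) = x n.+1.
    rewrite (K_x n1 b2).2 wtw_odd // (_ : wtx n.+1 n = 0) ?oppr0 ?expr0z ?scale1r //.
    by rewrite /wtx; move: oN n1; mlia.
  rewrite mulr0 mul0r addr0 add0r mulNr mulrN -!scalerAl -!scalerAr !scalerA.
  have -> : s^-1 / s * q = 1 by rewrite -s_sqrt; field; rewrite s_neq0.
  by rewrite mulfV ?s_neq0 // !scale1r -opprD [x n.+2 * _ + _]addrC subrr.
have {i_lt} k_bd : (1 <= k < n)%N by lia.
have k1 : (1 <= k <= n)%N by lia.
have [b1 b2] : (1 <= k <= N)%N /\ (1 <= k.+1 <= N)%N by split; move: k_bd; mlia.
have [b3 b4] : (1 <= mir k <= N)%N /\ (1 <= mir k.+1 <= N)%N by split; move: k_bd; mlia.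
apply: (@Q_kill (Fop U k) i k); [lia | lia | |].
  move=> j j_bd; apply: F_mirror => //; rewrite F_low ?ifN //; by move: j_bd k_bd; mlia.
rewrite Q_pair // Q_pair; last by lia.
rewrite addrA linearD.
have -> : Fop U k (Q k.+2) = 0.
  apply: (@Q_kill (Fop U k) k.+2 n.+1); [lia | lia | |].
    move=> j j_bd; apply: F_mirror => //; rewrite F_low ?ifN //; by move: j_bd k_bd; mlia.
  have -> : Q n.+1 = if oddN then x n.+1 * x n.+1 else 0.
    have := Qop_mid lx 1; rewrite Qop_lx mulr1 => ->.
    by apply: eq_if0 => _; rewrite !lxE mulr1.
  case oN: {-}oddN; last by rewrite ifF // linear0.
  rewrite ifT // (FopM U) // F_low ?ifN ?mulr0 ?mul0r ?addr0 //; by move: k_bd oN; mlia.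
rewrite addr0 /mirror_pair; apply: F_two_pairs => //.
- exact: qrho_neq0.
- by rewrite qrhoS //; lia.
- by rewrite F_low ?ifN //; move: k_bd; mlia.
- by rewrite F_low ?ifN //; move: k_bd; mlia.
- by rewrite F_low ?eqxx.
- by rewrite F_low // ifN ?eqxx //; move: k_bd; mlia.
- rewrite (K_x k1 b3).2 wtw_low; last by lia.
  have -> : wtx (mir k) k - wtx (mir k) k.+1 = -1 by rewrite /wtx; move: k_bd; mlia.
  by rewrite opprK expr1z.
rewrite (K_x k1 b2).2 wtw_low; last by lia.
have -> : wtx k.+1 k - wtx k.+1 k.+1 = -1 by rewrite /wtx; move: k_bd; mlia.
by rewrite opprK expr1z.
Qed.

(** * Zonal elements through their coefficients *)

Section Coefficients.

Variable cf : (nat -> nat) -> {scalar A}.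
Hypothesis cfE : forall mu nu, cf mu (xmon pi nu) = (agree 1 mu nu)%:R.

Lemma agreeP mu nu : reflect (forall k, (1 <= k <= N)%N -> mu k = nu k) (agree 1 mu nu).
Proof.
rewrite /agree mir1; apply: (iffP allP) => [H k k_bd|H k].
  by apply/eqP/H; rewrite mem_index_iota.
by rewrite mem_index_iota => k_bd; rewrite H.
Qed.

(** Let mu be nu with a unit moved from p to i. The coefficient of E P at mu receives contributions
    only from nu and from nu2, the exponent that the second move takes to mu. The factor of the
    first is nonzero, so if P has no coefficient at nu2, it has none at nu. *)
Lemma raising_rel (E : {linear A -> A}) (i p j p' : nat) (nu : nat -> nat) P d :
    raising E i p j p' -> i != p -> j != p' -> p != p' ->
    (1 <= i <= N)%N -> (1 <= p <= N)%N -> (1 <= j <= N)%N -> (1 <= p' <= N)%N ->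
    homog pi d P -> E P = 0 -> (0 < nu p)%N ->
    ((0 < shiftn i p nu j)%N -> cf (shiftn p' j (shiftn i p nu)) P = 0) ->
  cf nu P = 0.
Proof.
move=> E_r ne_ip ne_jp ne_pp i_bd p_bd j_bd p'_bd P_d EP nu_p.
set mu := shiftn i p nu; set nu2 := shiftn p' j mu => cf2.
have [u [v0 [Enu u0 v00]]] := E_r nu.
have [u2 [v [Enu2 u20 vv0]]] := E_r nu2.
(* If mu j = 0, the second move cannot end at mu, and the truncated nu2 is not a preimage. *)
pose v' := if (0 < mu j)%N then v else 0.
have mon nu' : cf mu (E (xmon pi nu')) = u * cf nu (xmon pi nu') + v' * cf nu2 (xmon pi nu').
  rewrite !cfE; case: (agreeP nu nu') => [e|ne].
    rewrite -(xmon_ext e) Enu (linearP (cf mu)) (linearZ_LR (cf mu)) /= !cfE.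
    have -> : agree 1 mu mu by apply/agreeP.
    congr (_ + _).
      case: (posnP (nu p')) => [nu0|nu_p']; last first.
        case: agreeP => [/(_ p' p'_bd)|_]; last first.
          case: agreeP => [/(_ p' p'_bd)|_]; last by rewrite !mulr0.
          by rewrite -e // /nu2 /mu /shiftn; lia.
        by rewrite /mu /shiftn; lia.
      have /eqP -> : v0 == 0 by rewrite v00 nu0.
      rewrite mul0r; case: agreeP => [/(_ p' p'_bd)|_]; last by rewrite mulr0.
      by rewrite -e // /nu2 /mu /shiftn; lia.
  rewrite mulr0 add0r; case: (agreeP nu2 nu') => [e|ne2].
    rewrite -(xmon_ext e) Enu2 (linearP (cf mu)) (linearZ_LR (cf mu)) /= !cfE mulr1 /v'.
    have -> : agree 1 mu (shiftn i p nu2) = false.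
      by apply/negP => /agreeP/(_ p' p'_bd); rewrite /nu2 /shiftn; lia.
    rewrite mulr0 add0r; case: ifP => mu_j.
      suff -> : agree 1 mu (shiftn j p' nu2) by rewrite mulr1.
      apply/agreeP => k _; rewrite /nu2 /shiftn.
      by case: (eqVneq k j) => [->|_]; move: mu_j; lia.
    suff -> : agree 1 mu (shiftn j p' nu2) = false by rewrite mulr0.
    by apply/negP => /agreeP/(_ j j_bd); rewrite /nu2 /shiftn; move: mu_j; lia.
  have [u3 [v3 [Enu3 u30 v30]]] := E_r nu'.
  rewrite mulr0 Enu3 (linearP (cf mu)) (linearZ_LR (cf mu)) /= !cfE.
  case: (posnP (nu' p)) => [nu0|nu'_p].
    have /eqP -> : u3 == 0 by rewrite u30 nu0.
    rewrite mul0r add0r; case: (posnP (nu' p')) => [nu0'|nu'_p'].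
      have /eqP -> : v3 == 0 by rewrite v30 nu0'.
      by rewrite mul0r.
    case: agreeP => [e|]; last by rewrite mulr0.
    case: ne2 => k k_bd; move: (e k k_bd); rewrite /nu2 /shiftn.
    by case: (eqVneq k p') => [->|_]; move: nu'_p'; lia.
  case: agreeP => [e|_].
    case: ne => k k_bd; move: (e k k_bd); rewrite /mu /shiftn.
    by case: (eqVneq k p) => [->|_]; move: nu_p nu'_p; lia.
  rewrite mulr0 add0r; case: (posnP (nu' p')) => [nu0'|nu'_p'].
    have /eqP -> : v3 == 0 by rewrite v30 nu0'.
    by rewrite mul0r.
  case: agreeP => [e|]; last by rewrite mulr0.
  case: ne2 => k k_bd; move: (e k k_bd); rewrite /nu2 /shiftn.
  by case: (eqVneq k p') => [->|_]; move: nu'_p'; lia.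
have ext : cf mu (E P) = u * cf nu P + v' * cf nu2 P.
  move: P P_d {EP cf2}; apply: lin_span_ind => [|c a b ea eb|a [nu' [_ ->]]] //.
    by rewrite !(linear0 E) !linear0 !mulr0 addr0.
  by rewrite (linearP E) !(linearP (cf _)) /= ea eb; ring.
have v'0 : v' * cf nu2 P = 0.
  by rewrite /v'; case: ifP => [/cf2->|_]; rewrite ?mulr0 ?mul0r.
move/eqP: ext; rewrite EP linear0 v'0 addr0 eq_sym mulf_eq0 u0.
by case/orP=> [/eqP e|/eqP //]; move: nu_p; rewrite e.
Qed.

Lemma raising_swap (E : A -> A) (i p j p' : nat) : raising E i p j p' -> raising E j p' i p.
Proof.
move=> E_r nu; have [u [v [e u0 v0]]] := E_r nu.
by exists v, u; split=> //; rewrite addrC.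
Qed.

(** Only indices up to n+1 are weighed, so the half of a move that adds a unit above the middle
    cannot increase the measure. *)
Definition meas (mu : nat -> nat) := (\sum_(1 <= k < n.+2) k * mu k)%N.

Lemma meas_shift a b mu : (1 <= a <= n.+1)%N -> (1 <= b <= n.+1)%N -> (0 < mu b)%N ->
  (meas (shiftn a b mu) + b = meas mu + a)%N.
Proof.
move=> a_bd b_bd mu_b.
have pick l : (1 <= l <= n.+1)%N -> (l = \sum_(1 <= k < n.+2) k * (k == l))%N.
  move=> l_bd; rewrite (bigD1_seq l) ?iota_uniq ?mem_index_iota //= eqxx muln1.
  by rewrite big1 ?addn0 // => k /negbTE->; rewrite muln0.
have [ea eb] := (pick a a_bd, pick b b_bd); rewrite [X in (_ + X)%N = _]eb [X in _ = (_ + X)%N]ea.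
rewrite /meas -!big_split; apply: eq_bigr => k _ /=.
rewrite -!mulnDr /shiftn; congr (_ * _)%N.
by case: (eqVneq k b) => [->|_]; move: mu_b; lia.
Qed.

Lemma meas_shift_le a b mu : (n.+1 < a)%N -> (meas (shiftn a b mu) <= meas mu)%N.
Proof.
move=> a_gt; rewrite /meas !big_nat; apply: leq_sum => k k_bd.
have ne : (k == a) = false by lia.
by rewrite leq_mul2l /shiftn ne addn0 leq_subr orbT.
Qed.

(* E_k p = 0 makes the coefficients at mu and at mu with a pair moved from k+1 to k
   proportional; the moves decrease [meas] and end at x_1^a x_2^l x_{2'}^l x_{1'}^b. *)
Lemma zonal_init P d : (1 < n)%N -> homog pi d P ->
    (forall k, (2 <= k < n)%N -> Eop U k P = 0) -> (oddN -> Eop U n P = 0) ->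
    (forall mu, cf mu P != 0 -> forall k, (2 <= k <= n)%N -> mu k = mu (mir k)) ->
    (forall mu, (forall k, (3 <= k <= mir 3)%N -> mu k = 0%N) -> mu 2%N = mu (mir 2) ->
      cf mu P = 0) ->
  forall mu, cf mu P = 0.
Proof.
move=> n_gt1 P_d EP EnP P_wt P_init mu.
have [m] := ubnP (meas mu); elim: m => // m IHm in mu *; rewrite ltnS => le_m.
case: (boolP [exists k : 'I_n, (2 <= k)%N && (0 < mu k.+1)%N]) => [/existsP[k /andP[k2 mu_k]]|no_k].
  have k_bd : (2 <= k < n)%N by rewrite k2 ltn_ord.
  apply: (@raising_rel (Eop U k) k k.+1 (mir k.+1) (mir k) mu P d) => //;
    try by move: k_bd; mlia.
  - by apply: raising_low; lia.
  - exact: EP.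
  move=> _; apply: IHm; apply: (leq_trans _ le_m).
  apply: (@leq_ltn_trans (meas (shiftn k k.+1 mu))).
    by apply: meas_shift_le; move: k_bd; mlia.
  have := @meas_shift k k.+1 mu; move: k_bd mu_k; lia.
case: (boolP (oddN && (0 < mu n.+1)%N)) => [/andP[oN mu_n]|no_n].
  apply: (@raising_rel (Eop U n) n n.+1 n.+1 n.+2 mu P d) => //; try by move: n_gt1 oN; mlia.
  - exact: raising_odd.
  - exact: EnP.
  move=> _; apply: IHm; apply: (leq_trans _ le_m).
  apply: (@leq_ltn_trans (meas (shiftn n n.+1 mu))); first by apply: meas_shift_le; lia.
  have := @meas_shift n n.+1 mu; move: n_gt1 mu_n; lia.
(* No move is left: the exponents at 3, ..., n and at the middle vanish, and weight zero carries
   this over to the mirror positions. *)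
apply/eqP; apply: contraT => cf_neq0; have wt0 := P_wt _ cf_neq0.
move: cf_neq0; rewrite P_init ?eqxx //; last by apply: wt0; lia.
have low k : (3 <= k <= n)%N -> mu k = 0%N.
  case: k => // k k_bd; apply/eqP; rewrite -leqn0 leqNgt; apply: contra no_k => mu_k.
  by apply/existsP; exists (Ordinal (proj2 (andP k_bd))); rewrite /= mu_k andbT; lia.
move=> k k_bd; case: (leqP k n) => [le_kn|lt_nk]; first by apply: low; lia.
case: (eqVneq k (mir k)) => [ek|ne_k].
  have [oN ->] : oddN /\ k = n.+1 by split; move: ek lt_nk k_bd n_gt1; mlia.
  by apply/eqP; rewrite -leqn0 leqNgt; apply: contra no_n; rewrite oN.
rewrite -[k]mirK; last by move: k_bd n_gt1; mlia.
rewrite -wt0 ?low //; by move: ne_k lt_nk k_bd n_gt1; mlia.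
Qed.

(** E_2 relates monomials that differ by exchanging x_1 x_4 with x_2 x_3, which preserves nu_1 -
    nu_4. If nu_1 < nu_4, pairs x_1 x_4 are used up until no x_1 remains; otherwise pairs x_2 x_3
    are used up, and weight zero leaves only x_1^a x_4^a. *)
Lemma zonal_init4 P d : n = 2%N -> ~~ oddN -> homog pi d P -> Eop U n P = 0 ->
    (forall mu, cf mu P != 0 -> (mu 1%N + mu 2%N = mu 3%N + mu 4%N)%N) ->
    (forall mu, mu 1%N = mu 4%N -> mu 2%N = 0%N -> mu 3%N = 0%N -> cf mu P = 0) ->
  forall mu, cf mu P = 0.
Proof.
move=> n2 oN P_d EP P_wt P_init mu.
have E_r := raising_even oN.
have [e1 e3 e4] : [/\ n.-1 = 1, n.+1 = 3 & n.+2 = 4]%N by rewrite n2.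
have low m nu : (nu 1%N < m)%N -> (nu 1%N < nu 4%N)%N -> cf nu P = 0.
  elim: m => // m IHm in nu *; rewrite ltnS => le_m lt14.
  apply: (@raising_rel (Eop U n) n n.+2 n.-1 n.+1 nu P d) => //; try by move: n2 oN; mlia.
  - exact: raising_swap.
  - by rewrite e4; lia.
  rewrite /shiftn e1 e3 n2 /= => nu1; apply: IHm; rewrite /shiftn /=; lia.
have high m nu : (nu 2%N < m)%N -> (nu 4%N <= nu 1%N)%N -> cf nu P = 0.
  elim: m => // m IHm in nu *; rewrite ltnS => le_m le41.
  case: (posnP (nu 3%N)) => [nu3|nu3]; last first.
    apply: (@raising_rel (Eop U n) n.-1 n.+1 n n.+2 nu P d) => //; try by move: n2 oN; mlia.
            - by rewrite e3.
    rewrite /shiftn e1 e3 n2 /= => nu2; apply: IHm; rewrite /shiftn /=; lia.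
  apply/eqP; apply: contraT => cf_neq0; have e := P_wt _ cf_neq0.
  move: cf_neq0; rewrite P_init ?eqxx //; lia.
case: (ltnP (mu 1%N) (mu 4%N)) => [lt14|le41]; first exact: (low (mu 1%N).+1).
exact: (high (mu 2%N).+1).
Qed.

Lemma cf_graded d w P mu : graded 1 d w P -> cf mu P != 0 ->
  degI 1 mu = d /\ forall k, (1 <= k <= n)%N -> wt_hat n oddN k mu = w k.
Proof.
move=> gP cf_neq0; apply: contrapT => n_cond.
move/eqP: cf_neq0; apply; move: P gP; apply: lin_span_ind => [|c u v eu ev|v [nu [nu_d nu_w ->]]].
- exact: linear0.
- by rewrite (linearP (cf mu)) eu ev mulr0 addr0.
rewrite xmonI1 cfE; case: agreeP => // e; case: n_cond; split.
  by rewrite -nu_d; apply: degI_ext => j; rewrite mir1; apply: e.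
move=> k k_bd; rewrite -nu_w // /wt_hat !e //; by move: k_bd; mlia.
Qed.

Lemma homog_graded0 d P : homog pi d P -> forall mu, cf mu P != 0 -> degI 1 mu = d.
Proof.
move=> gP mu cf_neq0; apply: contrapT => n_cond.
move/eqP: cf_neq0; apply; move: P gP; apply: lin_span_ind => [|c u v eu ev|v [nu [nu_d ->]]].
- exact: linear0.
- by rewrite (linearP (cf mu)) eu ev mulr0 addr0.
rewrite cfE; case: agreeP => // e; case: n_cond.
by rewrite -nu_d -degI1; apply: degI_ext => j; rewrite mir1; apply: e.
Qed.

(** A given expression of P may repeat a monomial. The terms agreeing with the first one add up to
    [cf nu P] times that monomial, hence to zero; removing them shortens the expression. *)
Lemma homog_cf0 d P : homog pi d P -> (forall mu, cf mu P = 0) -> P = 0.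
Proof.
move=> [k [c [w [w_mon eP]]]] cfP.
have [r {eP}eP] : exists r : seq (C * (nat -> nat)), P = \sum_(e <- r) e.1 *: xmon pi e.2.
  elim: k c w w_mon P {cfP} eP => [|k IHk] c w w_mon P eP.
    by exists [::]; rewrite eP big_ord0 big_nil.
  have [nu [_ e0]] := w_mon ord0.
  have [r er] := IHk (fun i => c (lift ord0 i)) (fun i => w (lift ord0 i))
    (fun i => w_mon _) _ erefl.
  by exists ((c ord0, nu) :: r); rewrite eP big_ord_recl big_cons er e0.
have [m] := ubnP (size r); elim: m => // m IHm in r eP *; rewrite ltnS => le_m.
case: r eP le_m => [|[c0 nu] r] eP le_m; first by rewrite eP big_nil.
set r1 := _ :: r in eP le_m.
have split1 : P = \sum_(e <- r1 | agree 1 nu e.2) e.1 *: xmon pi e.2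
    + \sum_(e <- r1 | ~~ agree 1 nu e.2) e.1 *: xmon pi e.2.
  by rewrite eP (bigID (fun e => agree 1 nu e.2)).
have e1 : \sum_(e <- r1 | agree 1 nu e.2) e.1 *: xmon pi e.2 = cf nu P *: xmon pi nu.
  rewrite eP linear_sum scaler_suml [RHS](bigID (fun e => agree 1 nu e.2)) /=.
  rewrite [X in _ = _ + X]big1 ?addr0 => [|e /negbTE ne].
    apply: eq_bigr => e nu_e; rewrite (linearZ_LR (cf nu)) /= cfE nu_e mulr1.
    by congr (_ *: _); apply: xmon_ext => j j_bd; move/agreeP: nu_e => ->.
  by rewrite (linearZ_LR (cf nu)) /= cfE ne mulr0 scale0r.
apply: (IHm [seq e <- r1 | ~~ agree 1 nu e.2]).
  by rewrite big_filter {1}split1 e1 cfP scale0r add0r.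
apply: leq_trans le_m; rewrite size_filter /r1 /= ltnS.
have -> : agree 1 nu nu by apply/agreeP.
exact: count_size.
Qed.

(** All terms but the leading one keep a factor Q_{i+1}, so a functional that kills those terms sees
    Q_i^l as [alp i ^+ l] x_i^l x_{i'}^l. *)
Lemma Q_pow_lead i l : (1 <= i <= n)%N ->
  lin_span (fun v => exists j k, (j + k.+1 = l)%N /\ v = ezon i j k.+1 j)
    (Q i ^+ l - alp i ^+ l *: (x i ^+ l * x (mir i) ^+ l)).
Proof.
move=> i_bd; elim: l => [|l IHl].
  by rewrite !expr0 mulr1 scale1r subrr; exact: lin_span0.
have -> : Q i ^+ l.+1 - alp i ^+ l.+1 *: (x i ^+ l.+1 * x (mir i) ^+ l.+1) =
  Q i * (Q i ^+ l - alp i ^+ l *: (x i ^+ l * x (mir i) ^+ l))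
  + (alp i ^+ l.+1 * bet i) *: ezon i l 1 l.
  have := Q_ezon l 0 l i_bd; rewrite {1}/ezon expr0 mulr1 expr1n invr1 scale1r => e.
  rewrite mulrBr -scalerAr e -exprS [ezon i l.+1 0 l.+1]/ezon expr0 mulr1.
  by rewrite scalerA -exprSr scalerDr scalerA opprD addrA subrK.
apply: lin_spanD; last first.
  by apply/lin_spanZ/lin_span_gen; exists l, 0%N; rewrite addn1.
move: (_ - _) IHl; apply: lin_span_ind => [|c u v gu gv|v [j [k [e ->]]]].
- by rewrite mulr0; exact: lin_span0.
- by rewrite mulrDr -scalerAr; exact: lin_spanP.
rewrite Q_ezon // scalerDr !scalerA; apply: lin_spanP.
  by apply: lin_span_gen; exists j.+1, k; rewrite addSn e.
by apply/lin_spanZ/lin_span_gen; exists j, k.+1; rewrite addnS e.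
Qed.

Lemma lead_functional (f : {linear A -> A}) (g : {scalar A}) i l : (1 <= i <= n)%N ->
    (forall j k, (j + k.+1 = l)%N -> g (f (ezon i j k.+1 j)) = 0) ->
  g (f (Q i ^+ l)) = alp i ^+ l * g (f (x i ^+ l * x (mir i) ^+ l)).
Proof.
move=> i_bd gf0; apply/eqP; rewrite -subr_eq0; apply/eqP.
have := Q_pow_lead l i_bd.
have -> : g (f (Q i ^+ l)) - alp i ^+ l * g (f (x i ^+ l * x (mir i) ^+ l)) =
    g (f (Q i ^+ l - alp i ^+ l *: (x i ^+ l * x (mir i) ^+ l))).
  by rewrite !(linearB f) !(linearB g) (linearZ_LR f) (linearZ_LR g).
move: (_ - _); apply: lin_span_ind => [|c u v eu ev|v [j [k [e ->]]]].
- by rewrite (linear0 f) (linear0 g).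
- by rewrite (linearP f) (linearP g) eu ev mulr0 addr0.
exact: gf0.
Qed.

Lemma sandwich_lin a b : linear (fun y : A => x 1 ^+ a * y * x (mir 1) ^+ b).
Proof. by move=> c u v; rewrite mulrDr mulrDl -scalerAr -scalerAl. Qed.

Lemma one_bd : (1 <= 1 <= n)%N. Proof. exact: n_gt0. Qed.

Lemma cf_sandwich a b mu nu :
  cf mu (x 1 ^+ a * xmonI 2 nu * x (mir 1) ^+ b) = (agree 1 mu (upd 1 a b nu))%:R.
Proof. by rewrite -xmonI_upd ?one_bd // xmonI1 cfE. Qed.

Lemma cf_ezon_first a l b mu : cf mu (ezon 1 a l b) != 0 -> mu 1%N = a.
Proof.
have : graded 2 l.*2 (fun=> 0) (Q 2 ^+ l) by apply: graded_QX; exact: n_gt0.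
rewrite /ezon; move: (Q 2 ^+ l) => y gy cf_neq0; apply: contrapT => ne.
move/eqP: cf_neq0; apply; move: y gy; apply: lin_span_ind => [|c u v eu ev|v [nu [_ _ ->]]].
- by rewrite mulr0 mul0r linear0.
- by rewrite (sandwich_lin a b) (linearP (cf mu)) eu ev mulr0 addr0.
rewrite cf_sandwich; case: agreeP => // /(_ 1%N); rewrite upd_l => e.
by case: ne; apply: e; mlia.
Qed.

(** The terms of Q_2^l with a factor Q_3 consist of monomials of positive degree in x_3, ...,
    x_{3'}, where mu vanishes, so only the leading term counts. *)
Lemma cf_ezon a l b mu : (1 < n)%N ->
    (forall k, (3 <= k <= mir 3)%N -> mu k = 0%N) -> mu 2%N = mu (mir 2) ->
  cf mu (ezon 1 a l b) =
    if [&& mu 1%N == a, mu N == b & mu 2%N == l] then alp 2 ^+ l else 0.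
Proof.
move=> n_gt1 mu0 mu2; have two_bd : (1 <= 2 <= n)%N by lia.
have := @lead_functional (linear_of (sandwich_lin a b)) (cf mu) 2 l two_bd.
rewrite -[linear_of _ (Q 2 ^+ l)]/(ezon 1 a l b) => ->; last first.
  move=> j k _; rewrite -[linear_of _ _]/(x 1 ^+ a * ezon 2 j k.+1 j * x (mir 1) ^+ b).
  have : graded 3 k.+1.*2 (fun=> 0) (Q 3 ^+ k.+1) by apply: graded_QX; lia.
  rewrite {1}/ezon; move: (Q 3 ^+ k.+1); apply: lin_span_ind => [|c u v eu ev|v [nu [nu_d _ ->]]].
  - by rewrite mulr0 !mul0r mulr0 mul0r linear0.
  - rewrite mulrDr mulrDl -scalerAr -scalerAl (sandwich_lin a b).
    by rewrite (linearP (cf mu)) eu ev mulr0 addr0.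
  rewrite -xmonI_upd // cf_sandwich; case: agreeP => // e.
  move: nu_d; rewrite (_ : degI 3 nu = 0%N) // /degI big_nat big1 // => i i_bd.
  have i_in : (1 <= i <= N)%N by move: i_bd n_gt1; mlia.
  have := e i i_in; rewrite mu0 ?upd_in //; by move: i_bd n_gt1; mlia.
rewrite -[linear_of _ _]/(x 1 ^+ a * (x 2 ^+ l * x (mir 2) ^+ l) * x (mir 1) ^+ b).
have -> : x 2 ^+ l * x (mir 2) ^+ l = xmonI 2 (upd 2 l l (fun=> 0%N)).
  by rewrite xmonI_upd // [xmonI 3 _]big1 ?mulr1.
rewrite cf_sandwich.
suff -> : agree 1 mu (upd 1 a b (upd 2 l l (fun=> 0%N))) =
    [&& mu 1%N == a, mu N == b & mu 2%N == l].
  by case: ifP => _; rewrite ?mulr1 ?mulr0.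
apply/agreeP/and3P => [e|[/eqP e1 /eqP eN /eqP e2] k k_bd].
  split; apply/eqP; rewrite e; try by move: n_gt1; mlia.
  - by rewrite upd_l.
  - by rewrite -mir1 upd_r ?one_bd.
  by rewrite upd_in ?upd_l //; move: n_gt1; mlia.
rewrite /upd mir1; case: eqVneq => [->//|k1]; case: eqVneq => [->//|kN].
case: eqVneq => [->//|k2]; case: eqVneq => [->|k2']; first by rewrite -mu2.
by apply: mu0; move: k1 kN k2 k2' k_bd; mlia.
Qed.

Lemma cf_ezon_neq0 a l b : exists2 mu, mu 1%N = a & cf mu (ezon 1 a l b) != 0.
Proof.
case: (ltnP 1 n) => [n_gt1|n_le1].
  have two_bd : (1 <= 2 <= n)%N by lia.
  exists (upd 1 a b (upd 2 l l (fun=> 0%N))); first by rewrite upd_l.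
  rewrite cf_ezon //.
  - rewrite -mir1 upd_l upd_r ?one_bd // !eqxx /= upd_in; last by move: n_gt1; mlia.
    by rewrite upd_l eqxx expf_neq0 // alp_neq0 //; lia.
  - by move=> k k_bd; rewrite !upd_in //; move: n_gt1 k_bd; mlia.
  have [in2 in2'] : (1 < 2 < mir 1)%N /\ (1 < mir 2 < mir 1)%N by split; move: n_gt1; mlia.
  by rewrite (upd_in _ _ _ in2) (upd_in _ _ _ in2') upd_l upd_r.
(* For N = 3 there is no second pair: Q_2 is x_2^2 and e(a,l,b) is itself a monomial. *)
have [n1 oN] : n = 1%N /\ oddN.
  by move: N_ge3 n_le1; rewrite /dimN; case: {-}(oddN) (leq_b1 oddN) => //; lia.
pose nu k := if k == n.+1 then l.*2 else 0%N.
have Q2 : Q 2 ^+ l = xmon pi nu.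
  rewrite xmon_mid // -muln2 mulnC exprM; congr (_ ^+ _).
  have := Qop_mid lx 1; rewrite Qop_lx mulr1 ifT // !lxE mulr1 expr2.
  by rewrite (_ : n.+1 = 2%N) // n1.
have nu_s : supp 2 nu.
  by move=> k k_bd k_out; rewrite /nu ifN //; move: k_out n1; mlia.
exists (upd 1 a b nu); first by rewrite upd_l.
rewrite /ezon Q2 -xmon_upd ?one_bd // cfE.
have -> : agree 1 (upd 1 a b nu) (upd 1 a b nu) by apply/agreeP.
exact: oner_neq0.
Qed.

Local Notation QelT := (Qhomog s pi).

(** * Harmonic projections *)

Lemma Qhomog_lin m c u v : QelT m u -> QelT m v -> QelT m (c *: u + v).
Proof.
case: m => [|[|m]] /=; [by move=> -> ->; rewrite scaler0 addr0.. |].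
move=> [a [a_m ->]] [b [b_m ->]]; exists (c *: a + b); split; first exact: lin_spanP.
by rewrite mulrDr scalerAr.
Qed.

Lemma Qhomog0 m : QelT m 0.
Proof.
case: m => [|[|m]] //=; exists 0; rewrite mulr0; split=> //; exact: lin_span0.
Qed.

Lemma Qhomog_ezon a l b m : (a + l.*2 + b + 2 = m)%N -> QelT m (Q 1 * ezon 1 a l b).
Proof.
move=> <-; rewrite addn2 /=; exists (ezon 1 a l b); split.
  exact: graded_homog (graded_ezon a l b one_bd).
by rewrite /Qelt /Qlevel mir1.
Qed.

(** By [Q_ezon], modulo multiples of Q one factor Q_2 can be traded for a factor x_1 and a factor
    x_{1'}; [bet 1] and [alp 1] are invertible. *)
Lemma ezon_modQ a l b m : (a + l.*2 + b = m)%N ->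
  exists c, QelT m (ezon 1 a l b - c *: ezon 1 (a + l) 0 (b + l)).
Proof.
elim: l a b => [|l IHl] a b e.
  by exists 1; rewrite !addn0 scale1r subrr; exact: Qhomog0.
have [|c Hc] := IHl a.+1 b.+1; first by move: e; rewrite doubleS; lia.
have [a0 b0] := (alp_neq0 n_gt0, bet_neq0 n_gt0).
have H := @Qhomog_ezon a l b m ltac:(move: e; rewrite doubleS; lia).
exists (- (bet 1)^-1 * (q ^+ l) ^- 2 * c).
have e1 : ezon 1 a l.+1 b = ((bet 1)^-1 / alp 1) *: (Q 1 * ezon 1 a l b)
    - ((bet 1)^-1 * (q ^+ l) ^- 2) *: ezon 1 a.+1 l b.+1.
  rewrite (Q_ezon _ _ _ one_bd) scalerA mulfVK // scalerDr !scalerA mulVf // scale1r.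
  by rewrite addrAC subrr add0r.
rewrite -addSnnS -[(b + l.+1)%N]addSnnS.
have -> : ezon 1 a l.+1 b - (- (bet 1)^-1 * (q ^+ l) ^- 2 * c) *: ezon 1 (a.+1 + l) 0 (b.+1 + l) =
  ((bet 1)^-1 / alp 1) *: (Q 1 * ezon 1 a l b) +
  ((- ((bet 1)^-1 * (q ^+ l) ^- 2)) *: (ezon 1 a.+1 l b.+1 - c *: ezon 1 (a.+1 + l) 0 (b.+1 + l)) + 0).
  rewrite addr0 e1 scalerBr scalerA -addrA scaleNr; congr (_ + (_ - _ *: _)).
  by rewrite mulNr.
by apply: Qhomog_lin => //; apply: Qhomog_lin => //; exact: Qhomog0.
Qed.

Lemma w0_neq0 : w0 != 0.
Proof.
rewrite /w0; have -> : N%:Z - 2 = (N - 2)%N by move: N_ge3; lia.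
exact: (expqD_neq0 0).
Qed.

Lemma lower_coef_neq0 i a b d : (0 < a)%N -> (0 < b)%N -> lower_coef i a b d != 0.
Proof.
have sub_neq0 c : (0 < c)%N -> q ^+ c - (q ^+ c)^-1 != 0.
  move=> c_gt0; rewrite subr_eq0; apply: contraTneq isT => e.
  have := q_nroot (k := c.*2); rewrite double_gt0 => /(_ c_gt0).
  by rewrite -addnn exprD {2}e mulfV ?expf_neq0 ?eqxx.
have qq : (q - q^-1)^-1 != 0 by rewrite invr_neq0 //; exact: (sub_neq0 1%N).
move=> a_gt0 b_gt0; rewrite lower_coefE.
by rewrite !mulf_neq0 ?w0_neq0 ?expf_neq0 ?invr_neq0 ?qrho_neq0 ?sub_neq0 //;
  move: qq; rewrite invr_eq0.
Qed.

Lemma lower_coef_0r i a d : lower_coef i a 0 d = 0.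
Proof. by rewrite lower_coefE expr0 invr1 subrr !mul0r mulr0 mul0r mulr0. Qed.

(** Harmonicity amounts to z_k u_k + z_{k+1} v_{k+1} = 0; the boundary terms vanish since x_1 or
    x_{1'} is used up at k = K and since theta is 0 at k = 0. *)
Lemma harmonic_comb m1 m1' : exists z : nat -> C,
  z (minn m1 m1') = 1 /\
  Delta (\sum_(k < (minn m1 m1').+1) z k *: ezon 1 (m1 - k) k (m1' - k)) = 0.
Proof.
set K := minn m1 m1'.
pose u k := lower_coef 1 (m1 - k) (m1' - k) k.*2.
pose v k := (q ^+ (m1 - k + (m1' - k))) ^+ 2 * theta 2 k.
(* Solved downwards from z_K = 1: this direction divides by the u_k only, which are nonzero for k <
   K, and it keeps the last coefficient visible for the proof that the combination is nonzero. *)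
pose z k := \prod_(k <= t < K) (- v t.+1 / u t).
exists z; split; first by rewrite /z big_geq.
have DE k : Delta (ezon 1 (m1 - k) k (m1' - k)) =
    u k *: ezon 1 (m1 - k.+1) k (m1' - k.+1) + v k *: ezon 1 (m1 - k) k.-1 (m1' - k).
  rewrite !subnS; apply: Delta_ezon; first exact: one_bd.
  by move=> l; apply: Delta_QX; exact: n_gt0.
rewrite linear_sum.
under eq_bigr => k _ do rewrite (linearZ_LR Delta) /= DE scalerDr !scalerA.
rewrite big_split /= big_ord_recr /= [X in _ + X]big_ord_recl /=.
have -> : u K = 0.
  rewrite /u; case: (leqP m1 m1') => le_m.
    by rewrite (_ : (m1 - K = 0)%N) ?lower_coef0 // /K; lia.
  by rewrite (_ : (m1' - K = 0)%N) ?lower_coef_0r // /K; lia.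
have -> : v 0 = 0 by rewrite /v /= mulr0.
rewrite !mulr0 !scale0r addr0 add0r -big_split big1 // => k _ /=.
rewrite /bump /= add1n -scalerDl [z k]big_ltn // -/(z k.+1).
suff -> : - v k.+1 / u k * z k.+1 * u k + z k.+1 * v k.+1 = 0 by rewrite scale0r.
have uk : u k != 0.
  by apply: lower_coef_neq0; have := ltn_ord k; rewrite /K leq_min; lia.
by field; rewrite uk.
Qed.

Section Projector.

Variable P : nat -> A -> A.
Hypothesis P_proj : forall m, is_harmonic_projector s pi Delta m (P m).

Lemma harmonic_Q0 m p : harmonic pi Delta m p -> QelT m p -> p = 0.
Proof. by have [_ Ph PQ] := P_proj m => /Ph e /PQ; rewrite e. Qed.

Lemma harmonic_lin m c u v : harmonic pi Delta m u -> harmonic pi Delta m v ->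
  harmonic pi Delta m (c *: u + v).
Proof.
move=> [u_m Du] [v_m Dv]; split; first exact: lin_spanP.
by rewrite (linearP Delta) Du Dv scaler0 addr0.
Qed.

Lemma ezon0 a b : ezon 1 a 0 b = x 1 ^+ a * x (mir 1) ^+ b.
Proof. by rewrite /ezon mulr1. Qed.

Lemma homog_ezon a l b m : (a + l.*2 + b = m)%N -> homog pi m (ezon 1 a l b).
Proof. by move=> <-; apply: graded_homog (graded_ezon a l b one_bd). Qed.

Lemma phi_harmonic m m1 m1' : (m1 + m1' = m)%N ->
  harmonic pi Delta m (phi pi P m m1 m1') /\
  QelT m (ezon 1 m1 0 m1' - phi pi P m m1 m1').
Proof.
move=> e; have [Ph _ _] := P_proj m; rewrite /phi -ezon0; apply: Ph.
by apply: homog_ezon; rewrite addn0.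
Qed.

(** The harmonic combination Z is congruent to c e(m1,0,m1') and hence to c phi modulo Q A, so Z = c
    phi by [harmonic_Q0]; c is nonzero because Z is. *)
Lemma phi_comb m m1 m1' : (m1 + m1' = m)%N ->
  lin_span (fun v => exists k, (k <= minn m1 m1')%N /\ v = ezon 1 (m1 - k) k (m1' - k))
    (phi pi P m m1 m1').
Proof.
move=> e; have [z [zK Dz]] := harmonic_comb m1 m1'.
set K := minn m1 m1' in zK Dz *; set Z := \sum_(k < _) _ in Dz.
have Z_span : lin_span (fun v => exists k, (k <= K)%N /\ v = ezon 1 (m1 - k) k (m1' - k)) Z.
  apply: lin_span_sum => k _; apply/lin_spanZ/lin_span_gen.
  by exists k; rewrite -ltnS ltn_ord.
have [c Zc] : exists c, QelT m (Z - c *: ezon 1 m1 0 m1').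
  move: (Z) Z_span; apply: lin_span_ind => [|c u v [c1 e1] [c2 e2]|v [k [le_k ->]]].
  - by exists 0; rewrite scale0r subr0; exact: Qhomog0.
  - exists (c * c1 + c2); have := Qhomog_lin c e1 e2.
    by rewrite scalerBr addrACA -opprD scalerA -scalerDl.
  have [|c Hc] := @ezon_modQ (m1 - k) k (m1' - k) m.
    by move: le_k; rewrite /K; lia.
  by exists c; move: Hc; rewrite !subnK //; move: le_k; rewrite /K; lia.
have Z_m : homog pi m Z.
  move: (Z) Z_span; apply: lin_span_ind => [|c' u v|v [k [le_k ->]]].
  - exact: lin_span0.
  - exact: lin_spanP.
  by apply: homog_ezon; move: le_k; rewrite /K; lia.
have [phi_h phi_Q] := phi_harmonic e.
have Z_phi : Z - c *: phi pi P m m1 m1' = 0.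
  apply: (@harmonic_Q0 m).
    by rewrite addrC -scaleNr; apply: harmonic_lin.
  have := Qhomog_lin c phi_Q Zc.
  by rewrite scalerBr addrC addrA subrK.
(* The terms of Z differ in their exponent of x_1, so a monomial occurring in the last one, whose
   coefficient is 1, occurs in no other. *)
have Z_neq0 : Z != 0.
  have [mu mu1 mu_K] := cf_ezon_neq0 (m1 - K) K (m1' - K).
  apply: contra_neq mu_K => Z0.
  have : cf mu Z = 0 by rewrite Z0 linear0.
  rewrite /Z (linear_sum (cf mu)) big_ord_recr /= (linearZ_LR (cf mu)) /= zK mul1r.
  rewrite big1 ?add0r // => k _; rewrite (linearZ_LR (cf mu)) /=.
  apply/eqP; rewrite mulf_eq0; apply/orP; right; apply: contraT => /cf_ezon_first.
  by rewrite mu1; have := ltn_ord k; rewrite /K; lia.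
have c0 : c != 0.
  apply: contra_neq Z_neq0 => c0; by move: Z_phi; rewrite c0 scale0r subr0.
have -> : phi pi P m m1 m1' = c^-1 *: Z.
  by rewrite (subr0_eq Z_phi) scalerA mulVf // scale1r.
exact: lin_spanZ.
Qed.

(** For even N the last generators act on x_{n-1}, ..., x_{n+2}; these include x_1 and x_{1'}
    exactly when N = 4. *)
Lemma E_ends k : (2 <= k <= n)%N -> N <> 4%N ->
  [/\ Eop U k (x 1) = 0, Eop U k (x (mir 1)) = 0,
      Fop U k (x 1) = 0 & Fop U k (x (mir 1)) = 0].
Proof.
move=> k_bd N4; have b1 : (1 <= 1 <= N)%N by mlia.
have b2 : (1 <= mir 1 <= N)%N by mlia.
case: (eqVneq k n) => [ek|ne_kn]; last first.
  have lt_kn : (1 <= k < n)%N by lia.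
  by rewrite !E_low // !F_low // !ifN //; move: lt_kn k_bd; mlia.
rewrite {k}ek in k_bd *; case oN: {-}oddN.
  by rewrite !E_odd // !F_odd // !ifN //; move: oN k_bd; mlia.
have {}oN := negbT oN.
by rewrite !E_even // !F_even // !ifN //; move: N4 oN k_bd; mlia.
Qed.

Lemma zonal_ezon a l b : N <> 4%N -> zonal U (ezon 1 a l b).
Proof.
move=> N4 k k_bd; have k1 : (1 <= k <= n)%N by lia.
have [E1 E1' F1 F1'] := E_ends k_bd N4.
have k_even : ~~ oddN && (k == n) -> (2 < n)%N by move: N4 k_bd; mlia.
have EQ : Eop U k (Q 2) = 0 by apply: E_Q => //; lia.
have FQ : Fop U k (Q 2) = 0 by apply: F_Q => //; lia.
have EX y c : Eop U k y = 0 -> Eop U k (y ^+ c) = 0.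
  move=> Ey; elim: c => [|c IHc]; first by rewrite (Eop1 U).
  by rewrite exprS (EopM U) // Ey IHc mul0r mulr0 addr0.
have FX y c : Fop U k y = 0 -> Fop U k (y ^+ c) = 0.
  move=> Fy; elim: c => [|c IHc]; first by rewrite (Fop1 U).
  by rewrite exprS (FopM U) // Fy IHc mul0r mulr0 addr0.
split.
- by rewrite /ezon !(EopM U) // !EX // !(mul0r, mulr0, addr0).
- by rewrite /ezon !(FopM U) // !FX // !(mul0r, mulr0, addr0).
rewrite (K_graded k1 (graded_ezon a l b one_bd)).1.
rewrite (_ : wtw _ _ = 0) ?expr0z ?scale1r // /wtw.
case: ltnP => lt_kn.
  by rewrite !ifN ?subrr //; lia.
case: ifP => oN; first by rewrite ifN //; lia.
by rewrite !ifN ?addr0 //; move: N4 k_bd oN; mlia.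
Qed.

Lemma zonal_phi m m1 m1' : (m1 + m1' = m)%N -> N <> 4%N -> zonal U (phi pi P m m1 m1').
Proof.
move=> e N4; move: (phi _ _ _ _ _) (phi_comb e).
apply: lin_span_ind => [|c u v zu zv|v [k [_ ->]]].
- by move=> i _; rewrite !linear0.
- move=> i i_bd; have [u1 u2 u3] := zu i i_bd; have [v1 v2 v3] := zv i i_bd.
  rewrite (linearP (Eop U i)) (linearP (Fop U i)) (linearP (Kop U i)).
  by rewrite u1 u2 u3 v1 v2 v3 scaler0 addr0.
exact: zonal_ezon.
Qed.

Definition wt1 (a : int) : nat -> int := fun k => if k == 1%N then a else 0.

Lemma graded_phi m m1 m1' : (m1 + m1' = m)%N ->
  graded 1 m (wt1 (m1%:Z - m1'%:Z)) (phi pi P m m1 m1').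
Proof.
move=> e; move: (phi _ _ _ _ _) (phi_comb e).
apply: lin_span_ind => [|c u v|v [k [le_k ->]]].
- exact: lin_span0.
- exact: lin_spanP.
apply: graded_ext (graded_ezon (m1 - k) k (m1' - k) one_bd); first by lia.
by move=> j _; rewrite /wt1; case: ifP => // _; lia.
Qed.

(** * The star operation, the invariant functional and orthogonality *)

Section Star.

Variables (antilin : bool) (star : A -> A).
Hypothesis star_def : is_star s pi antilin star.

Lemma star1 : star 1 = 1.
Proof.
have [_ _ sM sK _] := star_def.
by rewrite -[RHS]sK -{2}[star 1]mulr1 sM sK mulr1.
Qed.

(** The star of an ordered monomial is a product of multiples of the x_{j'}; [graded_mul] keeps
    track of the grading through its straightening. A span absorbs the scalars, conjugated or
    not. *)
Lemma star_graded d w p : graded 1 d w p -> graded 1 d (fun k => - w k) (star p).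
Proof.
have [sD sZ sM sK sx] := star_def.
have s0 : star 0 = 0.
  by have := sZ 0 0; rewrite scale0r => ->; case: (antilin); rewrite ?rmorph0 scale0r.
move: p; apply: lin_span_ind => [|c u v gu gv|v [nu [<- nu_w ->]]].
- by rewrite s0; exact: lin_span0.
- by rewrite sD sZ; exact: lin_spanP.
apply: (@graded_ext 1 (degI 1 nu) _ (fun k => - wt_hat n oddN k nu)) => //.
  by move=> k k_bd; rewrite nu_w.
rewrite /xmonI /degI.
apply: (@graded_ext 1 _ _ (fun k => - \sum_(1 <= j < (mir 1).+1) (nu j)%:Z * wtx j k)) => //.
  by move=> k k_bd; rewrite sum_wtx.
have : all (fun j => 1 <= j <= N)%N (index_iota 1 (mir 1).+1).
  by apply/allP => j; rewrite mem_index_iota mir1.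
elim: (index_iota _ _) => [|j r IHr] /=.
  move=> _; rewrite [\prod_(_ <- _) _]big_nil star1.
  by apply: graded_ext (graded1 1) => [|k _]; rewrite big_nil ?oppr0.
case/andP=> j_bd /IHr{}IHr; rewrite [\prod_(_ <- _) _]big_cons sM.
have gx : graded 1 (nu j) (fun k => - ((nu j)%:Z * wtx j k)) (star (x j ^+ nu j)).
  elim: (nu j) => [|c IHc].
    by rewrite star1; apply: graded_ext (graded1 1) => // k _; rewrite mul0r oppr0.
  rewrite exprSr sM sx // -scalerAl; apply: lin_spanZ.
  have j'_bd : (1 <= mir j <= N)%N by move: j_bd; mlia.
  apply: graded_ext (graded_mul _ (graded_x j'_bd) IHc) => // k k_bd.
  by rewrite /wtx mirK // -addn1 PoszD mulrDl mul1r opprD opprB addrC.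
apply: graded_ext (graded_mul _ IHr gx) => // [|k _].
  by rewrite big_cons addnC.
by rewrite big_cons opprD addrC.
Qed.

Section Sphere.

Variables (FS : algType C) (tau : {lrmorphism A -> FS}) (h : {scalar FS}).
Hypothesis h_def : is_invariant_functional q s pi tau h.

Lemma h_graded0 d w p : graded 1 d w p -> w 1%N != 0 -> h (tau p) = 0.
Proof.
move=> gp w1; move: p gp; apply: lin_span_ind => [|c u v eu ev|v [nu [_ nu_w ->]]].
- by rewrite (linear0 tau) (linear0 h).
- by rewrite (linearP tau) (linearP h) eu ev mulr0 addr0.
rewrite xmonI1 h_def; case: ifP => // /andP[/allP bal _].
have /eqP e := bal 1%N ltac:(by rewrite mem_iota; have := n_gt0; lia).
by move: w1; rewrite -nu_w ?one_bd // /wt_hat e subrr eqxx.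
Qed.

Lemma phi_orthogonal m m1 m1' k1 k1' : (m1 + m1' = m)%N -> (k1 + k1' = m)%N ->
  (m1, m1') <> (k1, k1') ->
  sprod tau star h (phi pi P m m1 m1') (phi pi P m k1 k1') = 0.
Proof.
move=> em ek ne; rewrite /sprod -(rmorphM tau).
have g1 := star_graded (graded_phi em); have g2 := graded_phi ek.
apply: (h_graded0 (graded_mul _ g1 g2)) => //.
(* The weight of the product is (k1 - k1') - (m1 - m1'). As m1 + m1' = k1 + k1', it vanishes only
   for equal pairs. *)
rewrite /wt1 eqxx; apply/eqP => e0; apply: ne.
have -> : m1 = k1 by lia.
by have -> : m1' = k1' by lia.
Qed.

End Sphere.

End Star.

(** * Fullness: zonal elements are combinations of the e(a,l,b) *)

Lemma cf_ext d p mu mu' : homog pi d p -> agree 1 mu mu' -> cf mu p = cf mu' p.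
Proof.
move=> gp /agreeP e; move: p gp; apply: lin_span_ind => [|c u v eu ev|v [nu [_ ->]]].
- by rewrite !linear0.
- by rewrite !(linearP (cf _)) eu ev.
rewrite !cfE; congr (nat_of_bool _)%:R.
by apply/agreeP/agreeP => H k k_bd; rewrite -H // e.
Qed.

Lemma K_fix_wt d i p mu : (1 <= i <= n)%N -> homog pi d p -> Kop U i p = p ->
  cf mu p != 0 -> wt n oddN i mu = 0.
Proof.
move=> i_bd gp Kp cf_neq0; apply/eqP; rewrite -expqz_eq1.
suff e : cf mu (Kop U i p) = q ^ wt n oddN i mu * cf mu p.
  by move: e; rewrite Kp -{1}[cf mu p]mul1r => /(mulIf cf_neq0) <-.
move: p gp {Kp cf_neq0}; apply: lin_span_ind => [|c u v eu ev|v [nu [_ ->]]].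
- by rewrite !linear0 mulr0.
- by rewrite (linearP (Kop U i)) !(linearP (cf mu)) /= eu ev; ring.
rewrite (Kop_mon U) // (linearZ_LR (cf mu)) /= !cfE; case: agreeP => [e|_]; last by rewrite !mulr0.
congr (q ^ _ * _); rewrite /wt /wt_hat.
case: ltnP => lt_in; first by rewrite !e //; move: i_bd lt_in; mlia.
case: ifP => oN; first by rewrite !e //; move: i_bd; mlia.
by rewrite !e //; move: N_ge3 oN i_bd; mlia.
Qed.

(** The weight of \hat K_n vanishes first: it is that of K_n for odd N; for even N its double is the
    difference of those of K_n and K_{n-1}, and K_{n-1} is available only if n > 2. The remaining
    \hat K_k follow downwards. *)
Lemma zonal_wt d p mu : (1 < n)%N -> N <> 4%N -> homog pi d p -> zonal U p ->
  cf mu p != 0 -> forall k, (2 <= k <= n)%N -> mu k = mu (mir k).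
Proof.
move=> n_gt1 N4 gp zp cf_neq0.
have wt0 i : (2 <= i <= n)%N -> wt n oddN i mu = 0.
  by move=> i_bd; have [_ _ Kp] := zp i i_bd; apply: K_fix_wt gp Kp cf_neq0; lia.
have hat_n : wt_hat n oddN n mu = 0.
  have := wt0 n; rewrite /wt ltnn; case oN: {-}oddN.
    by rewrite ifT // => ->; lia.
  rewrite ifF // => /(_ ltac:(lia)) e1.
  have n_gt2 : (2 < n)%N by move: N4 n_gt1 oN; mlia.
  have := wt0 n.-1 ltac:(lia); rewrite /wt ifT ?prednK //; try lia.
have hat k : (k <= n - 2)%N -> wt_hat n oddN (n - k)%N mu = 0.
  elim: k => [|k IHk] le_k; first by rewrite subn0.
  have := wt0 (n - k.+1)%N ltac:(lia); rewrite /wt ifT; last by lia.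
  by rewrite (_ : (n - k.+1).+1 = n - k)%N ?IHk ?subr0 //; lia.
move=> k k_bd; have := hat (n - k)%N ltac:(lia); rewrite subKn; last by lia.
by rewrite /wt_hat; lia.
Qed.

Definition ezon_span m := lin_span (fun v => exists a l b,
  (a + l.*2 + b = m)%N /\ v = ezon 1 a l b).

Lemma zonal_span m p : (1 < n)%N -> N <> 4%N -> homog pi m p -> zonal U p ->
  ezon_span m p.
Proof.
move=> n_gt1 N4 gp zp.
pose ok (t : 'I_m.+1 * 'I_m.+1) := (t.1 + (t.2 : nat).*2 <= m)%N.
pose b (t : 'I_m.+1 * 'I_m.+1) := (m - (t.1 + (t.2 : nat).*2))%N.
pose mu0 (t : 'I_m.+1 * 'I_m.+1) := upd 1 t.1 (b t) (upd 2 t.2 t.2 (fun=> 0%N)).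
(* [alp 2 ^+ l] is the coefficient of x_2^l x_{2'}^l in Q_2^l, so p - S has coefficient zero at all
   the monomials [mu0 t] with [ok t], and [zonal_init] applies to it. *)
pose c (t : 'I_m.+1 * 'I_m.+1) := cf (mu0 t) p / alp 2 ^+ t.2.
pose S := \sum_(t | ok t) c t *: ezon 1 t.1 t.2 (b t).
have gS : ezon_span m S.
  rewrite /S /index_enum big_mkcond; apply: lin_span_sum => t _.
  case: ifP => ok_t; last exact: lin_span0.
  apply/lin_spanZ/lin_span_gen; exists t.1, t.2, (b t); split=> //.
  exact: subnKC ok_t.
have S_prop v : ezon_span m v -> homog pi m v /\ zonal U v.
  move: v; apply: lin_span_ind => [|d u w [gu zu] [gw zw]|w [a [l [b' [e ->]]]]].
  - by split; [exact: lin_span0 | move=> i _; rewrite !linear0].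
  - split=> [|i i_bd]; first exact: lin_spanP.
    have [u1 u2 u3] := zu i i_bd; have [v1 v2 v3] := zw i i_bd.
    rewrite (linearP (Eop U i)) (linearP (Fop U i)) (linearP (Kop U i)).
    by rewrite u1 u2 u3 v1 v2 v3 scaler0 addr0.
  by split; [exact: homog_ezon | exact: zonal_ezon].
have [S_m S_z] := S_prop S gS.
suff -> : p = S by [].
apply: subr0_eq; have gD : homog pi m (p - S).
  by rewrite -scaleN1r addrC; exact: lin_spanP.
have zD : zonal U (p - S).
  move=> i i_bd; have [u1 u2 u3] := zp i i_bd; have [v1 v2 v3] := S_z i i_bd.
  rewrite (linearB (Eop U i)) (linearB (Fop U i)) (linearB (Kop U i)).
  by rewrite u1 u2 u3 v1 v2 v3 subr0.
apply: (homog_cf0 gD); apply: (@zonal_init _ m) => //.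
- by move=> k k_bd; have [-> _ _] := zD k ltac:(lia).
- by move=> _; have [-> _ _] := zD n ltac:(lia).
- by move=> mu cf_neq0; apply: zonal_wt gD zD cf_neq0.
move=> mu mu_in mu2; apply/eqP; apply: contraT => cf_neq0.
have deg_mu := homog_graded0 gD cf_neq0.
have two_bd : (1 <= 2 <= n)%N by lia.
have deg_e : (mu 1 + (mu 2).*2 + mu N = m)%N.
  rewrite -deg_mu degI_split ?one_bd // degI_split // mir1 -mu2.
  rewrite [degI 3 mu](_ : _ = 0%N) ?addn0 ?addnn //.
  by rewrite /degI big_nat big1 // => k k_bd; apply: mu_in; lia.
have lt1 : (mu 1%N < m.+1)%N by lia.
have lt2 : (mu 2%N < m.+1)%N by lia.
pose t0 := (Ordinal lt1, Ordinal lt2).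
have ok0 : ok t0 by rewrite /ok /t0 /=; lia.
have bt0 : b t0 = mu N by rewrite /b /t0 /=; lia.
move: cf_neq0; rewrite (linearB (cf mu)) /= /S (linear_sum (cf mu)) (bigD1 t0) //=.
rewrite (linearZ_LR (cf mu)) /= cf_ezon // bt0 !eqxx /=.
rewrite big1 ?addr0 => [|t /andP[ok_t ne_t]]; last first.
  rewrite (linearZ_LR (cf mu)) /= cf_ezon // ifF ?mulr0 //.
  apply: contraNF ne_t => /and3P[/eqP e1 _ /eqP e2].
  by apply/eqP; case: t e1 e2 {ok_t} => [t1 t2] /= e1 e2; congr (_, _); apply: val_inj.
rewrite /c divfK; last by rewrite expf_neq0 // alp_neq0.
rewrite (cf_ext gp (mu' := mu)) ?subrr ?eqxx //; apply/agreeP => k k_bd.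
rewrite /mu0 bt0 /= /upd mir1; case: eqVneq => [->//|k1]; case: eqVneq => [->//|kN].
case: eqVneq => [->//|k2]; case: eqVneq => [->|k2']; first by rewrite -mu2.
by rewrite mu_in //; move: k1 kN k2 k2' k_bd; mlia.
Qed.

(** The e(a,l,b) are not zonal here in general, so p is compared with a power of Q instead, which
    E_2 does kill and which [Q_pow] expands in the e(j,l,j). *)
Lemma zonal_span4 m p : N = 4%N -> homog pi m p -> zonal U p -> ezon_span m p.
Proof.
move=> N4 gp zp.
have [n2 oN] : n = 2%N /\ ~~ oddN by move: N4; rewrite /dimN; move: (leq_b1 oddN) => ? ?; split; lia.
have two_bd : (2 <= n <= n)%N by rewrite n2.
have n_gt1 : (1 < n)%N by rewrite n2.
have [Ep _ Kp] := zp n two_bd.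
pose k := m./2; pose mu0 := upd 1 k k (fun=> 0%N).
(* For even m this matches the coefficient at x_1^k x_4^k, which is [alp 1 ^+ k] in Q^k. For odd m
   the power Q^k has the wrong degree, and p itself turns out to be zero. *)
pose c := if odd m then 0 else cf mu0 p / alp 1 ^+ k.
have gQ : graded 1 k.*2 (fun=> 0) (Q 1 ^+ k) by apply: graded_QX.
have gcQ : homog pi m (c *: Q 1 ^+ k).
  rewrite /c; case: ifP => odd_m; first by rewrite scale0r; exact: lin_span0.
  apply: lin_spanZ; have -> : m = k.*2 by rewrite /k even_halfK // odd_m.
  exact: graded_homog gQ.
have gD : homog pi m (p - c *: Q 1 ^+ k).
  by rewrite addrC -scaleN1r; exact: lin_spanP.
have [m1 m2 m3] : [/\ mir 1 = 4, mir 2 = 3 & mir 3 = 2]%N by rewrite /Defs.mir N4.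
have wt4 d w v mu : graded 1 d w v -> w 1%N = 0 -> w 2%N = 0 -> cf mu v != 0 ->
    (mu 1 + mu 2 = mu 3 + mu 4)%N.
  move=> gv w1 w2 /(cf_graded gv)[_ W].
  have := W 1%N ltac:(lia); have := W 2%N ltac:(lia).
  by rewrite w1 w2 /wt_hat m1 m2; lia.
suff e : p = c *: Q 1 ^+ k.
  rewrite e /c; case: ifP => odd_m; first by rewrite scale0r; exact: lin_span0.
  apply: lin_spanZ; have em : m = k.*2 by rewrite /k even_halfK // odd_m.
  move: (Q 1 ^+ k) (Q_pow k one_bd); apply: lin_span_ind => [|d u w gu gw|w [j [l [e' ->]]]].
  - exact: lin_span0.
  - exact: lin_spanP.
  by apply: lin_span_gen; exists j, l, j; split=> //; rewrite em -e'; lia.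
apply: subr0_eq; apply: (homog_cf0 gD); apply: (@zonal_init4 _ m) => //.
- rewrite (linearB (Eop U n)) (linearZ_LR (Eop U n)) /= Ep.
  have EQ : Eop U n (Q 1) = 0 by apply: E_Q => //; rewrite ?n2.
  have -> : Eop U n (Q 1 ^+ k) = 0; last by rewrite scaler0 subr0.
  elim: (k) => [|j IHj]; first by rewrite (Eop1 U) //; lia.
  by rewrite exprS (EopM U) ?EQ ?IHj ?mul0r ?mulr0 ?addr0 //; lia.
- move=> mu; rewrite (linearB (cf mu)) (linearZ_LR (cf mu)) /=.
  case: (eqVneq (cf mu (Q 1 ^+ k)) 0) => [->|Q_neq0 _]; last exact: (wt4 _ _ _ _ gQ).
  rewrite mulr0 subr0 => cf_neq0.
  have := K_fix_wt (i := n) ltac:(lia) gp Kp cf_neq0.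
  rewrite /wt ltnn ifN // /wt_hat.
  have -> : n.-1 = 1%N by rewrite n2.
  have -> : mir n = 3%N by rewrite /Defs.mir N4 n2.
  have -> : mu n = mu 2%N by rewrite n2.
  by rewrite m1; lia.
move=> mu mu14 mu2 mu3; apply/eqP; apply: contraT => cf_neq0.
have deg_mu := homog_graded0 gD cf_neq0.
have em : m = (mu 1%N).*2.
  rewrite -deg_mu degI1 /mdegree N4 /index_iota /= !big_cons big_nil.
  by rewrite mu2 mu3 -mu14; lia.
have ek : k = mu 1%N by rewrite /k em doubleK.
move: cf_neq0; rewrite (linearB (cf mu)) (linearZ_LR (cf mu)) /= ek.
have := @lead_functional idfun (cf mu) 1 (mu 1%N) one_bd; rewrite /= => ->; last first.
  move=> j l e; apply/eqP; apply: contraT => /cf_ezon_first e1.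
  by move: e; rewrite e1; lia.
rewrite -ezon0 cf_ezon //; last first.
- by rewrite m2 mu2 mu3.
- by move=> j; rewrite m3; lia.
rewrite N4 -mu14 mu2 !eqxx /= expr0 mulr1 /c em odd_double ek.
rewrite divfK; last by rewrite expf_neq0 // alp_neq0 // n_gt0.
rewrite (cf_ext gp (mu' := mu)) ?subrr ?eqxx //; apply/agreeP => j j_bd.
rewrite /mu0 /upd mir1 N4; case: eqVneq => [->//|j1].
case: eqVneq => [->|j4]; first by rewrite -mu14.
have [->|->] : j = 2%N \/ j = 3%N by move: j_bd j1 j4; rewrite N4; lia.
  by rewrite mu2.
by rewrite mu3.
Qed.

Lemma ezon_span_mod m v : ezon_span m v -> exists c : 'I_m.+1 -> C,
  QelT m (v - \sum_(i < m.+1) c i *: phi pi P m i (m - i)).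
Proof.
move: v; apply: lin_span_ind => [|c u v [c1 H1] [c2 H2]|v [a [l [b [e ->]]]]].
- exists (fun=> 0); rewrite big1 ?subr0; first exact: Qhomog0.
  by move=> i _; rewrite scale0r.
- exists (fun i => c * c1 i + c2 i); have := Qhomog_lin c H1 H2.
  rewrite scalerBr addrACA -opprD scaler_sumr -big_split /=.
  by under eq_bigr do rewrite scalerA -scalerDl.
have [c Hc] := ezon_modQ e.
have lt_al : (a + l < m.+1)%N by lia.
exists (fun i => if i == Ordinal lt_al then c else 0).
rewrite (bigD1 (Ordinal lt_al)) //= eqxx big1 ?addr0 => [|i /negbTE->]; last by rewrite scale0r.
have ebl : (m - (a + l) = b + l)%N by lia.
have [_ Hphi] := @phi_harmonic m (a + l) (b + l) ltac:(lia).
rewrite ebl; have := Qhomog_lin c Hphi Hc.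
by rewrite scalerBr addrC addrA subrK.
Qed.

(** Modulo Q A each e(a,l,b) is a multiple of some phi, so p minus a combination of the phi is both
    harmonic and in Q A, hence zero. This covers N = 4 as well, where the phi are harmonic but need
    not be zonal. *)
Lemma zonal_full m p : N <> 3%N -> harmonic pi Delta m p -> zonal U p ->
  exists c : 'I_m.+1 -> C, p = \sum_(i < m.+1) c i *: phi pi P m i (m - i).
Proof.
move=> N3 hp zp; have [gp _] := hp.
have n_gt1 : (1 < n)%N by move: N_ge3 N3; mlia.
have sp : ezon_span m p.
  by case: (eqVneq N 4%N) => [N4|/eqP N4]; [exact: zonal_span4 | exact: zonal_span].
have [c Hc] := ezon_span_mod sp; exists c; apply: subr0_eq.
apply: harmonic_Q0 Hc; rewrite addrC -scaleN1r; apply: harmonic_lin => //.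
apply: (big_ind (harmonic pi Delta m)).
- by split; [exact: lin_span0 | exact: linear0].
- by move=> u v hu hv; rewrite -[u]scale1r; apply: harmonic_lin.
move=> i _; rewrite -[_ *: _]addr0; apply: harmonic_lin.
  by have [] := @phi_harmonic m i (m - i) ltac:(have := ltn_ord i; lia).
by split; [exact: lin_span0 | exact: linear0].
Qed.

End Projector.

End Coefficients.

End Action.

End Laplacian.

End Algebra.

End QuantumSphere.

Theorem theorem1 (R : realType) (n : nat) (oddN : bool) (q s : R[i])
    (N_ge3 : (3 <= dimN n oddN)%N)
    (q_neq0 : q != 0) (q_nroot : forall k : nat, (0 < k)%N -> q ^+ k != 1)
    (s_sqrt : s ^+ 2 = q)
    (A : algType R[i]) (pi : {lrmorphism free_alg R[i] (dimN n oddN) -> A})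
    (A_pres : is_quotient_by pi (qrelator (n := n) (oddN := oddN) q s))
    (Delta : {linear A -> A}) (Delta_def : is_qlaplace q s pi Delta)
    (P : nat -> A -> A)
    (P_proj : forall m, is_harmonic_projector s pi Delta m (P m))
    (U : so_action q s pi)
    (antilin : bool) (star : A -> A) (star_def : is_star s pi antilin star)
    (FS : algType R[i]) (tau : {lrmorphism A -> FS})
    (tau_quot : is_sphere s pi tau)
    (h : {scalar FS}) (h_def : is_invariant_functional q s pi tau h)
    (m : nat) :
  [/\ (* the phi^m_{m1 m1'} lie in H_m and are zonal *)
      forall m1 m1' : nat, (m1 + m1' = m)%N ->
        harmonic pi Delta m (phi pi P m m1 m1') /\
        (dimN n oddN <> 4%N -> zonal U (phi pi P m m1 m1')),
      (* orthogonality *)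
      forall m1 m1' k1 k1' : nat, (m1 + m1' = m)%N -> (k1 + k1' = m)%N ->
        (m1, m1') <> (k1, k1') ->
        sprod tau star h (phi pi P m m1 m1') (phi pi P m k1 k1') = 0
    & (* fullness *)
      dimN n oddN <> 3%N ->
      forall p : A, harmonic pi Delta m p -> zonal U p ->
        exists c : 'I_m.+1 -> R[i],
          p = \sum_(i < m.+1) c i *: phi pi P m i (m - i)].
Proof.
have [cf cfE] := coef_exists N_ge3 q_neq0 q_nroot s_sqrt A_pres.
split=> [m1 m1' em|m1 m1' k1 k1' em ek ne|N3 p p_h p_z].
- split=> [|N4 i i_bd].
    by have [] := phi_harmonic N_ge3 q_neq0 q_nroot s_sqrt A_pres P_proj em.
  exact: (zonal_phi N_ge3 q_neq0 q_nroot s_sqrt A_pres Delta_def U cfE P_proj em N4 i_bd).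
- exact: (phi_orthogonal N_ge3 q_neq0 q_nroot s_sqrt A_pres Delta_def cfE P_proj
    star_def h_def em ek ne).
exact: (zonal_full N_ge3 q_neq0 q_nroot s_sqrt A_pres cfE P_proj N3 p_h p_z).
Qed.
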